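(* Let $(\psi,\phi)\in\mathcal N\times\mathcal B$ and let $P$ be the CBI$(\psi,\phi)$ semigroup. Then $P$ admits a unique invariant probability measure $\mathcal V$ on $[0,\infty)$. Moreover $P$ is exponentially ergodic, in the sense that there exist $C>0$ and $\overline B>0$ such that, for any $x\ge0$ and any $t>\underline T=T_0+\frac1m\ln(2-A(-R_A))$, $$\|P_t(x,\cdot)-\mathcal V(\cdot)\|_{\mathrm{TV}}\le Ce^{\overline Bx}\,\frac{e^{-m(t-\underline T)}}{1-e^{-m(t-\underline T)}}.$$
   Context: Notation. $\mathbb R^+=(0,\infty)$; $e_\lambda(x)=e^{-\lambda x}$. $\mathcal H(R)$ is the set of functions holomorphic on the open disc $D(0,R)$, with the understanding that $R$ is the radius of convergence of their Taylor series at $0$. For a signed measure $\mu$ on $[0,\infty)$, $\|\mu\|_{\mathrm{TV}}=\sup_E|\mu(E)|$, the supremum over Borel sets $E\subseteq[0,\infty)$. Mechanisms. $\mathcal N$ is the set of $\psi(u)=\sigma^2u^2+mu+\int_0^\infty(e^{-ur}-1+ur)\Pi(dr)$, $u\ge0$, with $\sigma\ge0$, $m>0$, $\Pi$ a non-negative Borel measure on $\mathbb R^+$, such that $\int^\infty\frac{du}{\psi(u)}<\infty$ and $\psi\in\mathcal H(R_\psi)$ for some $R_\psi>0$. $\mathcal B$ is the set of $\phi(u)=bu+\int_0^\infty(1-e^{-ur})\mu(dr)$, $u\ge0$, with $b\ge0$, $\mu$ a non-negative Borel measure on $\mathbb R^+$ with $\int_0^\infty(1\wedge r)\mu(dr)<\infty$,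 such that $\phi\in\mathcal H(R_\phi)$ for some $R_\phi>0$. Auxiliary functions. $A(\lambda)=\exp\big(-m\int_\lambda^\infty\frac{du}{\psi(u)}\big)$ is an increasing bijection $[0,\infty)\to[0,1)$ with inverse $B$; $A$ is analytic at $0$, $R_A>0$ denotes the radius of convergence of its Taylor series at $0$, and $A$ extends to a real-analytic strictly increasing function on $(-R_A,\infty)$; $A(-R_A)=\lim_{\lambda\downarrow-R_A}A(\lambda)\in[-\infty,0)$ (so $\underline T=\infty$ if this limit is $-\infty$); $B$ also denotes its analytic extension near $0$. $\Phi_\nu(\lambda)=\int_0^\lambda\frac{\phi(u)}{\psi(u)}du$. $G_x(z)=e^{-xB(z)+\Phi_\nu(B(z))}$. $R_0\in(0,1]$ is a number, independent of $x$, such that $G_x\in\mathcal H(R_0)$ for all $x\ge0$ (with $B$ and $\Phi_\nu\circ B$ holomorphic on $D(0,R_0)$), and $T_0=-\ln(R_0)/m$. The CBI$(\psi,\phi)$ semigroup $P$ is the Feller (strongly continuous non-negative contraction) semigroup on $C_0([0,\infty))$ determined by $P_te_\lambda(x)=e^{-\Phi_\nu(\lambda)}G_x(A(\lambda)e^{-mt})$ for $t,x,\lambda\ge0$, with transition kernel $P_t(x,dy)$. A probability measure $\mathcal V$ is invariant if $\int P_tf\,d\mathcal V=\int f\,d\mathcal V$ for all $f\in C_0([0,\infty))$ and $t\ge0$. *)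

(* Defs.v *)
(* MathComp-Analysis, over an arbitrary R : realType. *)
From HB Require Import structures.
From mathcomp Require Import all_boot all_order all_algebra.
From mathcomp Require Import all_classical all_reals all_analysis.
From mathcomp Require Import complex.

Set Implicit Arguments.
Unset Strict Implicit.
Unset Printing Implicit Defensive.

Import Order.TTheory GRing.Theory Num.Theory.
Import numFieldNormedType.Exports.

Local Open Scope classical_set_scope.
Local Open Scope ring_scope.

(* R[i] packed as a numClosedFieldType: in this form it carries the topology
   of a numFieldType, so that [derivable F z 1] is complex differentiability. *)
Definition cplx (R : realType) : numClosedFieldType := R[i].

Definition embC (R : realType) (x : R) : cplx R := real_complex R x.

Definition disc (R : realType) (r : \bar R) : set (cplx R) :=
  [set z | ((ComplexField.Normc.normc z)%:E < r)%E].

Definition taylor_coef (R : realType) (F : cplx R -> cplx R) (n : nat) : cplx R :=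
  derive1n n F 0 / n`!%:R.

Definition conv_radius (R : realType) (c : nat -> cplx R) : \bar R :=
  ereal_sup [set r%:E | r in [set r : R | 0 <= r /\
    cvgn (series (fun n => ComplexField.Normc.normc (c n) * r ^+ n))]].

(* [F] is complex differentiable on D(0, r) and is there the sum of its Taylor
   series at 0, as every holomorphic function on a disc is. *)
Definition holomorphic_disc (R : realType) (r : \bar R)
    (F : cplx R -> cplx R) : Prop :=
  forall z, disc r z ->
    derivable F z 1 /\
    series (fun n => taylor_coef F n * z ^+ n) @ \oo --> F z.

(* The set H(r): [r] is exactly the radius of convergence. *)
Definition calH (R : realType) (r : \bar R) (F : cplx R -> cplx R) : Prop :=
  holomorphic_disc r F /\ conv_radius (taylor_coef F) = r.

(* [F] agrees on the real points of [0, r) with [f], of which only the values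
   on that interval matter. *)
Definition extends (R : realType) (r : \bar R) (F : cplx R -> cplx R)
    (f : R -> R) : Prop :=
  forall u : R, 0 <= u -> (u%:E < r)%E -> F (embC u) = embC (f u).

Definition analytic_at0 (R : realType) (f : R -> R) : Prop :=
  exists2 r : \bar R, (0 < r)%E & exists2 F, calH r F & extends r F f.

Definition holomorphic_ext (R : realType) (r : \bar R) (f : R -> R) : Prop :=
  exists2 F, holomorphic_disc r F & extends r F f.

(* Measures on (0, oo) are measures on R of which only the restriction to
   ]0, +oo[ is used; mechanisms are only constrained on [0, oo). *)

(* [psi] belongs to the class N, with linear coefficient [m]. *)
Definition classN (R : realType) (m : R) (psi : R -> R) : Prop :=
  exists (sigma : R) (Pi : {measure set R -> \bar R}),
  [/\ 0 <= sigma /\ 0 < m,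
      forall u, 0 <= u ->
        Pi.-integrable `]0, +oo[
          (fun r => (expR (- (u * r)) - 1 + u * r)%:E),
      forall u, 0 <= u ->
        psi u = sigma ^+ 2 * u ^+ 2 + m * u
          + \int[Pi]_(r in `]0, +oo[) (expR (- (u * r)) - 1 + u * r),
      exists2 a : R, 0 < a &
        (\int[lebesgue_measure]_(u in `[a, +oo[) ((psi u)^-1)%:E < +oo)%E
    & analytic_at0 psi].

Definition classB (R : realType) (phi : R -> R) : Prop :=
  exists (b : R) (mu : {measure set R -> \bar R}),
  [/\ 0 <= b,
      (\int[mu]_(r in `]0%R, +oo[) (Num.min 1 r)%:E < +oo)%E,
      forall u, 0 <= u ->
        phi u = b * u + \int[mu]_(r in `]0, +oo[) (1 - expR (- (u * r)))
    & analytic_at0 phi].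

(* The integral is +oo at l = 0, whence an extended real exponent and
   A(0) = 0. *)
Definition funA (R : realType) (m : R) (psi : R -> R) (l : R) : R :=
  fine (expeR (- (m%:E *
    \int[lebesgue_measure]_(u in `]l, +oo[) ((psi u)^-1)%:E))%E).

Definition funB (R : realType) (m : R) (psi : R -> R) : R -> R :=
  'pinv_(fun=> 0) (`[0, +oo[ : set R) (funA m psi).

Definition Phi_nu (R : realType) (psi phi : R -> R) (l : R) : R :=
  \int[lebesgue_measure]_(u in `[0, l]) (phi u / psi u).

Definition funG (R : realType) (m : R) (psi phi : R -> R) (x z : R) : R :=
  expR (- (x * funB m psi z) + Phi_nu psi phi (funB m psi z)).

(* The limit at - RA from the right of the extension of A, where [FA] is the
   holomorphic function of radius of convergence [RA] that extends A. *)
Definition A_at_minus (R : realType) (RA : \bar R) (FA : cplx R -> cplx R) :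
    \bar R :=
  let Aext (u : R) : \bar R := (complex.Re (FA (embC u)))%:E in
  if RA is r%:E then lim (Aext u @[u --> (- r)^'+])
  else lim (Aext u @[u --> -oo%R]).

Definition T_zero (R : realType) (m R0 : R) : R := - ln R0 / m.

Definition T_lower (R : realType) (m R0 : R) (RA : \bar R)
    (FA : cplx R -> cplx R) : \bar R :=
  ((T_zero m R0)%:E + (m^-1)%:E * lne (2%:E - A_at_minus RA FA))%E.

Definition C0 (R : realType) (f : R -> R) : Prop :=
  {within `[0, +oo[, continuous f} /\ f x @[x --> +oo] --> 0.

Definition semigroup_op (R : realType) (P : R -> R.-spker R ~> R) (t : R)
    (f : R -> R) (x : R) : R :=
  \int[P t x]_(y in `[0, +oo[) f y.

(* A Feller semigroup on C_0([0, oo)), given by its transition kernel: only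
   [P t x] with t, x >= 0 matters, and it lives on [0, oo).  Non-negativity and
   contractivity hold because the [P t x] are sub-probability measures. *)
Record feller_semigroup (R : realType) (P : R -> R.-spker R ~> R) : Prop := {
  feller_support : forall t x, 0 <= t -> 0 <= x -> P t x `]-oo, 0[%classic = 0%E ;
  feller_C0 : forall t f, 0 <= t -> C0 f -> C0 (semigroup_op P t f) ;
  feller_id : forall f x, C0 f -> 0 <= x -> semigroup_op P 0 f x = f x ;
  feller_comp : forall s t f x, 0 <= s -> 0 <= t -> C0 f -> 0 <= x ->
    semigroup_op P (s + t) f x = semigroup_op P s (semigroup_op P t f) x ;
  feller_cont : forall f, C0 f -> forall e, 0 < e ->
    \forall t \near 0^'+, forall x, 0 <= x ->
      `|semigroup_op P t f x - f x| <= e }.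

Definition cbi_semigroup (R : realType) (m : R) (psi phi : R -> R)
    (P : R -> R.-spker R ~> R) : Prop :=
  feller_semigroup P /\
  forall t x l, 0 <= t -> 0 <= x -> 0 <= l ->
    semigroup_op P t (fun y => expR (- (l * y))) x =
    expR (- Phi_nu psi phi l) *
      funG m psi phi x (funA m psi l * expR (- (m * t))).

Definition invariant_measure (R : realType) (P : R -> R.-spker R ~> R)
    (V : probability R R) : Prop :=
  V `]-oo, 0[%classic = 0%E /\
  forall t f, 0 <= t -> C0 f ->
    \int[V]_(x in `[0, +oo[) semigroup_op P t f x =
    \int[V]_(x in `[0, +oo[) f x.

Definition tv_norm (R : realType) (mu : set R -> \bar R) : \bar R :=
  ereal_sup [set `|mu E|%E | E in
    [set E : set R | measurable E /\ E `<=` `[0, +oo[]].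

(* Main.v *)
From HB Require Import structures.
Require Import Defs.
From mathcomp Require Import all_boot all_order all_algebra.
From mathcomp Require Import all_classical all_reals all_analysis.
From mathcomp Require Import complex measurable_realfun.
From mathcomp Require Import ring lra.
Import Order.TTheory GRing.Theory Num.Theory.
Import numFieldNormedType.Exports.
Local Open Scope classical_set_scope.
Local Open Scope ring_scope.

(** Write [e_l] for [y |-> exp (- l y)], and say that [h] has norm at most [K] when
    [|sum c_i h l_i| <= K sup_{y >= 0} |sum c_i e_{l_i} y|] for every exponential
    sum.  The norm is submultiplicative: shifting the argument of an exponential
    sum by [y] multiplies its weights by [e_{l_i} y].  The same remark makes the
    class of "Laplace-positive" [h], those with [sum c_i h l_i >= 0] as soon as
    [sum c_i e_{l_i} >= 0] on [0, oo), closed under products.  So neither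
    convolutions nor Bernstein's representation theorem are needed.

    The Levy-Khintchine form of [psi] makes suitable explicit Euler steps for
    [v' = - psi v] Bernstein functions; rescaled, the scheme converges to a
    multiple of [A], so [A] is a Bernstein function.  As [A] tends to 1 at
    infinity, [1 - A] is Laplace-positive with value 1 at 0 (it is the Laplace
    transform of the Yaglom limit), whence [A^n] has norm at most [2^n].
    Now [P_t e_l x = e^(- Phi l) exp (sum_k g_k e^(- m k t) A(l)^k)] where the
    [g_k] are affine in [x], so [P_t e_l x - e^(- Phi l)] has norm at most
    [q exp (beta x + kappa)] with [q = 2 e^(- m t) / rho], for any [rho < R0].

    Norm bounds on differences of Laplace transforms are bounds in total
    variation, because indicators of Borel sets are limits in mean of exponential
    sums with values in [0, 1].  Hence the [P_t x] are Cauchy in total variation,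
    and their limit is the invariant measure.  Finally [1 - A] Laplace-positive
    gives alternating Taylor coefficients of [A] at 0, hence [A(- R_A) < 0], which
    leaves room for [rho = 2 R0 / (2 - A(- R_A)) < R0]. *)

(** * Positivity, norms and Bernstein functions, tested on exponential sums *)

Section LaplacePositivity.
Context {R : realType}.
Implicit Types (s : seq (R * R)) (h g : R -> R) (D : set R).

(** The flow enters because [A' = m A / psi]: along [v' = - psi v] one has
    [A v_T = e^(- m T) A v_0], while [A u] is close to [a u] near 0, with [a] the derivative there.
    So [A l] is the limit of [a e^(m T) v_T l] and inherits what composition, positive scaling and
    limits preserve. The obstacle is that [u - h psi u] is never Bernstein for [h > 0]:
    integrability of [1 / psi] at infinity makes [psi] outgrow every linear function, and the step
    becomes negative. Hence [psi] is replaced by some [C u - b u], with an error [e (u^2 + u^3)]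
    that is small relative to [psi u >= m u] all the way down to 0; this is what allows running
    times that go to infinity. The factor 2 in [q] is the norm bound for [A = 1 - (1 - A)]. When the
    threshold [T] of the theorem is finite, [q] equals [e^(- m (t - T))] exactly for the final
    choice of [rho], so no constant is lost in the rate. *)

Definition ev s h : R := \sum_(p <- s) p.1 * h p.2.

Definition expo (y l : R) : R := expR (- (l * y)).

Definition nodes D s := forall p, p \in s -> 0 <= p.2 /\ D p.2.

(** [D] localizes the nodes, for functions whose Taylor series is known on an interval [[0, r)]
    only. *)
Definition lap_pos D h := forall s, nodes D s ->
  (forall y, 0 <= y -> 0 <= ev s (expo y)) -> 0 <= ev s h.

(** A dual norm: for the transform of a signed measure, it is the norm of integration as a
    functional on exponential sums. Any upper bound [M] stands in for the supremum. *)
Definition lap_bounded (K : R) h := forall s M, nodes setT s ->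
  (forall y, 0 <= y -> `|ev s (expo y)| <= M) -> `|ev s h| <= K * M.

(** Subordinator form of the notion: [g] is a Bernstein function iff each [exp (- x g)] is
    completely monotone. Stability under sums, limits and composition is then immediate. *)
Definition bernstein g := (forall l, 0 <= l -> 0 <= g l) /\
  forall x, 0 <= x -> lap_pos setT (fun l => expR (- (x * g l))).

Definition reweight h s := [seq (p.1 * h p.2, p.2) | p <- s].

Lemma ev_reweight s h g : ev (reweight h s) g = ev s (fun l => h l * g l).
Proof. by rewrite /ev big_map; apply: eq_bigr => p _ /=; rewrite mulrA. Qed.

Lemma nodes_reweight D s h : nodes D s -> nodes D (reweight h s).
Proof. by move=> ns _ /mapP[p /ns ? ->]. Qed.

Lemma eq_ev D s h g : nodes D s -> (forall l, 0 <= l -> D l -> h l = g l) ->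
  ev s h = ev s g.
Proof.
move=> ns hg; rewrite /ev; apply: eq_big_seq => p /ns[p0 Dp].
by rewrite hg.
Qed.

Lemma ev_cons p s h : ev (p :: s) h = p.1 * h p.2 + ev s h.
Proof. by rewrite /ev big_cons. Qed.

Lemma evD s h g : ev s (fun l => h l + g l) = ev s h + ev s g.
Proof. by rewrite /ev -big_split; apply: eq_bigr => p _; rewrite mulrDr. Qed.

Lemma evB s h g : ev s (fun l => h l - g l) = ev s h - ev s g.
Proof. by rewrite /ev -sumrB; apply: eq_bigr => p _; rewrite mulrBr. Qed.

Lemma evZ s (c : R) h : ev s (fun l => c * h l) = c * ev s h.
Proof. by rewrite /ev mulr_sumr; apply: eq_bigr => p _; rewrite mulrCA. Qed.

Lemma expo_add y z l : expo (y + z) l = expo y l * expo z l.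
Proof. by rewrite /expo mulrDr opprD expRD. Qed.

Lemma expo0 l : expo 0 l = 1. Proof. by rewrite /expo mulr0 oppr0 expR0. Qed.

Lemma expo_at0 y : expo y 0 = 1. Proof. by rewrite /expo mul0r oppr0 expR0. Qed.

Lemma ev_cvg D s (f : nat -> R -> R) h : nodes D s ->
  (forall l, 0 <= l -> D l -> f n l @[n --> \oo] --> h l) ->
  ev s (f n) @[n --> \oo] --> ev s h.
Proof.
elim: s => [|p s IH] ns fh.
  rewrite /ev big_nil; under eq_fun do rewrite big_nil; exact: cvg_cst.
rewrite /ev big_cons; under eq_fun do rewrite big_cons.
have [p0 Dp] := ns p (mem_head _ _).
apply: cvgD; first by apply: cvgMr; exact: fh.
by apply: IH => // q qs; apply: ns; rewrite inE qs orbT.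
Qed.

Lemma lap_posW D D' h : D' `<=` D -> lap_pos D h -> lap_pos D' h.
Proof. by move=> DD hp s ns; apply: hp => p /ns[? /DD]. Qed.

Lemma eq_lap_pos D h g : (forall l, 0 <= l -> D l -> h l = g l) ->
  lap_pos D h -> lap_pos D g.
Proof. by move=> hg hp s ns s0; rewrite -(eq_ev _ _ _ _ ns hg); exact: hp. Qed.

Lemma lap_pos_lim D (f : nat -> R -> R) h :
  (forall n, lap_pos D (f n)) ->
  (forall l, 0 <= l -> D l -> f n l @[n --> \oo] --> h l) -> lap_pos D h.
Proof.
move=> fp fh s ns s0; have := ev_cvg _ _ _ _ ns fh => /[dup] cv /cvg_lim <- //.
by apply: limr_ge; [exact: cvgP cv|apply: nearW => n; exact: fp].
Qed.

Lemma lap_pos_expo D x : 0 <= x -> lap_pos D (expo x).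
Proof. by move=> x0 s _; apply. Qed.

Lemma lap_posD D h g : lap_pos D h -> lap_pos D g ->
  lap_pos D (fun l => h l + g l).
Proof. by move=> hp gp s ns s0; rewrite evD addr_ge0 ?hp ?gp. Qed.

Lemma lap_posZ D c h : 0 <= c -> lap_pos D h -> lap_pos D (fun l => c * h l).
Proof. by move=> c0 hp s ns s0; rewrite evZ mulr_ge0 ?hp. Qed.

Lemma lap_pos_cst D c : 0 <= c -> lap_pos D (cst c).
Proof.
move=> c0; apply: (@eq_lap_pos _ (fun l => c * expo 0 l)).
  by move=> l _ _; rewrite expo0 mulr1.
by apply: lap_posZ => //; exact: lap_pos_expo.
Qed.

(* An exponential sum that is nonnegative on [0, oo) stays so after a shift of
   its argument, and shifting multiplies the weights by [expo y]. *)
Lemma lap_posM D h g : lap_pos D h -> lap_pos D g ->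
  lap_pos D (fun l => h l * g l).
Proof.
move=> hp gp s ns s0; rewrite -ev_reweight; apply: gp.
  exact: nodes_reweight.
move=> y y0; rewrite ev_reweight.
rewrite (@eq_ev D _ _ (fun l => expo y l * h l))//; last first.
  by move=> l _ _; rewrite mulrC.
rewrite -ev_reweight; apply: hp; first exact: nodes_reweight.
move=> z z0; rewrite ev_reweight.
rewrite (@eq_ev D _ _ (expo (y + z)))//; first by apply: s0; rewrite addr_ge0.
by move=> l _ _; rewrite expo_add.
Qed.

Lemma lap_pos_expR D h : lap_pos D h -> lap_pos D (fun l => expR (h l)).
Proof.
move=> hp; apply: (@lap_pos_lim _
    (fun n l => \sum_(0 <= k < n) exp_coeff (h l) k)); last first.
  by move=> l _ _; exact: is_cvg_series_exp_coeff.
elim=> [|n IH].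
  apply: (@eq_lap_pos _ (cst 0)); first by move=> l _ _; rewrite big_nil.
  exact: lap_pos_cst.
apply: (@eq_lap_pos _ (fun l => \sum_(0 <= k < n) exp_coeff (h l) k +
    (n`!%:R^-1) * h l ^+ n)).
  by move=> l _ _; rewrite big_nat_recr//= /exp_coeff/= mulrC.
apply: lap_posD => //; apply: lap_posZ; first by rewrite invr_ge0.
elim: n {IH} => [|n IH]; first exact: lap_pos_cst.
apply: (@eq_lap_pos _ (fun l => h l * h l ^+ n)); last exact: lap_posM.
by move=> l _ _; rewrite exprS.
Qed.

(* [f = f (1 - expo n) + f (expo n)] for an exponential sum [f]: the first
   term is nonnegative, and the second contributes [c * f 0] in the limit. *)
Lemma lap_pos_sub_atom h c : lap_pos setT h ->
  (forall l, 0 <= l -> h (l + n%:R) @[n --> \oo] --> c) ->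
  lap_pos setT (fun l => h l - c).
Proof.
move=> hp hc; apply: (@lap_pos_lim _ (fun n l => h l - h (l + n%:R))).
  move=> n s ns s0.
  pose s' := s ++ [seq (- p.1, p.2 + n%:R) | p <- s].
  have evs' g : ev s' g = ev s (fun l => g l - g (l + n%:R)).
    rewrite /ev big_cat/= big_map/= -big_split/=; apply: eq_bigr => p _.
    by rewrite mulrBr mulNr.
  rewrite -evs'; apply: hp.
    move=> p; rewrite mem_cat => /orP[/ns//|/mapP[q /ns[q0 _] ->]]/=.
    by split=> //; rewrite addr_ge0.
  move=> y y0; rewrite evs' (@eq_ev setT _ _
     (fun l => (1 - expR (- (n%:R * y))) * expo y l))//.
    rewrite evZ mulr_ge0 ?s0// subr_ge0 -[leRHS]expR0 ler_expR.
    by rewrite oppr_le0 mulr_ge0.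
  by move=> l _ _; rewrite /expo mulrDl opprD expRD; ring.
by move=> l l0 _; apply: cvgB; [exact: cvg_cst|exact: hc].
Qed.

(** A node at 0 carries the constant [M], so [M + b s] with [b = 1] or [b = -1] is again an
    exponential sum, and it is nonnegative. *)
Lemma lap_pos_bounded h : lap_pos setT h -> lap_bounded (h 0) h.
Proof.
move=> hp s M ns sM.
have evc (b : R) g : ev ((M, 0) :: [seq (b * p.1, p.2) | p <- s]) g =
    M * g 0 + b * ev s g.
  rewrite /ev big_cons/= big_map/= mulr_sumr; congr (_ + _).
  by apply: eq_bigr => p _; rewrite mulrA.
have H (b : R) : `|b| = 1 -> 0 <= M * h 0 + b * ev s h.
  move=> b1; rewrite -evc; apply: hp.
    move=> p; rewrite inE => /predU1P[->//|/mapP[q /ns[q0 _] ->//]].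
  move=> y y0; rewrite evc {1}/expo mul0r oppr0 expR0 mulr1.
  have : `|b * ev s (expo y)| <= M by rewrite normrM b1 mul1r sM.
  by rewrite ler_norml => /andP[]; lra.
have := H 1 (normr1 _); have := H (-1) (normrN1 _).
rewrite ler_norml mulN1r mul1r => h1 h2; apply/andP; split; lra.
Qed.

Lemma lap_boundedW K K' h : K <= K' -> lap_bounded K h -> lap_bounded K' h.
Proof.
move=> KK' hp s M ns sM; apply: le_trans (hp s M ns sM) _.
by rewrite ler_wpM2r// (le_trans _ (sM 0 _)).
Qed.

Lemma eq_lap_bounded K h g : (forall l, 0 <= l -> h l = g l) ->
  lap_bounded K h -> lap_bounded K g.
Proof.
move=> hg hp s M ns s0; rewrite -(@eq_ev setT s h) ?hp// => l l0 _; exact: hg.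
Qed.

Lemma lap_bounded_lim (K : nat -> R) K' (f : nat -> R -> R) h :
  (forall n, lap_bounded (K n) (f n)) -> K n @[n --> \oo] --> K' ->
  (forall l, 0 <= l -> f n l @[n --> \oo] --> h l) -> lap_bounded K' h.
Proof.
move=> fp KK fh s M ns sM.
have evh : ev s (f n) @[n --> \oo] --> ev s h.
  by apply: (@ev_cvg setT) => // l l0 _; exact: fh.
have cvK : K n * M @[n --> \oo] --> K' * M by apply: cvgMl.
have cvh : `|ev s (f n)| @[n --> \oo] --> `|ev s h| by exact: cvg_norm.
rewrite -(cvg_lim _ cvh)// -(cvg_lim _ cvK)//; apply: ler_lim.
- exact: cvgP cvh.
- exact: cvgP cvK.
- by apply: nearW => n; exact: fp.
Qed.

Lemma lap_boundedD K K' h g : lap_bounded K h -> lap_bounded K' g ->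
  lap_bounded (K + K') (fun l => h l + g l).
Proof.
move=> hp gp s M ns sM; rewrite evD mulrDl (le_trans (ler_normD _ _))//.
by rewrite lerD ?hp ?gp.
Qed.

Lemma lap_boundedZ K c h : lap_bounded K h ->
  lap_bounded (`|c| * K) (fun l => c * h l).
Proof.
by move=> hp s M ns sM; rewrite evZ normrM -mulrA ler_wpM2l ?hp.
Qed.

Lemma lap_bounded_cst c : lap_bounded `|c| (cst c).
Proof.
have := lap_boundedZ _ c _ (lap_pos_bounded _ (lap_pos_cst setT _ ler01)).
by rewrite mulr1; apply: eq_lap_bounded => l _; rewrite /= mulr1.
Qed.

Lemma lap_boundedM K K' h g : lap_bounded K h -> lap_bounded K' g ->
  lap_bounded (K * K') (fun l => h l * g l).
Proof.
move=> hp gp s M ns sM; rewrite -ev_reweight [K * K']mulrC -mulrA; apply: gp.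
  exact: nodes_reweight.
move=> y y0; rewrite ev_reweight.
rewrite (@eq_ev setT _ _ (fun l => expo y l * h l))//; last first.
  by move=> l _ _; rewrite mulrC.
rewrite -ev_reweight; apply: hp; first exact: nodes_reweight.
move=> z z0; rewrite ev_reweight.
rewrite (@eq_ev setT _ _ (expo (y + z)))//; first by apply: sM; rewrite addr_ge0.
by move=> l _ _; rewrite expo_add.
Qed.

Lemma lap_boundedX K h n : lap_bounded K h ->
  lap_bounded (K ^+ n) (fun l => h l ^+ n).
Proof.
move=> hp; elim: n => [|n IH].
  by rewrite expr0 -[1]normr1; exact: lap_bounded_cst.
rewrite exprS; have := lap_boundedM _ _ _ _ hp IH.
by apply: eq_lap_bounded => l _; rewrite exprS.
Qed.

Lemma lap_bounded_sum n (K : nat -> R) (f : nat -> R -> R) :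
  (forall k, lap_bounded (K k) (f k)) ->
  lap_bounded (\sum_(0 <= k < n) K k) (fun l => \sum_(0 <= k < n) f k l).
Proof.
move=> fp; elim: n => [|n IH].
  rewrite big_nil; have := lap_bounded_cst 0; rewrite normr0.
  by apply: eq_lap_bounded => l _; rewrite big_nil.
rewrite big_nat_recr//=; have := lap_boundedD _ _ _ _ IH (fp n).
by apply: eq_lap_bounded => l _; rewrite big_nat_recr.
Qed.

(** Removing the constant term of the exponential series leaves a bound that vanishes with [K]; the
    decay in time rests on this. *)
Lemma lap_bounded_expR_sub1 K h : lap_bounded K h ->
  lap_bounded (expR K - 1) (fun l => expR (h l) - 1).
Proof.
move=> hp.
pose S (x : R) n := \sum_(0 <= k < n) exp_coeff x k.+1.
have cvS x : S x n @[n --> \oo] --> expR x - 1.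
  have -> : S x = (fun n => series (exp_coeff x) n.+1 - 1).
    apply/funext => n; rewrite /S /series/= big_nat_recl//.
    have -> : exp_coeff x 0%N = 1 by rewrite /exp_coeff/= expr0 fact0 divr1.
    by rewrite addrC addKr.
  apply: cvgB; last exact: cvg_cst.
  rewrite (cvg_shiftS (series (exp_coeff x)) (nbhs (expR x))).
  exact: is_cvg_series_exp_coeff.
apply: (@lap_bounded_lim (S K) _ (fun n l => S (h l) n)) => //.
move=> n; apply: lap_bounded_sum => k.
have := lap_boundedZ _ (k.+1`!%:R^-1) _ (lap_boundedX _ _ k.+1 hp).
rewrite ger0_norm ?invr_ge0// /exp_coeff/= mulrC.
by apply: eq_lap_bounded => l _; rewrite mulrC.
Qed.

(** Moving the nodes along [g] keeps a sum nonnegative: at [y] the moved sum is [s] tested on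
    [exp (- y g)]. *)
Lemma lap_pos_comp h g : lap_pos setT h -> bernstein g ->
  lap_pos setT (fun l => h (g l)).
Proof.
move=> hp [g0 gp] s ns s0.
pose s' := [seq (p.1, g p.2) | p <- s].
have evs' f : ev s' f = ev s (fun l => f (g l)) by rewrite /ev big_map.
rewrite -evs'; apply: hp; first by move=> _ /mapP[p /ns[p0 _] ->]; split; [exact: g0|].
move=> y y0; rewrite evs' (@eq_ev setT _ _ (fun l => expR (- (y * g l))))//.
  exact: gp.
by move=> l _ _; rewrite /expo mulrC.
Qed.

Lemma bernstein_comp f g : bernstein f -> bernstein g -> bernstein (f \o g).
Proof.
move=> [f0 fp] gb; split=> [l l0|x x0]; first by apply: f0; exact: gb.1.
exact: (lap_pos_comp (fun l => expR (- (x * f l))) g (fp x x0) gb).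
Qed.

Lemma bernstein_id : bernstein id.
Proof.
split=> // x x0; apply: (@eq_lap_pos _ (expo x)); last exact: lap_pos_expo.
by move=> l _ _; rewrite /expo mulrC.
Qed.

Lemma bernsteinD f g : bernstein f -> bernstein g ->
  bernstein (fun l => f l + g l).
Proof.
move=> [f0 fp] [g0 gp]; split=> [l l0|x x0]; first by rewrite addr_ge0 ?f0 ?g0.
have := lap_posM _ _ _ (fp x x0) (gp x x0); apply: eq_lap_pos => l _ _.
by rewrite mulrDr opprD expRD.
Qed.

Lemma bernsteinZ c f : 0 <= c -> bernstein f -> bernstein (fun l => c * f l).
Proof.
move=> c0 [f0 fp]; split=> [l l0|x x0]; first by rewrite mulr_ge0 ?f0.
have := fp (x * c) (mulr_ge0 x0 c0); apply: eq_lap_pos => l _ _.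
by rewrite mulrA.
Qed.

Lemma bernstein_lim (f : nat -> R -> R) g : (forall n, bernstein (f n)) ->
  (forall l, 0 <= l -> f n l @[n --> \oo] --> g l) -> bernstein g.
Proof.
move=> fb fg; split=> [l l0|x x0].
  have cv := fg _ l0; rewrite -(cvg_lim _ cv)//.
  by apply: limr_ge; [exact: cvgP cv|apply: nearW => n; exact: (fb n).1].
apply: (@lap_pos_lim _ (fun n l => expR (- (x * f n l)))).
  by move=> n; exact: (fb n).2.
move=> l l0 _; apply: continuous_cvg; first exact: continuous_expR.
by apply: cvgN; apply: cvgMr; exact: fg.
Qed.

(** Compound Poisson exponents: [exp (- x (c - h)) = exp (- x c) exp (x h)], and the exponential
    series preserves positivity. *)
Lemma bernstein_sub_pos c h : lap_pos setT h ->
  (forall l, 0 <= l -> h l <= c) -> bernstein (fun l => c - h l).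
Proof.
move=> hp hc; split=> [l l0|x x0]; first by rewrite subr_ge0 hc.
apply: (@eq_lap_pos _ (fun l => expR (- (x * c)) * expR (x * h l))).
  by move=> l _ _; rewrite -expRD; congr expR; ring.
apply: lap_posZ; first exact: expR_ge0.
by apply: lap_pos_expR; exact: lap_posZ.
Qed.

Lemma bernstein_iter n g : bernstein g -> bernstein (fun l => iter n g l).
Proof.
move=> gb; elim: n => [|n IH]; first exact: bernstein_id.
exact: bernstein_comp gb IH.
Qed.

(* [1 - A] is the derivative at [c = 0] of [expR (- c * A) - expR (- c)], which
   is [expR (- c * A)] minus its limit at infinity. *)
Lemma bernstein_1sub g : bernstein g ->
  (forall l, 0 <= l -> g (l + n%:R) @[n --> \oo] --> (1 : R)) ->
  lap_pos setT (fun l => 1 - g l).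
Proof.
move=> [g0 gp] g1.
pose c (n : nat) : R := n.+1%:R^-1.
have c_gt0 n : 0 < c n by rewrite /c invr_gt0.
have derive_exp (x : R) : (c n)^-1 * (1 - expR (- (c n * x))) @[n --> \oo] --> x.
  have cv0 : c n @[n --> \oo] --> (0 : R) by exact: cvg_harmonic.
  have up : forall n, (c n)^-1 * (1 - expR (- (c n * x))) <= x.
    move=> n; rewrite ler_pdivrMl// lerBlDr -lerBlDl.
    exact: (le_trans _ (expR_ge1Dx _)).
  have lo : forall n, x * expR (- (c n * x)) <= (c n)^-1 * (1 - expR (- (c n * x))).
    move=> n; rewrite ler_pdivlMl//.
    have := expR_ge1Dx (c n * x).
    rewrite -(ler_pM2r (expR_gt0 (- (c n * x)))) -expRD subrr expR0.
    lra.
  apply: (@squeeze_cvgr _ _ _ _ (fun n => x * expR (- (c n * x))) (cst x)).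
  - by apply: nearW => n; rewrite lo up.
  - rewrite -[X in _ --> X]mulr1 -[X in _ * X]expR0 -[X in expR X]oppr0 -(mul0r x).
    apply: cvgMr; apply: continuous_cvg; first exact: continuous_expR.
    by apply: cvgN; exact: cvgMl.
  - exact: cvg_cst.
apply: (@lap_pos_lim _
  (fun n l => (c n)^-1 * (expR (- (c n * g l)) - expR (- (c n))))).
  move=> n; apply: lap_posZ; first by rewrite invr_ge0 ltW.
  apply: lap_pos_sub_atom; first by apply: gp; exact: ltW.
  move=> l l0; apply: continuous_cvg; first exact: continuous_expR.
  apply: cvgN; rewrite -[X in _ --> X]mulr1; apply: cvgMr; exact: g1.
move=> l l0 _.
apply: cvg_trans (cvgB (derive_exp 1) (derive_exp (g l))).
rewrite (_ : (fun n => _) = (fun n => (c n)^-1 * (1 - expR (- (c n * 1))) -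
   (c n)^-1 * (1 - expR (- (c n * g l))))) //.
by apply/funext => n; rewrite mulr1; ring.
Qed.

End LaplacePositivity.

(** * Estimates for [exp (- s) - 1 + s], the integrand of the jump part *)

Section Kernel.
Context {R : realType}.
Implicit Types (s x y z : R).

Definition kern s : R := expR (- s) - 1 + s.

Lemma kern_ge0 s : 0 <= kern s.
Proof. by rewrite /kern; have := expR_ge1Dx (- s); lra. Qed.

Lemma derive_ge0_ge (f df : R -> R) : f 0 = 0 ->
  (forall x, is_derive x 1 f (df x)) -> (forall x, 0 <= x -> 0 <= df x) ->
  forall s, 0 <= s -> 0 <= f s.
Proof.
move=> f0 dfE df0 s s0.
have cf : {within `[0, s], continuous f}.
  apply: continuous_subspaceT => x; apply: differentiable_continuous.
  by apply/derivable1_diffP; exact: ex_derive.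
have [c cs] := MVT_segment s0 (fun x _ => dfE x) cf.
rewrite f0 !subr0 => ->; apply: mulr_ge0 => //; apply: df0.
by move: cs; rewrite in_itv/= => /andP[].
Qed.

Lemma kern_le s : 0 <= s -> kern s <= s ^+ 2 / 2.
Proof.
move=> s0; rewrite -subr_ge0.
apply: (@derive_ge0_ge (fun x => x ^+ 2 / 2 - (expR (- x) - 1 + x))
  (fun x => x - 1 + expR (- x))) => //.
- by rewrite oppr0 expR0; lra.
- move=> x; apply: is_derive_eq; rewrite /GRing.scale/=; lra.
- by move=> x x0; have := expR_ge1Dx (- x); lra.
Qed.

Lemma kern_ge s : 0 <= s -> s ^+ 2 / 2 - s ^+ 3 / 6 <= kern s.
Proof.
move=> s0; rewrite -subr_ge0.
apply: (@derive_ge0_ge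
  (fun x => (expR (- x) - 1 + x) - (x ^+ 2 / 2 - x ^+ 3 / 6))
  (fun x => x ^+ 2 / 2 - (expR (- x) - 1 + x))) => //.
- by rewrite oppr0 expR0; lra.
- move=> x; apply: is_derive_eq; rewrite /GRing.scale/=; lra.
- by move=> x x0; rewrite subr_ge0; exact: kern_le.
Qed.

(** For [s <= 1] the cubic term of [kern_ge] is at most a third of the quadratic one. This serves to
    compare [kern (u * r)] with [u ^+ 2 * kern r] for small jumps. *)
Lemma sqr_le_kern s : 0 <= s <= 1 -> s ^+ 2 <= 3 * kern s.
Proof. by move=> /andP[s0 s1]; have := kern_ge _ s0; nra. Qed.

(** Convexity without division, so that it integrates in the jump size. The tangent of [exp (- s)]
    at [y], evaluated at [x] and at [z], is weighted so that the slopes cancel. *)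
Lemma kern_convex x y z : x <= y -> y <= z ->
  (z - x) * kern y <= (z - y) * kern x + (y - x) * kern z.
Proof.
move=> xy yz.
have ex : expR (- y) * (1 + (y - x)) <= expR (- x).
  have -> : expR (- x) = expR (- y) * expR (y - x) by rewrite -expRD; congr expR; lra.
  by rewrite ler_pM2l ?expR_gt0// expR_ge1Dx.
have ez : expR (- y) * (1 + (y - z)) <= expR (- z).
  have -> : expR (- z) = expR (- y) * expR (y - z) by rewrite -expRD; congr expR; lra.
  by rewrite ler_pM2l ?expR_gt0// expR_ge1Dx.
rewrite /kern.
have h1 : (z - y) * (expR (- y) * (1 + (y - x))) <= (z - y) * expR (- x).
  by rewrite ler_wpM2l// subr_ge0.
have h2 : (y - x) * (expR (- y) * (1 + (y - z))) <= (y - x) * expR (- z).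
  by rewrite ler_wpM2l// subr_ge0.
lra.
Qed.

Lemma kern0 : kern 0 = 0.
Proof. by rewrite /kern oppr0 expR0; lra. Qed.

Lemma continuous_kernM (u : R) : continuous (fun r : R => kern (u * r) : R).
Proof.
move=> r; rewrite /kern; apply: cvgD; last first.
  by apply: cvgMr; exact: cvg_id.
apply: cvgB; last exact: cvg_cst.
apply: continuous_cvg; first exact: continuous_expR.
by apply: cvgN; apply: cvgMr; exact: cvg_id.
Qed.

Lemma continuous_expoM (l : R) : continuous (fun r : R => expo r l : R).
Proof.
move=> r; apply: continuous_cvg; first exact: continuous_expR.
by apply: cvgN; apply: cvgMr; exact: cvg_id.
Qed.

End Kernel.

(** * Laplace transforms of measures *)

Section MeasureTransforms.
Context {R : realType}.

Lemma ev_Rintegral (mu : {measure set R -> \bar R}) (D : set R) s :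
  measurable D ->
  (forall p, p \in s -> mu.-integrable D (EFin \o (fun r => expo r p.2))) ->
  mu.-integrable D (EFin \o (fun r => ev s (expo r))) /\
  \int[mu]_(r in D) ev s (expo r) = ev s (fun l => \int[mu]_(r in D) expo r l).
Proof.
move=> mD; elim: s => [|p s IH] si.
  rewrite /ev big_nil; split.
    apply: (eq_integrable mD (cst 0%E)); last exact: integrable0.
    by move=> x _; rewrite /= big_nil.
  by under eq_Rintegral do rewrite big_nil; rewrite Rintegral_cst// mul0r.
have [is_ Es] : mu.-integrable D (EFin \o (fun r => ev s (expo r))) /\
  \int[mu]_(r in D) ev s (expo r) = ev s (fun l => \int[mu]_(r in D) expo r l).
  by apply: IH => q qs; apply: si; rewrite inE qs orbT.
have ip := si p (mem_head _ _).
have ipc : mu.-integrable D (EFin \o (fun r => p.1 * expo r p.2)).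
  by apply: (eq_integrable mD _ _ _ (integrableZl mD p.1 ip)) => x _.
split.
  apply: (eq_integrable mD _ _ _ (integrableD mD ipc is_)) => x _.
  by rewrite /= ev_cons EFinD.
rewrite ev_cons -Es -RintegralZl// -RintegralD//.
by apply: eq_Rintegral => x _; rewrite ev_cons.
Qed.

Lemma lap_pos_Rintegral (mu : {measure set R -> \bar R}) (D : set R) :
  measurable D -> (forall r, D r -> 0 <= r) ->
  (forall l, 0 <= l -> mu.-integrable D (EFin \o (fun r => expo r l))) ->
  lap_pos setT (fun l => \int[mu]_(r in D) expo r l).
Proof.
move=> mD D0 Di s ns s0.
have [_ <-] := ev_Rintegral mu D s mD (fun p ps => Di _ (ns p ps).1).
by apply: Rintegral_ge0 => r /D0; exact: s0.
Qed.

End MeasureTransforms.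

(** * The branching mechanism and its Euler approximation *)

Section Mechanism.
Context {R : realType}.

(* [C u - b u] with [b] Bernstein: here an explicit Euler step
   [u - h (C u - b u)] is again Bernstein as soon as [h C <= 1]. *)
Definition euler_approximable (f : R -> R) := forall e : R, 0 < e ->
  exists (C : R) (b : R -> R), [/\ 0 <= C, bernstein b & forall u, 0 <= u ->
    f u - e * (u ^+ 2 + u ^+ 3) <= C * u - b u <= f u].

Lemma euler_approximableD f g : euler_approximable f -> euler_approximable g ->
  euler_approximable (fun u => f u + g u).
Proof.
move=> fa ga e e0; have e20 : 0 < e / 2 by rewrite divr_gt0.
have [C [b [C0 bb Cb]]] := fa _ e20; have [C' [b' [C'0 bb' Cb']]] := ga _ e20.
exists (C + C'), (fun u => b u + b' u); split.
- by rewrite addr_ge0.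
- exact: bernsteinD.
- move=> u u0; have /andP[] := Cb u u0; have /andP[] := Cb' u u0.
  by move=> *; apply/andP; split; lra.
Qed.

Lemma euler_approximable_linear c : 0 <= c -> euler_approximable (fun u => c * u).
Proof.
move=> c0 e e0; exists c, (fun l => 0 * l); split => //.
- by apply: bernsteinZ => //; exact: bernstein_id.
- move=> u u0; rewrite mul0r subr0 lexx andbT gerBl.
  by rewrite mulr_ge0 ?addr_ge0 ?exprn_ge0// ltW.
Qed.

(** A Brownian part is replaced by jumps of size [k^-1] at rate [2 c k^2]: [2 c k^2 kern (u / k)]
    falls short of [c u^2] by at most [c u^3 / (3 k)]. The choice [k = (c + 1) / e] brings this
    below [e u^3] and stays positive for [c = 0]. *)
Lemma euler_approximable_square c : 0 <= c ->
  euler_approximable (fun u => c * u ^+ 2).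
Proof.
move=> c0 e e0; have [k kE] : exists k : R, k = (c + 1) / e by eexists.
have k0 : 0 < k by rewrite kE divr_gt0// ltr_wpDl.
have ck0 : 0 <= c * (2 * k ^+ 2) by rewrite mulr_ge0// mulr_ge0// exprn_ge0// ltW.
exists (c * (2 * k)), (fun u => c * (2 * k ^+ 2) * (1 - expo k^-1 u)); split.
- by rewrite !mulr_ge0// ltW.
- apply: bernsteinZ => //; apply: bernstein_sub_pos.
    by apply: lap_pos_expo; rewrite invr_ge0 ltW.
  move=> l l0; rewrite -[leRHS]expR0 ler_expR oppr_le0 mulr_ge0//.
  by rewrite invr_ge0 ltW.
- move=> u u0.
  have uk0 : 0 <= u / k by rewrite divr_ge0// ltW.
  have -> : c * (2 * k) * u - c * (2 * k ^+ 2) * (1 - expo k^-1 u) =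
      c * (2 * k ^+ 2) * kern (u / k).
    by rewrite /kern /expo; field; rewrite gt_eqF.
  have Ec : c * u ^+ 2 = c * (2 * k ^+ 2) * ((u / k) ^+ 2 / 2).
    by field; rewrite gt_eqF.
  apply/andP; split; last by rewrite Ec ler_wpM2l// kern_le.
  apply: le_trans (ler_wpM2l ck0 (kern_ge _ uk0)).
  rewrite mulrBr -Ec lerD2l lerN2.
  have -> : c * (2 * k ^+ 2) * ((u / k) ^+ 3 / 6) = c / 3 / k * u ^+ 3.
    by field; rewrite gt_eqF.
  have -> : c / 3 / k = (c / (c + 1)) / 3 * e.
    by rewrite kE; field; rewrite !gt_eqF// ltr_wpDl.
  have cc : 0 <= c / (c + 1) <= 1.
    by rewrite divr_ge0 ?addr_ge0// ler_pdivrMr ?ltr_wpDl// mul1r lerDl ler01.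
  have u2 : 0 <= u ^+ 2 by rewrite exprn_ge0.
  have u3 : 0 <= u ^+ 3 by rewrite exprn_ge0.
  have eu2 : 0 <= e * u ^+ 2 by rewrite mulr_ge0// ltW.
  have eu3 : 0 <= e * u ^+ 3 by rewrite mulr_ge0// ltW.
  move: (c / (c + 1)) cc => q /andP[q0 q1].
  have : q * (e * u ^+ 3) <= e * u ^+ 3 by rewrite ler_piMl.
  lra.
Qed.

Section Jumps.
Context (Pi : {measure set R -> \bar R}).
Hypothesis Pi_int : forall u : R, 0 <= u ->
  Pi.-integrable `]0, +oo[ (EFin \o (fun r : R => kern (u * r))).

Definition jump_part u := \int[Pi]_(r in `]0, +oo[) kern (u * r).

Lemma jump_part_convex x y z : 0 <= x -> x <= y -> y <= z ->
  (z - x) * jump_part y <= (z - y) * jump_part x + (y - x) * jump_part z.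
Proof.
move=> x0 xy yz; have y0 := le_trans x0 xy; have z0 := le_trans y0 yz.
have mD : measurable (`]0, +oo[ : set R) by [].
have iZ c u : 0 <= u -> Pi.-integrable `]0, +oo[ (EFin \o (fun r : R => c * kern (u * r))).
  by move=> u0; apply: (eq_integrable mD _ _ _ (integrableZl mD c (Pi_int u u0))).
rewrite /jump_part -!RintegralZl//; try exact: Pi_int.
rewrite -RintegralD//; try exact: iZ.
apply: le_Rintegral => //; first exact: iZ.
  by apply: (eq_integrable mD _ _ _ (integrableD mD (iZ (z - y) _ x0) (iZ (y - x) _ z0))).
(* Convexity at the points [x * r], [y * r], [z * r] gives the claim multiplied by [r > 0]. *)
move=> r; rewrite /= in_itv/= andbT => r0.
have := @kern_convex R (x * r) (y * r) (z * r).
rewrite !ler_pM2r// => /(_ xy yz); rewrite -!mulrBl => h.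
rewrite -(ler_pM2r r0); apply: le_trans (le_trans _ h) _; lra.
Qed.

Lemma jump_part0 : jump_part 0 = 0.
Proof.
rewrite /jump_part (@eq_Rintegral _ _ _ _ _ (cst 0)) ?Rintegral_cst ?mul0r//.
by move=> r _; rewrite mul0r kern0.
Qed.

Lemma jump_part_ge0 u : 0 <= u -> 0 <= jump_part u.
Proof. by move=> u0; apply: Rintegral_ge0 => r _; exact: kern_ge0. Qed.

(** [kern] is integrable (the case [u = 1]), so its integrals over the rays from [n.+1%:R^-1]
    increase to the full one and leave an arbitrarily small remainder near 0. *)
Lemma small_jumps e : 0 < e ->
  exists2 d : R, 0 < d <= 1 & \int[Pi]_(r in `]0, d]) kern r <= e.
Proof.
move=> e0.
have i1 : Pi.-integrable `]0, +oo[ (EFin \o kern).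
  by apply: (eq_integrable _ _ _ _ (Pi_int 1 ler01)) => // r _; rewrite /= mul1r.
pose F (n : nat) : set R := `]n.+1%:R^-1, +oo[%classic.
have UF : \bigcup_n F n = `]0, +oo[%classic.
  apply/seteqP; split => [r [n _]|r]; rewrite /F /= !in_itv/= !andbT.
    by apply: lt_trans; rewrite invr_gt0.
  move=> r0; have [n nr] := ltr_add_invr r0.
  by exists n => //; rewrite /= in_itv/= andbT; rewrite add0r in nr.
have mF n : measurable (F n) by exact: measurable_itv.
have ndF : nondecreasing_seq F.
  move=> i j ij; apply/subsetPset => r; rewrite /F/= !in_itv/= !andbT.
  by apply: le_lt_trans; rewrite lef_pV2 ?posrE// ler_nat.
have mk (D : set R) : measurable_fun D (fun r : R => (kern r)%:E).
  apply: measurable_funTS; apply/measurable_EFinP.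
  apply: continuous_measurable_fun => r.
  have := @continuous_kernM R 1 r; rewrite (_ : (fun r => kern (1 * r)) = kern)//.
  by apply/funext => x; rewrite mul1r.
have := @ge0_nondecreasing_set_cvg_integral _ _ R F (fun r : R => (kern r)%:E) Pi ndF mF
  (fun i => mk (F i)) (fun i x _ => kern_ge0 x).
rewrite UF => cv.
have fin0 := integrable_fin_num (measurable_itv _) i1.
have := fine_cvg; move/(_ _ _ _ _ _) => fc.
have : \int[Pi]_(x in F n) kern x @[n --> \oo] --> \int[Pi]_(x in `]0, +oo[) kern x.
  apply: (fine_cvg (f := fun n => \int[Pi]_(x in F n) (EFin \o kern) x)%E).
  by rewrite fineK.
move=> /cvgrPdist_le/(_ _ e0)[N _ /(_ N (leqnn _))] HN.
exists (N.+1%:R^-1).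
  by rewrite invr_gt0 ltr0n/= invf_le1// ler1n.
move: HN; have N0 : (0 : R) < N.+1%:R^-1 by rewrite invr_gt0.
have Esplit : `]0, +oo[%classic = `]0, N.+1%:R^-1] `|` F N.
  by rewrite /F -itv_bndbnd_setU// bnd_simp// ltW.
rewrite [X in `|X - _|]/Rintegral /= {1}Esplit -/(Rintegral _ _ _).
rewrite Rintegral_setU//.
- by rewrite addrK ger0_norm// Rintegral_ge0// => r _; exact: kern_ge0.
- by rewrite -Esplit.
- apply/disj_setPS => r [] /=; rewrite /F /= !in_itv/= andbT => /andP[_ h1] h2.
  by have := lt_le_trans h2 h1; rewrite ltxx.
Qed.

(** Jumps larger than [d] have finite mass and finite first moment, so their part is exactly
    [C u - b u] with [C] that moment and [b] a compound Poisson exponent. Small jumps add a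
    nonnegative remainder of at most [e u^2]. *)
Lemma euler_approximable_jump_part : euler_approximable jump_part.
Proof.
move=> e e0; have e20 : 0 < e / 2 by rewrite divr_gt0.
have [d /andP[d0 d1] dP] := small_jumps _ e20.
pose F : set R := `]d, +oo[%classic.
pose G : set R := `]0, d]%classic.
have mF : measurable F by exact: measurable_itv.
have mG : measurable G by exact: measurable_itv.
have GUF : `]0, +oo[%classic = G `|` F.
  by rewrite /F /G -itv_bndbnd_setU// bnd_simp// ltW.
have GF : [disjoint G & F].
  apply/disj_setPS => r [] /=; rewrite /F /G /= !in_itv/= andbT => /andP[_ h1] h2.
  by have := lt_le_trans h2 h1; rewrite ltxx.
have FP r : F r -> d < r by rewrite /F/= in_itv/= andbT.
have FS : F `<=` `]0, +oo[ by rewrite GUF; exact: subsetUr.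
have GS : G `<=` `]0, +oo[ by rewrite GUF; exact: subsetUl.
have iF u : 0 <= u -> Pi.-integrable F (EFin \o (fun r : R => kern (u * r))).
  by move=> u0; apply: integrableS (Pi_int _ u0).
have iG u : 0 <= u -> Pi.-integrable G (EFin \o (fun r : R => kern (u * r))).
  by move=> u0; apply: integrableS (Pi_int _ u0).
have kd : 0 < kern d.
  have := sqr_le_kern d; rewrite (ltW d0) d1 => /(_ isT).
  have : 0 < d ^+ 2 by rewrite exprn_gt0.
  lra.
(* By convexity and [kern 0 = 0], [kern r / r] is nondecreasing, so beyond [d] the identity is
   dominated by a multiple of [kern]. *)
have intr_F : Pi.-integrable F (EFin \o (fun r : R => r)).
  apply: (le_integrable mF _ _ (integrableZl mF (d / kern d) (iF 1 ler01))).
    by apply/measurable_EFinP; exact: measurable_id.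
  move=> r /FP dr; rewrite /= mul1r lee_fin.
  rewrite ger0_norm ?(ltW (lt_trans d0 dr))//.
  rewrite ger0_norm ?mulr_ge0 ?kern_ge0 ?invr_ge0 ?(ltW d0) ?(ltW kd)//.
  have := kern_convex 0 d r (ltW d0) (ltW dr).
  by rewrite kern0 mulr0 add0r !subr0 mulrAC ler_pdivlMr.
have i1 : Pi.-integrable F (EFin \o cst 1).
  apply: (le_integrable mF _ _ (integrableZl mF d^-1 intr_F)).
    by apply/measurable_EFinP; exact: measurable_cst.
  move=> r /FP dr; rewrite /= lee_fin normr1.
  rewrite ger0_norm ?mulr_ge0 ?invr_ge0 ?(ltW (lt_trans d0 dr)) ?(ltW d0)//.
  by rewrite ler_pdivlMl// mulr1 ltW.
have iexp l : 0 <= l -> Pi.-integrable F (EFin \o (fun r => expo r l)).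
  move=> l0; apply: (le_integrable mF _ _ i1).
    apply/measurable_EFinP; apply: measurable_funTS.
    by apply: continuous_measurable_fun; exact: continuous_expoM.
  move=> r /FP dr; rewrite /= lee_fin normr1 ger0_norm ?expR_ge0//.
  by rewrite /expo -[leRHS]expR0 ler_expR oppr_le0 mulr_ge0// ltW// (lt_trans d0).
exists (\int[Pi]_(r in F) r),
  (fun u => \int[Pi]_(r in F) (cst 1 r) - \int[Pi]_(r in F) expo r u).
split.
- by apply: Rintegral_ge0 => r /FP dr; rewrite ltW// (lt_trans d0).
- apply: bernstein_sub_pos.
    apply: lap_pos_Rintegral => // r /FP dr.
    by rewrite ltW// (lt_trans d0).
  move=> l l0; apply: le_Rintegral => //; first exact: iexp.
  move=> r /FP dr; rewrite /expo -[leRHS]expR0 ler_expR oppr_le0 mulr_ge0//.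
  by rewrite ltW// (lt_trans d0).
- move=> u u0.
  have -> : (\int[Pi]_(r in F) r) * u -
      (\int[Pi]_(r in F) (cst 1 r) - \int[Pi]_(r in F) expo r u) =
      \int[Pi]_(r in F) kern (u * r).
    rewrite mulrC opprB addrC -RintegralB//; last exact: iexp.
    rewrite -RintegralZl// -RintegralD//.
    + apply: (eq_integrable mF _ _ _ (integrableB mF (iexp u u0) i1)) => r _.
      by rewrite /= EFinB.
    + by apply: (eq_integrable mF _ _ _ (integrableZl mF u intr_F)).
  have -> : jump_part u = \int[Pi]_(r in G) kern (u * r) +
      \int[Pi]_(r in F) kern (u * r).
    by rewrite /jump_part GUF Rintegral_setU// -GUF; exact: Pi_int.
  rewrite lerDr Rintegral_ge0 ?andbT; last by move=> r _; exact: kern_ge0.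
  suff : \int[Pi]_(r in G) kern (u * r) <= e * u ^+ 2.
    have : 0 <= e * u ^+ 3 by rewrite mulr_ge0 ?exprn_ge0// ltW.
    lra.
  (* [kern (u * r) <= (u * r)^2 / 2], and [r^2 <= 3 kern r] because [r <= d <= 1]. *)
  apply: (@le_trans _ _ (\int[Pi]_(r in G) (3 / 2 * u ^+ 2 * kern r))).
    apply: le_Rintegral => //; first exact: iG.
      have := integrableZl mG (3 / 2 * u ^+ 2) (iG 1 ler01).
      apply: (eq_integrable mG) => r _ /=.
      by rewrite mul1r EFinM.
    move=> r /=; rewrite /G /= in_itv/= => /andP[r0 rd].
    have := sqr_le_kern r; rewrite (ltW r0) (le_trans rd d1) => /(_ isT).
    move=> /(ler_wpM2l (exprn_ge0 2 u0)) h.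
    apply: le_trans (kern_le (u * r) (mulr_ge0 u0 (ltW r0))) _.
    rewrite exprMn ler_pdivrMr//; apply: le_trans h _.
    by rewrite le_eqVlt; apply/orP; left; apply/eqP; field.
  rewrite RintegralZl//; last first.
    apply: (eq_integrable mG _ _ _ (iG 1 ler01)) => r _ /=.
    by rewrite mul1r.
  have := ler_wpM2l (exprn_ge0 2 u0) dP; rewrite -/G.
  have : 0 <= e * u ^+ 2 by rewrite mulr_ge0 ?exprn_ge0// ltW.
  lra.
Qed.

End Jumps.

Lemma mechanism_properties m psi : classN m psi ->
  [/\ 0 < m, psi 0 = 0,
      forall x y z : R, 0 <= x -> x <= y -> y <= z ->
        (z - x) * psi y <= (z - y) * psi x + (y - x) * psi z,
      forall u : R, 0 <= u -> m * u <= psi u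
    & euler_approximable psi].
Proof.
move=> [sigma [Pi [[s0 m0] Pi_int psiE _ _]]].
have Pi_int' (u : R) : 0 <= u ->
    Pi.-integrable `]0, +oo[ (EFin \o (fun r : R => kern (u * r))).
  exact: Pi_int.
have psiE' u : 0 <= u -> psi u = sigma ^+ 2 * u ^+ 2 + m * u + jump_part Pi u.
  exact: psiE.
have s20 : 0 <= sigma ^+ 2 by rewrite exprn_ge0.
split => //.
- by rewrite psiE'// jump_part0 expr0n/= !mulr0 !addr0.
- move=> x y z x0 xy yz; have y0 := le_trans x0 xy; have z0 := le_trans y0 yz.
  rewrite !psiE'//; have := jump_part_convex _ Pi_int' _ _ _ x0 xy yz.
  have : (z - x) * (sigma ^+ 2 * y ^+ 2) <=
    (z - y) * (sigma ^+ 2 * x ^+ 2) + (y - x) * (sigma ^+ 2 * z ^+ 2).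
    rewrite -subr_ge0.
    have -> : (z - y) * (sigma ^+ 2 * x ^+ 2) + (y - x) * (sigma ^+ 2 * z ^+ 2)
      - (z - x) * (sigma ^+ 2 * y ^+ 2) =
      sigma ^+ 2 * ((z - y) * (y - x) * (z - x)) by ring.
    by rewrite !mulr_ge0// subr_ge0// (le_trans xy).
  lra.
- move=> u u0; rewrite psiE'//.
  have := jump_part_ge0 Pi u u0.
  have : 0 <= sigma ^+ 2 * u ^+ 2 by rewrite mulr_ge0// exprn_ge0.
  lra.
- have := euler_approximableD _ _ (euler_approximableD _ _
    (euler_approximable_square _ s20) (euler_approximable_linear _ (ltW m0)))
    (euler_approximable_jump_part _ Pi_int').
  move=> H e e0; have [C [b [C0 bb Cb]]] := H e e0; exists C, b; split => // u u0.
  by rewrite psiE'//; exact: Cb.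
Qed.

End Mechanism.

(** * The tail integral of [1 / psi] and the Bernstein property of [A] *)

Section InverseIntegral.
Context {R : realType} (m : R) (psi : R -> R).
Hypothesis m_gt0 : 0 < m.
Hypothesis psi0 : psi 0 = 0.
Hypothesis psi_convex : forall x y z : R, 0 <= x -> x <= y -> y <= z ->
  (z - x) * psi y <= (z - y) * psi x + (y - x) * psi z.
Hypothesis psi_ge : forall u : R, 0 <= u -> m * u <= psi u.
Hypothesis grey : exists2 a : R, 0 < a &
  (\int[lebesgue_measure]_(u in `[a, +oo[) ((psi u)^-1)%:E < +oo)%E.
Implicit Types (u v l : R).

Lemma psi_gt0 u : 0 < u -> 0 < psi u.
Proof. by move=> u0; apply: lt_le_trans (psi_ge _ (ltW u0)); rewrite mulr_gt0. Qed.

Lemma psi_chord u v : 0 <= u -> u <= v -> v * psi u <= u * psi v.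
Proof. by move=> u0 uv; have := psi_convex 0 u v (lexx _) u0 uv; rewrite psi0; lra. Qed.

Lemma psi_nd u v : 0 <= u -> u <= v -> psi u <= psi v.
Proof.
move=> u0 uv; have [v0|v0] := ltP 0 v; last first.
  by have -> : u = v by apply/eqP; rewrite eq_le uv (le_trans v0).
rewrite -(ler_pM2l v0); apply: le_trans (psi_chord _ _ u0 uv) _.
by rewrite ler_wpM2r// ltW// psi_gt0.
Qed.

Lemma psiV_ge0 u : 0 < u -> 0 <= (psi u)^-1.
Proof. by move=> u0; rewrite invr_ge0 ltW// psi_gt0. Qed.

Lemma psiV_nincr u v : 0 < u -> u <= v -> (psi v)^-1 <= (psi u)^-1.
Proof.
move=> u0 uv; rewrite lef_pV2 ?posrE ?psi_gt0//; last exact: lt_le_trans uv.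
by rewrite psi_nd// ltW.
Qed.

Lemma measurable_psiV (D : set R) : measurable D -> (forall u, D u -> 0 < u) ->
  measurable_fun D (fun u => ((psi u)^-1)%:E).
Proof.
move=> mD D0; suff mT : measurable_fun `](0 : R), +oo[%classic (fun u => ((psi u)^-1)%:E).
  apply: measurable_funS mT => //.
  by move=> u /D0; rewrite /= in_itv/= andbT.
have -> : `](0 : R), +oo[%classic = \bigcup_n `](n.+1%:R^-1 : R), +oo[%classic.
  apply/seteqP; split => [u|u [n _]]; rewrite /= !in_itv/= !andbT; last first.
    by apply: lt_trans; rewrite invr_gt0.
  move=> u0; have [n nr] := ltr_add_invr u0.
  by exists n => //; rewrite /= in_itv/= andbT; rewrite add0r in nr.
apply/measurable_fun_bigcup => // n; apply/measurable_EFinP.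
have n0 : 0 < n.+1%:R^-1 :> R by rewrite invr_gt0.
(* Truncating the argument at [n.+1%:R^-1] gives a function that is monotone on the whole line,
   hence measurable. *)
apply: (@eq_measurable_fun _ _ _ _ _ (fun u => (psi (Num.max u n.+1%:R^-1))^-1)).
  move=> u; rewrite inE/= in_itv/= andbT => /ltW nu.
  by rewrite max_l.
apply: nonincreasing_measurable => // u v uv.
apply: psiV_nincr; first by rewrite lt_max n0 orbT.
by rewrite ge_max !le_max uv lexx orbT.
Qed.

Definition tail_integral l : \bar R :=
  (\int[lebesgue_measure]_(u in `]l, +oo[) ((psi u)^-1)%:E)%E.

Definition tail l : R := fine (tail_integral l).

Definition slab u v : \bar R :=
  (\int[lebesgue_measure]_(x in `]u, v]) ((psi x)^-1)%:E)%E.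

Lemma tail_integral_split u v : 0 <= u -> u <= v ->
  tail_integral u = (slab u v + tail_integral v)%E.
Proof.
move=> u0 uv; rewrite /tail_integral /slab.
have E : `]u, +oo[%classic = `]u, v] `|` `]v, +oo[%classic.
  by rewrite -itv_bndbnd_setU// bnd_simp.
have D0 x : `]u, +oo[%classic x -> 0 < x.
  by rewrite /= in_itv/= andbT; exact: le_lt_trans.
rewrite {1}E ge0_integral_setU//.
- by rewrite -E; exact: measurable_psiV.
- by move=> x; rewrite -E lee_fin => /D0; exact: psiV_ge0.
- apply/disj_setPS => r [] /=; rewrite !in_itv/= andbT => /andP[_ h1] h2.
  by have := lt_le_trans h2 h1; rewrite ltxx.
Qed.

Lemma tail_integral_ge0 u : 0 <= u -> (0 <= tail_integral u)%E.
Proof.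
move=> u0; apply: integral_ge0 => x; rewrite /= in_itv/= andbT => ux.
by rewrite lee_fin psiV_ge0// (le_lt_trans u0).
Qed.

Lemma slab_bounds u v : 0 < u -> u <= v ->
  (((v - u) / psi v)%:E <= slab u v)%E /\ (slab u v <= ((v - u) / psi u)%:E)%E.
Proof.
move=> u0 uv.
have mI : measurable (`]u, v] : set R) by [].
have D0 x : `]u, v]%classic x -> 0 < x.
  by rewrite /= in_itv/= => /andP[ux _]; exact: lt_trans ux.
have mp := measurable_psiV _ mI D0.
have cstE (c : R) :
    (\int[lebesgue_measure]_(x in `]u, v]) (cst c%:E x) = ((v - u) * c)%:E)%E.
  rewrite integral_cst//= lebesgue_measure_itv/= lte_fin.
  case: ltP => [_|vu]; first by rewrite -EFinD -EFinM mulrC.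
  have -> : u = v by apply/eqP; rewrite eq_le uv vu.
  by rewrite subrr mul0r mule0.
rewrite -!cstE /slab; split; apply: ge0_le_integral => //.
- by move=> x _; rewrite lee_fin; apply: psiV_ge0; exact: lt_le_trans uv.
- move=> x /[dup] /D0 x0; rewrite /= in_itv/= => /andP[_ xv].
  by rewrite lee_fin; exact: psiV_nincr.
- by move=> x /D0 x0; rewrite lee_fin; exact: psiV_ge0.
- move=> x; rewrite /= in_itv/= => /andP[/ltW ux _].
  by rewrite lee_fin; exact: psiV_nincr.
Qed.

Lemma tail_integral_fin u : 0 < u -> tail_integral u \is a fin_num.
Proof.
move=> u0; rewrite ge0_fin_numE ?tail_integral_ge0 ?ltW//.
have [a a0 aoo] := grey.
pose b := Num.max a u.
have bu : u <= b by rewrite le_max lexx orbT.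
rewrite (tail_integral_split _ b)//; last exact: ltW.
apply: lte_add_pinfty.
  by apply: le_lt_trans (slab_bounds _ _ u0 bu).2 _; exact: ltry.
apply: le_lt_trans aoo; apply: ge0_subset_integral => //.
- apply: measurable_psiV => // x; rewrite /= in_itv/= andbT.
  exact: lt_le_trans.
- by move=> x; rewrite /= in_itv/= andbT => ax; rewrite lee_fin psiV_ge0// (lt_le_trans a0).
- by move=> x; rewrite /= !in_itv/= !andbT => bx; rewrite (le_trans _ (ltW bx))// le_max lexx.
Qed.

Lemma tail_ge0 u : 0 < u -> 0 <= tail u.
Proof. by move=> u0; rewrite fine_ge0// tail_integral_ge0// ltW. Qed.

Lemma tail_bounds u v : 0 < u -> u <= v ->
  (v - u) / psi v <= tail u - tail v <= (v - u) / psi u.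
Proof.
move=> u0 uv; have v0 := lt_le_trans u0 uv.
have [h1 h2] := slab_bounds _ _ u0 uv.
have E := tail_integral_split _ _ (ltW u0) uv.
have fv := tail_integral_fin _ v0; have fu := tail_integral_fin _ u0.
have fs : slab u v \is a fin_num.
  by rewrite fin_numElt (lt_le_trans _ h1) ?ltNyr// (le_lt_trans h2) ?ltry.
have -> : tail u - tail v = fine (slab u v).
  by rewrite /tail E fineD// addrK.
by rewrite -!lee_fin fineK// h1 h2.
Qed.

Lemma tail_nincr u v : 0 < u -> u <= v -> tail v <= tail u.
Proof.
move=> u0 uv; rewrite -subr_ge0.
have /andP[+ _] := tail_bounds _ _ u0 uv; apply: le_trans.
by rewrite divr_ge0 ?subr_ge0// ltW// psi_gt0// (lt_le_trans u0).
Qed.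

Lemma tail_small (e : R) : 0 < e ->
  exists2 v, 0 < v & forall u, v <= u -> tail u <= e.
Proof.
move=> e0.
pose F (n : nat) : set R := `]1, n.+1%:R]%classic.
have UF : \bigcup_n F n = `]1, +oo[%classic.
  apply/seteqP; split => [r [n _]|r]; rewrite /F /= !in_itv/= ?andbT.
    by move=> /andP[].
  move=> r1; exists (Num.truncn r) => //; rewrite /= in_itv/= r1.
  by rewrite ltW// truncnS_gt.
have mF n : measurable (F n) by exact: measurable_itv.
have FP n r : F n r -> 0 < r.
  by rewrite /F/= in_itv/= => /andP[r1 _]; exact: lt_trans r1.
have ndF : nondecreasing_seq F.
  move=> i j ij; apply/subsetPset => r; rewrite /F/= !in_itv/= => /andP[-> h]/=.
  by rewrite (le_trans h)// ler_nat.
have cv : (slab 1 n.+1%:R @[n --> \oo] --> tail_integral 1)%E.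
  rewrite /tail_integral -UF; apply: ge0_nondecreasing_set_cvg_integral => //.
    by move=> n; apply: measurable_psiV => //; exact: FP.
  by move=> n x /FP x0; rewrite lee_fin; exact: psiV_ge0.
have : fine (slab 1 n.+1%:R) @[n --> \oo] --> tail 1.
  apply: fine_cvg; rewrite fineK//; exact: tail_integral_fin.
move=> /cvgrPdist_le/(_ _ e0)[N _ /(_ N (leqnn _))].
have N1 : (1 : R) <= N.+1%:R by rewrite ler1n.
have fs : slab 1 N.+1%:R \is a fin_num.
  have [h1 h2] := slab_bounds 1 N.+1%:R ltr01 N1.
  by rewrite fin_numElt (lt_le_trans _ h1) ?ltNyr// (le_lt_trans h2) ?ltry.
rewrite {1}/tail (tail_integral_split _ N.+1%:R)// fineD//; last first.
  exact: tail_integral_fin.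
rewrite addrC addKr => /(le_trans (ler_norm _)) HN.
by exists N.+1%:R => // u Nu; apply: le_trans HN; exact: tail_nincr.
Qed.

Local Notation A := (funA m psi).

Lemma funAE l : 0 < l -> A l = expR (- (m * tail l)).
Proof. by move=> l0; rewrite /funA -/(tail_integral l) -(fineK (tail_integral_fin _ l0)). Qed.

Lemma funA_gt0 l : 0 < l -> 0 < A l.
Proof. by move=> l0; rewrite funAE// expR_gt0. Qed.

Lemma funA_le1 l : 0 < l -> A l <= 1.
Proof.
move=> l0; rewrite funAE// -[leRHS]expR0 ler_expR oppr_le0 mulr_ge0//.
  exact: ltW.
exact: tail_ge0.
Qed.

(** Right continuity along [n.+1%:R^-1] is what the argument on Taylor signs will ask of [1 - A]. *)
Lemma funA_right_cvg l : 0 < l ->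
  A (l + n.+1%:R^-1) @[n --> \oo] --> A l.
Proof.
move=> l0; rewrite funAE//.
rewrite (_ : (fun n => _) = (fun n => expR (- (m * tail (l + n.+1%:R^-1))))); last first.
  by apply/funext => n; rewrite funAE// addr_gt0.
apply: continuous_cvg; first exact: continuous_expR.
apply: cvgN; apply: cvgMr.
apply: (@squeeze_cvgr _ _ _ _ (fun n => tail l - n.+1%:R^-1 * (psi l)^-1) (cst (tail l))).
- apply: nearW => n.
  have c0 : (0 : R) < n.+1%:R^-1 by rewrite invr_gt0.
  have lc : l <= l + n.+1%:R^-1 by rewrite lerDl ltW.
  rewrite tail_nincr// andbT.
  have /andP[_] := tail_bounds _ _ l0 lc.
  by rewrite (_ : l + n.+1%:R^-1 - l = n.+1%:R^-1);
    [rewrite lerBlDr -lerBlDl|ring].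
- rewrite -[X in _ --> X]subr0 -(mul0r (psi l)^-1).
  apply: cvgB; first exact: cvg_cst.
  apply: cvgMl; exact: cvg_harmonic.
- exact: cvg_cst.
Qed.

(** Each dyadic interval []w / 2, w]] with [w <= 1] contributes at least [(2 psi 1)^-1], since
    [psi w <= w psi 1] by convexity. *)
Lemma tail_integral0 : tail_integral 0 = +oo%E.
Proof.
have p1 : 0 < psi 1 by exact: psi_gt0.
suff H (n : nat) : n%:R / (2 * psi 1) <= tail (2 ^- n).
  apply/eqyP => x x0.
  pose n := (Num.truncn (x * (2 * psi 1))).+1.
  have n0 : (0 : R) < 2 ^- n by rewrite invr_gt0 exprn_gt0.
  rewrite (tail_integral_split 0 (2 ^- n))//.
  apply: (@le_trans _ _ (tail_integral (2 ^- n))); last first.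
    rewrite leeDr// integral_ge0// => y; rewrite /= in_itv/= => /andP[y0 _].
    by rewrite lee_fin psiV_ge0.
  rewrite -(fineK (tail_integral_fin _ n0)) lee_fin; apply: le_trans (H n).
  by rewrite ler_pdivlMr ?mulr_gt0// ltW// truncnS_gt.
elim: n => [|n IH]; first by rewrite mul0r tail_ge0// expr0 invr1 ltr01.
set w : R := 2 ^- n; have w0 : 0 < w by rewrite invr_gt0 exprn_gt0.
have w1 : w <= 1 by rewrite invf_le1 ?exprn_gt0// exprn_ege1// ler1n.
have -> : 2 ^- n.+1 = w / 2 :> R by rewrite exprS invfM mulrC.
have w20 : 0 < w / 2 by rewrite divr_gt0.
have w2w : w / 2 <= w by lra.
have /andP[+ _] := tail_bounds _ _ w20 w2w.
suff : (2 * psi 1)^-1 <= (w - w / 2) / psi w.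
  by move: IH; rewrite -/w -[n.+1%:R]natr1 mulrDl mul1r; lra.
rewrite ler_pdivlMr ?psi_gt0// mulrC ler_pdivrMr ?mulr_gt0//.
have := psi_chord _ _ (ltW w0) w1; lra.
Qed.

Lemma funA0 : A 0 = 0.
Proof. by rewrite /funA -/(tail_integral 0) tail_integral0 gt0_muley//= lte_fin. Qed.

Lemma funA_cvg1 l : 0 <= l -> A (l + n%:R) @[n --> \oo] --> (1 : R).
Proof.
move=> l0; apply/cvgrPdist_le => e e0.
have [v v0 Hv] := tail_small (e / m) (divr_gt0 e0 m_gt0).
exists (Num.truncn v).+1 => // n /= nv.
have vn : v <= l + n%:R.
  apply: le_trans (ltW (truncnS_gt v)) _.
  by apply: (@le_trans _ _ n%:R); rewrite ?ler_nat// lerDr.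
have ln0 : 0 < l + n%:R by exact: lt_le_trans vn.
rewrite ger0_norm ?subr_ge0 ?funA_le1// funAE//.
have := expR_ge1Dx (- (m * tail (l + n%:R))).
have := Hv _ vn; rewrite ler_pdivlMr// mulrC; lra.
Qed.

Lemma funA_inj : {in `[(0 : R), +oo[%classic &, injective A}.
Proof.
suff H u v : 0 <= u -> u < v -> A u < A v.
  move=> u v; rewrite !inE/= !in_itv/= !andbT => u0 v0 uv.
  have [uv'|vu'|//] := ltgtP u v.
    by have := H _ _ u0 uv'; rewrite uv ltxx.
  by have := H _ _ v0 vu'; rewrite uv ltxx.
rewrite le_eqVlt => /predU1P[<- v0|u0 uv]; first by rewrite funA0 funA_gt0.
have v0 := lt_trans u0 uv.
rewrite !funAE// ltr_expR ltrN2 ltr_pM2l// -subr_gt0.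
have /andP[+ _] := tail_bounds _ _ u0 (ltW uv); apply: lt_le_trans.
by rewrite divr_gt0 ?subr_gt0// psi_gt0.
Qed.

(* As [psi w >= m w], the map [w |-> m * tail w + ln w] is nondecreasing up to
   second order increments, hence nondecreasing. *)
Lemma funA_chord u : 0 < u -> u <= 1 -> u * A 1 <= A u.
Proof.
move=> u0 u1; pose G w := m * tail w + ln w.
have step w v : u <= w -> w <= v -> G w - G v <= (u ^- 2) * (v - w) ^+ 2.
  move=> uw wv; have w0 := lt_le_trans u0 uw; have v0 := lt_le_trans w0 wv.
  have /andP[_ h1] := tail_bounds _ _ w0 wv.
  have h2 : m * (tail w - tail v) <= (v - w) / w.
    apply: (@le_trans _ _ (m * ((v - w) / (m * w)))); last first.
      by rewrite le_eqVlt; apply/orP; left; apply/eqP; field; rewrite !gt_eqF.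
    rewrite ler_pM2l//; apply: le_trans h1 _; rewrite ler_wpM2l ?subr_ge0//.
    by rewrite lef_pV2 ?posrE ?psi_gt0 ?mulr_gt0// psi_ge// ltW.
  have h3 : ln w - ln v <= w / v - 1.
    rewrite -ln_div ?posrE//; have := @le_ln1Dx R (w / v - 1).
    by rewrite [1 + _]addrC subrK ltrBrDl addrN divr_gt0// => /(_ isT).
  have h4 : (v - w) / w + (w / v - 1) = (w * v)^-1 * (v - w) ^+ 2.
    by field; rewrite !gt_eqF.
  apply: (@le_trans _ _ ((w * v)^-1 * (v - w) ^+ 2)).
    by rewrite -h4 /G; lra.
  rewrite ler_wpM2r ?sqr_ge0// lef_pV2 ?posrE ?mulr_gt0 ?exprn_gt0//.
  by rewrite expr2 ler_pM ?(ltW u0)// (le_trans uw).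
have sum_step (d : R) n : 0 <= d ->
    G u - G (u + n%:R * d) <= n%:R * (u ^- 2 * d ^+ 2).
  move=> d0; elim: n => [|n IH]; first by rewrite !mul0r addr0 subrr.
  have := step (u + n%:R * d) (u + n.+1%:R * d).
  rewrite lerDl mulr_ge0// => /(_ isT).
  rewrite lerD2l ler_wpM2r ?ler_nat// => /(_ isT).
  rewrite [_ + n.+1%:R * d - _](_ : _ = d); last by rewrite -natr1; ring.
  have -> : n.+1%:R * (u ^- 2 * d ^+ 2) =
      n%:R * (u ^- 2 * d ^+ 2) + u ^- 2 * d ^+ 2 by rewrite -natr1; ring.
  lra.
have GG : G u <= G 1.
  apply/ler_addgt0Pr => e e0.
  pose n := (Num.truncn (u ^- 2 * (1 - u) ^+ 2 / e)).+1.
  have n0 : (0 : R) < n%:R by rewrite ltr0n.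
  have d0 : 0 <= (1 - u) / n%:R by rewrite divr_ge0 ?subr_ge0// ltW.
  have := sum_step _ n d0.
  rewrite [u + _](_ : _ = 1); last by field; rewrite gt_eqF.
  rewrite [X in _ <= X](_ : _ = u ^- 2 * (1 - u) ^+ 2 / n%:R); last first.
    by field; rewrite !gt_eqF.
  suff : u ^- 2 * (1 - u) ^+ 2 / n%:R <= e by lra.
  rewrite ler_pdivrMr//.
  have := truncnS_gt (u ^- 2 * (1 - u) ^+ 2 / e).
  by rewrite -/n ltr_pdivrMr//; lra.
rewrite !funAE// -[X in X * _](lnK (u0 : u \in Num.pos)) -expRD ler_expR.
by move: GG; rewrite /G ln1; lra.
Qed.

Definition slope_bound l := psi (2 * l) / l.
Local Notation L := slope_bound.

Section Euler.
Context (C K : R) (b : R -> R) (e : R).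
Hypothesis C_ge0 : 0 <= C.
Hypothesis K_gt0 : 0 < K.
Hypothesis e_gt0 : 0 < e.
Hypothesis psi_approx : forall u, 0 <= u ->
    psi u - e * (u ^+ 2 + u ^+ 3) <= C * u - b u <= psi u.

Local Notation h := ((K + C)^-1).
(** The step [u - h (C u - b u)] written as a positive combination; [K] keeps the mesh [h] below
    [K^-1]. *)
Definition euler_step u := h * (K * u + b u).

Lemma euler_stepE u : euler_step u = u - h * (C * u - b u).
Proof. by rewrite /euler_step; field; rewrite gt_eqF// ltr_pwDl. Qed.

Lemma euler_step0 : euler_step 0 = 0.
Proof.
have := psi_approx 0 (lexx _).
rewrite psi0 !expr0n/= !(addr0, mulr0, subr0, sub0r) oppr0 oppr_ge0 oppr_le0 -eq_le.
by rewrite /euler_step mulr0 add0r => /eqP ->; rewrite mulr0.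
Qed.

Let h_gt0 : 0 < h. Proof. by rewrite invr_gt0 ltr_pwDl. Qed.

(* Lipschitz bound below [l], from the slope of the convex [psi] beyond [l]. *)
Lemma psi_lipschitz l u v : 0 <= u -> u <= v -> v <= l -> 0 < l ->
  psi v - psi u <= (v - u) * L l.
Proof.
move=> u0 uv vl l0; have v0 := le_trans u0 uv.
have v2l : v <= 2 * l by apply: (le_trans vl); lra.
have := psi_convex u v (2 * l) u0 uv v2l.
have p0 : 0 <= psi v by apply: le_trans (psi_ge _ v0); rewrite mulr_ge0// ltW.
move=> cvx; rewrite /slope_bound mulrA ler_pdivlMr//.
have q1 : (psi v - psi u) * (2 * l - v) <= (v - u) * psi (2 * l).
  have : 0 <= (v - u) * psi v by rewrite mulr_ge0// subr_ge0.
  lra.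
apply: le_trans q1; rewrite ler_wpM2l ?subr_ge0 ?psi_nd//; lra.
Qed.

(** [tail] is the clock of the flow: it advances at unit speed along [v' = - psi v]. With
    [s = C u - b u], a step moves it by something between [h s / psi u] and [h s / psi (u - h s)].
    Both are [h] up to the relative error [k], which covers the distance from [s] to [psi u] and the
    variation of [psi] along the step. *)
Lemma euler_step_bounds l k u : 0 < u -> u <= l ->
  e * (l + l ^+ 2) / m <= k -> 2 * h * L l <= k -> k <= 1 ->
  [/\ 0 < euler_step u, euler_step u <= u &
    `|tail (euler_step u) - tail u - h| <= h * k].
Proof.
move=> u0 ul ek Lk k1.
have l0 := lt_le_trans u0 ul.
have [u2 u3] : 0 <= u ^+ 2 /\ 0 <= u ^+ 3 by rewrite !exprn_ge0 ?ltW.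
have pu := psi_gt0 _ u0.
have /andP[lo up] := psi_approx u (ltW u0).
have Epsi : (1 - k) * psi u <= C * u - b u.
  apply: le_trans lo; rewrite mulrBl mul1r lerD2l lerN2.
  have mu_le := psi_ge u (ltW u0).
  have em0 : 0 <= e * (l + l ^+ 2) / m.
    by rewrite !mulr_ge0 ?addr_ge0 ?exprn_ge0 ?invr_ge0 ?ltW.
  apply: (@le_trans _ _ (e * (l + l ^+ 2) / m * (m * u))).
    have -> : e * (l + l ^+ 2) / m * (m * u) = e * (u * (l + l ^+ 2)).
      by field; rewrite gt_eqF.
    rewrite ler_pM2l// mulrDr lerD//.
      by rewrite expr2 ler_pM2l.
    by rewrite exprS ler_pM2l// !expr2 ler_pM// ltW.
  apply: (@le_trans _ _ (e * (l + l ^+ 2) / m * psi u)); first by rewrite ler_wpM2l.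
  by rewrite ler_wpM2r// ltW.
have s0 : 0 <= C * u - b u.
  by apply: le_trans Epsi; rewrite mulr_ge0 ?subr_ge0// ltW.
rewrite euler_stepE; move: (C * u - b u) up Epsi s0 => s up Epsi s0 {lo}.
have psl : psi u <= u * L l.
  have := psi_lipschitz l 0 u (lexx _) (ltW u0) ul l0.
  by rewrite psi0 !subr0.
have hL : h * L l <= 1 / 2 by lra.
(* At least half of [u] survives the step, so the iterates stay positive. *)
have hs : h * s <= u / 2.
  apply: (@le_trans _ _ (h * (u * L l))).
    by rewrite ler_pM2l// (le_trans up).
  rewrite mulrCA; have := ler_wpM2l (ltW u0) hL; lra.
have hs0 : 0 <= h * s by rewrite mulr_ge0// ltW.
have v0 : 0 < u - h * s by lra.
have vu : u - h * s <= u by lra.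
split => //.
have pv := psi_gt0 _ v0.
have /andP[t1 t2] := tail_bounds _ _ v0 vu.
have lip := psi_lipschitz l (u - h * s) u (ltW v0) vu ul l0.
have E : u - (u - h * s) = h * s by ring.
rewrite E in t1 t2 lip.
have pv_ge : (1 - k / 2) * psi u <= psi (u - h * s).
  have : h * s * L l <= k / 2 * psi u.
    have -> : h * s * L l = (h * L l) * s by ring.
    apply: ler_pM => //; last by lra.
    by rewrite mulr_ge0 ?ltW// divr_gt0// psi_gt0// mulr_gt0.
  lra.
have k0 : 0 <= k.
  apply: le_trans ek.
  by rewrite !mulr_ge0 ?addr_ge0 ?exprn_ge0 ?invr_ge0 ?ltW.
rewrite ler_norml; apply/andP; split.
  have : h * (1 - k) <= h * s / psi u.
    rewrite -mulrA ler_pM2l// ler_pdivlMr//.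
  lra.
have : h * s / psi (u - h * s) <= h * (1 + k).
  rewrite -mulrA ler_pM2l// ler_pdivrMr//.
  apply: (le_trans up).
  (* [(1 + k) (1 - k / 2) = 1 + k (1 - k) / 2 >= 1]. *)
  apply: (@le_trans _ _ ((1 + k) * ((1 - k / 2) * psi u))); last first.
    by rewrite ler_pM2l//; lra.
  rewrite mulrA; apply: ler_peMl; [exact: ltW|].
  have : 0 <= k * (1 - k) by rewrite mulr_ge0 ?subr_ge0.
  lra.
lra.
Qed.

Lemma euler_iter_bounds l k n : 0 < l ->
  e * (l + l ^+ 2) / m <= k -> 2 * h * L l <= k -> k <= 1 ->
  [/\ 0 < iter n euler_step l, iter n euler_step l <= l &
    `|tail (iter n euler_step l) - tail l - n%:R * h| <= n%:R * h * k].
Proof.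
move=> l0 ek Lk k1; elim: n => [|n [IH1 IH2 IH3]].
  by rewrite /= subrr mul0r subrr normr0 mul0r.
rewrite iterS; have [b1 b2 b3] := euler_step_bounds l k _ IH1 IH2 ek Lk k1.
split => //; first exact: le_trans IH2.
move: IH3 b3; rewrite !ler_norml -natr1 => /andP[? ?] /andP[? ?].
by apply/andP; split; lra.
Qed.

Lemma euler_step_bernstein : bernstein b -> bernstein euler_step.
Proof.
move=> bb; apply: bernsteinZ; first exact: ltW.
apply: bernsteinD => //; apply: bernsteinZ; first exact: ltW.
exact: bernstein_id.
Qed.

End Euler.

Hypothesis psi_euler : euler_approximable psi.

(* Schemes of mesh at most [1 / n.+1 ^ 2] run up to time about [n]: their total
   error is [O(1 / n)]. *)
Lemma exists_euler_flow (n : nat) : exists (g : R -> R) (T : R),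
  [/\ bernstein g, g 0 = 0, n%:R <= T &
    forall l, 0 < l -> (l + l ^+ 2) / m + 2 * L l <= n.+1%:R ->
     [/\ 0 < g l, g l <= l &
       `|tail (g l) - tail l - T| <= ((l + l ^+ 2) / m + 2 * L l) / n.+1%:R]].
Proof.
pose K : R := n.+1%:R ^+ 2.
have K0 : 0 < K by rewrite exprn_gt0.
have K1 : 1 <= K by rewrite exprn_ege1// ler1n.
have e0 : 0 < K^-1 by rewrite invr_gt0.
have [C [b [C0 bb Cb]]] := psi_euler _ e0.
pose h := (K + C)^-1.
have h0 : 0 < h by rewrite invr_gt0 ltr_pwDl.
have hK : h <= K^-1 by rewrite lef_pV2 ?posrE ?ltr_pwDl// lerDl.
pose N := (Num.truncn (n%:R / h)).+1.
have Nlo : n%:R <= N%:R * h.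
  by have := truncnS_gt (n%:R / h); rewrite ltr_pdivrMr// => /ltW.
have Nup : N%:R * h <= n.+1%:R.
  have : (Num.truncn (n%:R / h))%:R <= n%:R / h.
    by rewrite truncn_le divr_ge0// ltW.
  rewrite ler_pdivlMr// /N -natr1 -[n.+1%:R]natr1 mulrDl mul1r => H.
  by apply: lerD => //; apply: le_trans hK _; rewrite invf_le1.
exists (fun l => iter N (euler_step C K b) l), (N%:R * h); split => //.
- apply: bernstein_iter; exact: euler_step_bernstein.
- have E0 := euler_step0 C K b _ Cb.
  by elim: N {Nlo Nup} => //= k ->.
- move=> l l0; set c := (l + l ^+ 2) / m + 2 * L l => cn.
  have L0 : 0 <= L l by rewrite divr_ge0 ?ltW// psi_gt0// mulr_gt0.
  have l20 : 0 <= (l + l ^+ 2) / m.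
    by rewrite divr_ge0 ?addr_ge0 ?exprn_ge0 ?ltW.
  have c0 : 0 <= c by rewrite addr_ge0// mulr_ge0.
  (* [c / K] is the relative error of one step; over a time of at most [n.+1] it adds up to
     [c / n.+1], as [K = n.+1 ^ 2]. *)
  have k1 : c / K <= 1.
    rewrite ler_pdivrMr// mul1r; apply: le_trans cn _.
    by rewrite /K expr2 ler_peMl// ler1n.
  have ek : K^-1 * (l + l ^+ 2) / m <= c / K.
    rewrite -mulrA mulrC ler_wpM2r ?invr_ge0 ?(ltW K0)//.
    by rewrite lerDl mulr_ge0.
  have Lk : 2 * h * L l <= c / K.
    apply: (@le_trans _ _ (2 * L l * K^-1)).
      by rewrite [2 * h * _]mulrAC ler_wpM2l// mulr_ge0.
    by rewrite ler_wpM2r ?invr_ge0 ?(ltW K0)// lerDr.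
  have [b1 b2 b3] := euler_iter_bounds C K b _ C0 K0 e0 Cb l _ N l0 ek Lk k1.
  split => //; apply: le_trans b3 _.
  apply: (@le_trans _ _ (n.+1%:R * (c / K))).
    by rewrite ler_wpM2r// divr_ge0// ltW.
  rewrite le_eqVlt; apply/orP; left; apply/eqP; rewrite /K; field.
  by rewrite ?gt_eqF//; lra.
Qed.

(** The derivative [a] of [A] at 0 is taken as given here and comes later from the Taylor series of
    [FA]; [funA_chord] makes it positive. The times [T n] disappear because
    [A (g n l) * expR (m * T n)] tends to [A l]. *)
Lemma funA_bernstein (a : R) : A u / u @[u --> 0^'+] --> a -> 0 < a /\ bernstein A.
Proof.
move=> Aa.
have A1 : 0 < A 1 by exact: funA_gt0.
have a0 : 0 < a.
  apply: lt_le_trans A1 _; rewrite -(cvg_lim _ Aa)//.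
  apply: limr_ge; first exact: cvgP Aa.
  near=> u; rewrite ler_pdivlMr//; rewrite mulrC; apply: funA_chord => //.
  near: u; exact: nbhs_right_le.
split => //.
have /choice[g /choice[T gT]] := exists_euler_flow.
apply: (@bernstein_lim _ (fun n l => (a * expR (m * T n)) * g n l)).
  move=> n; have [gb _ _ _] := gT n; apply: bernsteinZ => //.
  by rewrite mulr_ge0 ?expR_ge0// ltW.
move=> l; rewrite le_eqVlt => /predU1P[<-|l0].
  rewrite (_ : (fun n => _) = cst 0); first by rewrite funA0; exact: cvg_cst.
  by apply/funext => n; have [_ -> _ _] := gT n; rewrite mulr0.
set c := (l + l ^+ 2) / m + 2 * L l.
have c0 : 0 <= c.
  rewrite addr_ge0// ?mulr_ge0 ?divr_ge0 ?addr_ge0 ?exprn_ge0 ?invr_ge0 ?ltW//.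
  by rewrite psi_gt0// mulr_gt0.
have Hn : \forall n \near \oo, [/\ 0 < g n l, g n l <= l &
       `|tail (g n l) - tail l - T n| <= c / n.+1%:R].
  exists (Num.truncn c) => // n /= cn; have [_ _ _ ] := gT n; apply => //.
  by apply: ltW; apply: lt_le_trans (truncnS_gt c) _; rewrite ler_nat.
have r0 : tail (g n l) - tail l - T n @[n --> \oo] --> 0.
  apply/cvgr0Pnorm_le => eps eps0; near=> n.
  have [_ _ h3] : [/\ 0 < g n l, g n l <= l &
       `|tail (g n l) - tail l - T n| <= c / n.+1%:R] by near: n.
  apply: le_trans h3 _.
  have : c / eps < n.+1%:R.
    apply: lt_le_trans (truncnS_gt _) _; rewrite ler_nat ltnS.
    near: n; exact: nbhs_infty_ge.
  by rewrite ltr_pdivrMr// ler_pdivrMr// mulrC => /ltW.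
have AE : \forall n \near \oo, A (g n l) * expR (m * T n) =
    A l * expR (- (m * (tail (g n l) - tail l - T n))).
  apply: filterS Hn => n [g0 _ _].
  by rewrite !funAE// -!expRD; congr expR; ring.
have cvA : A (g n l) * expR (m * T n) @[n --> \oo] --> A l.
  rewrite -[X in _ --> X]mulr1 -expR0 -oppr0 -(mulr0 m).
  apply: cvg_trans (_ : A l * expR (- (m * (tail (g n l) - tail l - T n)))
    @[n --> \oo] --> _).
    by apply: near_eq_cvg; apply: filterS AE => n ->.
  apply: cvgMr; apply: continuous_cvg; first exact: continuous_expR.
  by apply: cvgN; exact: cvgMr.
(* If [g n l] were at least [eps], then [tail (g n l) <= tail eps], whereas it is at least
   [tail l + n - c]. *)
have cvg0 : g n l @[n --> \oo] --> 0^'+.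
  move=> U [eps /= eps0 HU].
  pose N := maxn (Num.truncn c) (Num.truncn (tail eps + c - tail l)).+1.
  exists N => // n /= nN.
  have [g0 _ h3] : [/\ 0 < g n l, g n l <= l &
       `|tail (g n l) - tail l - T n| <= c / n.+1%:R].
    have [_ _ _] := gT n; apply => //.
    apply: ltW; apply: lt_le_trans (truncnS_gt c) _.
    by rewrite ler_nat ltnS (leq_trans _ nN)// leq_maxl.
  apply: HU => //=; rewrite sub0r normrN gtr0_norm// ltNge; apply/negP => epsg.
  have h1 := tail_nincr _ _ eps0 epsg.
  have h2 : tail eps + c - tail l < n%:R.
    apply: lt_le_trans (truncnS_gt _) _; rewrite ler_nat.
    by apply: leq_trans nN; rewrite leq_maxr.
  have h4 : n%:R <= T n by have [] := gT n.
  have h5 : c / n.+1%:R <= c by rewrite ler_pdivrMr// ler_peMr// ler1n.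
  by move: (c / n.+1%:R) h3 h5 => q; rewrite ler_norml => /andP[]; lra.
have cvr : A (g n l) / g n l @[n --> \oo] --> a by exact: cvg_comp cvg0 Aa.
have -> : A l = a * (A l / a) by field; rewrite gt_eqF.
have : a * ((A (g n l) * expR (m * T n)) / (A (g n l) / g n l)) @[n --> \oo]
   --> a * (A l / a).
  by apply: cvgMr; apply: cvgM => //; apply: cvgV => //; rewrite gt_eqF.
apply: cvg_trans; apply: near_eq_cvg; apply: filterS Hn => n [g0 _ _].
by field; rewrite !gt_eqF// funA_gt0.
Unshelve. all: by end_near. Qed.

End InverseIntegral.

Lemma funA_properties {R : realType} (m : R) (psi : R -> R) : classN m psi ->
  [/\ funA m psi 0 = 0,
      forall l, 0 < l -> 0 < funA m psi l,
      forall l, 0 < l -> funA m psi l <= 1,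
      {in `[(0 : R), +oo[%classic &, injective (funA m psi)} &
   [/\ forall l, 0 <= l -> funA m psi (l + n%:R) @[n --> \oo] --> (1 : R),
       forall l, 0 < l ->
         funA m psi (l + n.+1%:R^-1) @[n --> \oo] --> funA m psi l &
       forall a, funA m psi u / u @[u --> 0^'+] --> a ->
         0 < a /\ bernstein (funA m psi)]].
Proof.
move=> psiN; have [m0 p0 pc pg pe] := mechanism_properties m psi psiN.
have [s [Pi [_ _ _ grey _]]] := psiN.
split; [exact: funA0|exact: funA_gt0|exact: funA_le1|exact: funA_inj|].
split; [exact: funA_cvg1|exact: funA_right_cvg|exact: funA_bernstein].
Qed.

(** * Approximation in mean of Borel indicators by exponential sums *)

Section ExponentialSums.
Context {R : realType}.
Implicit Types (p q f g : R -> R).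

Definition expsum p := exists2 s : seq (R * R), nodes setT s &
  forall y, p y = ev s (expo y).

Lemma expsum_cst c : expsum (cst c).
Proof.
exists [:: (c, 0)]; first by move=> _ /predU1P[->|//].
by move=> y; rewrite /ev big_seq1 /expo mul0r oppr0 expR0 mulr1.
Qed.

Lemma expsum_expo l : 0 <= l -> expsum (fun y => expo y l).
Proof.
move=> l0; exists [:: (1, l)]; first by move=> _ /predU1P[->|//].
by move=> y; rewrite /ev big_seq1 mul1r.
Qed.

Lemma expsumB p q : expsum p -> expsum q -> expsum (fun y => p y - q y).
Proof.
move=> [s ns ps] [r nr qr]; exists (s ++ [seq (- u.1, u.2) | u <- r]).
  by move=> u; rewrite mem_cat => /orP[/ns//|/mapP[v /nr[? _] ->]].
move=> y; rewrite ps qr /ev big_cat big_map /=; congr (_ + _).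
by rewrite -sumrN; apply: eq_bigr => i _; rewrite mulNr.
Qed.

Lemma expsumM p q : expsum p -> expsum q -> expsum (fun y => p y * q y).
Proof.
move=> [s ns ps] [r nr qr].
exists [seq (u.1 * v.1, u.2 + v.2) | u <- s, v <- r].
  move=> _ /allpairsP[[u v] /= [/ns[u0 _] /nr[v0 _] ->]].
  by rewrite /= addr_ge0.
move=> y; rewrite ps qr /ev big_allpairs_dep mulr_suml; apply: eq_bigr => u _.
rewrite mulr_sumr; apply: eq_bigr => v _.
by rewrite /expo mulrDl opprD expRD /=; ring.
Qed.

Lemma expsumX p n : expsum p -> expsum (fun y => p y ^+ n).
Proof.
move=> pe; elim: n => [|n IH]; first exact: expsum_cst.
rewrite (_ : (fun y => _) = (fun y => p y * p y ^+ n)); first exact: expsumM.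
by apply/funext => y; rewrite exprS.
Qed.

Lemma measurable_expsum p : expsum p -> measurable_fun setT p.
Proof.
move=> [s _ ps]; rewrite (_ : p = (fun y => ev s (expo y))); last exact/funext.
rewrite /ev; apply: measurable_sum => u.
apply: measurable_funM => //.
by apply: continuous_measurable_fun; exact: continuous_expoM.
Qed.

Local Notation D := `[(0 : R), +oo[%classic.

Lemma halfline_ge0 y : D y -> 0 <= y.
Proof. by rewrite /= in_itv/= andbT. Qed.

Context (mu : {measure set R -> \bar R}).
Hypothesis mu_fin : (mu setT < +oo)%E.

Lemma bounded_integrable f (M : R) (E : set R) : measurable E ->
  measurable_fun setT f -> (forall y, E y -> `|f y| <= M) ->
  mu.-integrable E (EFin \o f).
Proof.
move=> mE mf fM; apply: (@le_integrable _ _ _ mu E mE _ (EFin \o cst M)).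
- by apply/measurable_EFinP; exact: measurable_funTS.
- move=> y Ey; rewrite /= lee_fin; apply: le_trans (fM y Ey) _; exact: ler_norm.
- apply/integrableP; split.
    by apply/measurable_EFinP; exact: measurable_cst.
  rewrite (eq_integral (cst (`|M|%:E))) => [|y _]; last by [].
  rewrite integral_cst// lte_mul_pinfty ?lee_fin// (le_lt_trans _ mu_fin)//.
  by apply: le_measure; rewrite ?inE//; exact: subsetT.
Qed.

(* Only test functions with values in [0, 1] are approximated, so the
   approximation comes for free with a bound on the approximants. *)
Definition expsum_approx f := [/\ measurable_fun setT f,
  (forall y, 0 <= y -> 0 <= f y <= 1) &
  forall e : R, 0 < e -> exists2 p, expsum p &
    (forall y, 0 <= y -> 0 <= p y <= 1) /\
    \int[mu]_(y in D) `|f y - p y| <= e].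

Lemma integrable_unit f : measurable_fun setT f ->
  (forall y, 0 <= y -> 0 <= f y <= 1) -> mu.-integrable D (EFin \o f).
Proof.
move=> mf f01; apply: (bounded_integrable _ 1) => // y /halfline_ge0/f01/andP[? ?].
by rewrite ger0_norm.
Qed.

Lemma integrable_dist f g : measurable_fun setT f -> measurable_fun setT g ->
  (forall y, 0 <= y -> 0 <= f y <= 1) -> (forall y, 0 <= y -> 0 <= g y <= 1) ->
  mu.-integrable D (EFin \o (fun y => `|f y - g y|)).
Proof.
move=> mf mg f01 g01; apply: integrable_unit.
  by apply: measurableT_comp => //; exact: measurable_funB.
move=> y y0; rewrite normr_ge0 ler_norml.
by have := f01 y y0; have := g01 y y0; lra.
Qed.

Lemma expsum_approx_expsum p : expsum p ->
  (forall y, 0 <= y -> 0 <= p y <= 1) -> expsum_approx p.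
Proof.
move=> pe p01; split => //; first exact: measurable_expsum.
move=> e e0; exists p => //; split => //.
rewrite (@eq_Rintegral _ _ _ _ _ (cst 0)) => [|y _]; last by rewrite subrr normr0.
by rewrite Rintegral_cst// mul0r ltW.
Qed.

Lemma expsum_approx_onem f : expsum_approx f -> expsum_approx (fun y => 1 - f y).
Proof.
move=> [mf f01 fe]; split.
- by apply: measurable_funB => //; exact: measurable_cst.
- by move=> y /f01; lra.
- move=> e e0; have [p pe [p01 pf]] := fe e e0.
  exists (fun y => 1 - p y); first exact: expsumB (expsum_cst 1) pe.
  split; first by move=> y /p01; lra.
  apply: le_trans pf; rewrite le_eqVlt; apply/orP; left; apply/eqP.
  by apply: eq_Rintegral => y _; rewrite distrC; congr (`|_|); ring.
Qed.

Lemma expsum_approxM f g : expsum_approx f -> expsum_approx g ->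
  expsum_approx (fun y => f y * g y).
Proof.
move=> [mf f01 fe] [mg g01 ge].
have M01 (u v : R) : 0 <= u <= 1 -> 0 <= v <= 1 -> 0 <= u * v <= 1.
  by move=> /andP[u0 u1] /andP[v0 v1]; rewrite mulr_ge0// mulr_ile1.
split; [exact: measurable_funM|by move=> y y0; apply: M01; [exact: f01|exact: g01]|].
move=> e e0; have e20 : 0 < e / 2 by rewrite divr_gt0.
have [p pe [p01 pf]] := fe _ e20; have [q qe [q01 qg]] := ge _ e20.
have mp := measurable_expsum _ pe; have mq := measurable_expsum _ qe.
exists (fun y => p y * q y); first exact: expsumM.
split; first by move=> y y0; apply: M01; [exact: p01|exact: q01].
have ifp := integrable_dist _ _ mf mp f01 p01.
have igq := integrable_dist _ _ mg mq g01 q01.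
have mD : measurable D by [].
apply: (@le_trans _ _ (\int[mu]_(y in D) (`|f y - p y| + `|g y - q y|))).
  apply: le_Rintegral => //.
  - apply: integrable_dist; [exact: measurable_funM|exact: measurable_funM|..].
      by move=> y y0; apply: M01; [exact: f01|exact: g01].
    by move=> y y0; apply: M01; [exact: p01|exact: q01].
  - apply: (eq_integrable mD _ _ _ (integrableD mD ifp igq)) => y _.
    by rewrite /= EFinD.
  - move=> y /halfline_ge0 y0.
    have /andP[f0 f1] := f01 y y0; have /andP[p0 p1] := p01 y y0.
    have /andP[g0 g1] := g01 y y0; have /andP[q0 q1] := q01 y y0.
    have -> : f y * g y - p y * q y = (f y - p y) * g y + p y * (g y - q y) by ring.
    apply: le_trans (ler_normD _ _) _; rewrite !normrM (ger0_norm g0) (ger0_norm p0).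
    by rewrite lerD// ?ler_piMr ?ler_piMl.
by rewrite RintegralD//; lra.
Qed.

Lemma expsum_approx_lim (F : nat -> R -> R) f : measurable_fun setT f ->
  (forall n, expsum_approx (F n)) ->
  (forall y, 0 <= y -> F n y @[n --> \oo] --> f y) -> expsum_approx f.
Proof.
move=> mf Fa Ff.
have f01 y : 0 <= y -> 0 <= f y <= 1.
  move=> y0; have cv := Ff y y0; rewrite -(cvg_lim _ cv)//; apply/andP; split.
    apply: limr_ge; first exact: cvgP cv.
    by apply: nearW => n; have [_ /(_ y y0)/andP[]] := Fa n.
  apply: limr_le; first exact: cvgP cv.
  by apply: nearW => n; have [_ /(_ y y0)/andP[]] := Fa n.
split => // e e0; have e20 : 0 < e / 2 by rewrite divr_gt0.
have mD : measurable D by [].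
have mF n : measurable_fun setT (F n) by have [] := Fa n.
have F01 n y : 0 <= y -> 0 <= F n y <= 1 by have [_ /(_ y)] := Fa n.
have cv0 : \int[mu]_(y in D) `|f y - F n y| @[n --> \oo] --> 0.
  have mE g : measurable_fun setT g -> measurable_fun D (fun y => (g y)%:E).
    by move=> mg; apply/measurable_EFinP; exact: measurable_funTS.
  have := @dominated_convergence _ _ R mu D mD
    (fun n y => (F n y)%:E) (fun y => (f y)%:E) (cst 1%:E)
    (fun n => mE _ (mF n)) (mE _ mf).
  case.
  - apply: aeW => y /halfline_ge0 y0; apply: cvg_EFin; first exact: nearW.
    exact: Ff.
  - apply: (bounded_integrable (cst 1) 1) => // y _; by rewrite normr1.
  - apply: aeW => y n /halfline_ge0 y0; have /andP[F0 F1] := F01 n y y0.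
    by rewrite lee_fin ger0_norm.
  move=> _ cv _.
  rewrite -[X in _ --> X]/(fine 0%E); apply: fine_cvg.
  apply: cvg_trans cv; apply: near_eq_cvg; apply: nearW => n.
  by apply: eq_integral => y _; rewrite -EFinB /= distrC.
have [n nF] : exists n, \int[mu]_(y in D) `|f y - F n y| <= e / 2.
  move/cvgr0Pnorm_le : cv0 => /(_ _ e20)[N _ /(_ N (leqnn _))] H.
  by exists N; apply: le_trans H; exact: ler_norm.
have [_ _ /(_ _ e20)[p pe [p01 pF]]] := Fa n.
have mp := measurable_expsum _ pe.
exists p => //; split => //.
have i1 := integrable_dist _ _ mf (mF n) f01 (F01 n).
have i2 := integrable_dist _ _ (mF n) mp (F01 n) p01.
apply: (@le_trans _ _ (\int[mu]_(y in D) (`|f y - F n y| + `|F n y - p y|))).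
  apply: le_Rintegral => //; first exact: integrable_dist.
    apply: (eq_integrable mD _ _ _ (integrableD mD i1 i2)) => y _.
    by rewrite /= EFinD.
  by move=> y _; exact: ler_distD.
by rewrite RintegralD//; lra.
Qed.

Lemma cvg_harmonic_bound (u : nat -> R) (l c : R) :
  (forall n, `|l - u n.+1| <= c / n.+1%:R) -> u n @[n --> \oo] --> l.
Proof.
move=> uc; rewrite -cvg_shiftS; apply/cvgrPdist_le => e e0.
exists (Num.truncn (c / e)) => // n /= nc; apply: le_trans (uc n) _.
have : c / e < n.+1%:R.
  by apply: lt_le_trans (truncnS_gt _) _; rewrite ler_nat ltnS.
by rewrite ltr_pdivrMr// ler_pdivrMr// mulrC => /ltW.
Qed.

Lemma bernoulli_ineq (x : R) n : 0 <= x <= 1 -> 1 - n%:R * x <= (1 - x) ^+ n.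
Proof.
move=> /andP[x0 x1]; elim: n => [|n IH]; first by rewrite mul0r subr0 expr0.
rewrite exprS -natr1; have x10 : 0 <= 1 - x by rewrite subr_ge0.
apply: le_trans (ler_wpM2l x10 IH); rewrite -subr_ge0.
rewrite (_ : _ - _ = n%:R * x ^+ 2); last by ring.
by rewrite mulr_ge0// exprn_ge0.
Qed.

(** For [a >= 0], [(1 - exp (- n y)) ^ N] with [N] about [n exp (n a)] behaves like
    [exp (- n exp (- n (y - a)))]: it tends to 1 for [y > a] and to 0 for [y < a]. The extra factor
    [n] in [N] sends the boundary [y = a] to 0 as well, as the open ray requires. *)
Lemma expsum_approx_ray (a : R) : expsum_approx \1_(`]a, +oo[).
Proof.
have mI : measurable_fun setT (\1_(`]a, +oo[) : R -> R).
  by apply: measurable_indic; exact: measurable_itv.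
have [a0|a0] := ltP a 0.
  apply: (@expsum_approx_lim (fun _ => cst 1)) => //.
    move=> n; apply: expsum_approx_expsum; first exact: expsum_cst.
    by move=> y _; rewrite /= ler01 lexx.
  move=> y y0; rewrite indicE mem_set; first exact: cvg_cst.
  by rewrite /= in_itv/= andbT (lt_le_trans a0).
pose N n := (Num.truncn (n%:R * expR (n%:R * a))).+1.
have e01 (n : nat) (y : R) : 0 <= y -> 0 <= expo y n%:R <= 1.
  move=> y0; rewrite expR_ge0/= -[leRHS]expR0 ler_expR oppr_le0.
  by rewrite mulr_ge0.
apply: (@expsum_approx_lim (fun n y => (1 - expo y n%:R) ^+ N n)) => //.
  move=> n; apply: expsum_approx_expsum.
    by apply: expsumX; apply: expsumB; [exact: expsum_cst|exact: expsum_expo].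
  move=> y /(e01 n)/andP[e0 e1]; rewrite exprn_ge0 ?subr_ge0//=.
  by rewrite exprn_ile1 ?subr_ge0// gerBl.
move=> y y0; rewrite indicE.
have [ya|ya] := ltP a y.
  rewrite mem_set; last by rewrite /= in_itv/= ya.
  have d0 : 0 < y - a by rewrite subr_gt0.
  (* Bernoulli bounds the gap by [N k * expo y k%:R <= 2 k exp (- k (y - a))], and
     [x^2 / 4 <= exp x] at [x = k (y - a)] turns this into [8 / ((y - a)^2 k)]. *)
  apply: (@cvg_harmonic_bound _ _ (8 / (y - a) ^+ 2)) => n.
  set k := n.+1; have k0 : (0 : R) < k%:R by rewrite ltr0n.
  have /andP[e0 e1] := e01 k y y0.
  rewrite ger0_norm; last by rewrite subr_ge0 exprn_ile1 ?subr_ge0// gerBl.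
  apply: (@le_trans _ _ ((N k)%:R * expo y k%:R)).
    by rewrite lerBlDr -lerBlDl; exact: bernoulli_ineq (e01 k y y0).
  have NkE : (N k)%:R * expo y k%:R <= 2 * k%:R * expR (- (k%:R * (y - a))).
    have ka1 : 1 <= k%:R * expR (k%:R * a).
      rewrite -[leLHS]mulr1 ler_pM ?ler1n// -expR0 ler_expR.
      by rewrite mulr_ge0.
    have : (N k)%:R <= 2 * (k%:R * expR (k%:R * a)).
      have : (Num.truncn (k%:R * expR (k%:R * a)))%:R <= k%:R * expR (k%:R * a).
        by rewrite truncn_le mulr_ge0// expR_ge0.
      by rewrite /N -natr1; lra.
    move=> /(ler_wpM2r e0) H; apply: le_trans H _.
    rewrite le_eqVlt; apply/orP; left; apply/eqP.
    rewrite (_ : - (k%:R * (y - a)) = k%:R * a + - (k%:R * y)); last by ring.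
    by rewrite expRD /expo; ring.
  apply: le_trans NkE _.
  set x := k%:R * (y - a); have x0 : 0 < x by rewrite mulr_gt0.
  have x2 : x ^+ 2 / 4 <= expR x.
    have -> : expR x = expR (x / 2) * expR (x / 2).
      by rewrite -expRD; congr expR; field.
    apply: (@le_trans _ _ ((x / 2) * (x / 2))).
      by rewrite le_eqVlt; apply/orP; left; apply/eqP; field.
    have H : x / 2 <= expR (x / 2) by have := expR_ge1Dx (x / 2); lra.
    have x20 : 0 <= x / 2 by rewrite divr_ge0 ?ltW.
    exact: ler_pM.
  rewrite expRN ler_pdivrMr ?expR_gt0//.
  apply: (@le_trans _ _ (8 / (y - a) ^+ 2 / k%:R * (x ^+ 2 / 4))).
    rewrite le_eqVlt; apply/orP; left; apply/eqP; rewrite /x; field.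
    by rewrite !gt_eqF.
  by rewrite ler_wpM2l// !divr_ge0 ?exprn_ge0 ?ltW.
rewrite memNset; last by rewrite /= in_itv/= andbT; apply/negP; rewrite -leNgt.
apply: (@cvg_harmonic_bound _ _ 1) => n.
set k := n.+1; have k0 : (0 : R) < k%:R by rewrite ltr0n.
have /andP[e0 e1] := e01 k y y0.
rewrite sub0r normrN ger0_norm ?exprn_ge0 ?subr_ge0//.
apply: (@le_trans _ _ (expR (- k%:R))); last first.
  rewrite expRN div1r lef_pV2 ?posrE ?expR_gt0//.
  by have := expR_ge1Dx (k%:R : R); lra.
apply: (@le_trans _ _ (expR (- expo y k%:R) ^+ N k)).
  rewrite lerXn2r ?nnegrE ?subr_ge0 ?expR_ge0//.
  by have := expR_ge1Dx (- expo y k%:R); lra.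
rewrite -expRM_natr ler_expR mulNr lerN2.
apply: (@le_trans _ _ (expo y k%:R * (k%:R * expR (k%:R * a)))); last first.
  by rewrite ler_wpM2l// ltW// truncnS_gt.
rewrite mulrCA ler_peMr// /expo -expRD -[leLHS]expR0 ler_expR.
by rewrite addrC -mulrBr mulr_ge0 ?subr_ge0// ltW.
Qed.

(** Sets with approximable indicator form a sigma-algebra: complements come from [1 - f], and a
    countable union is the complement of a limit of finite products. Open rays generate the Borel
    sets. *)
Lemma expsum_approx_measurable (E : set R) : measurable E -> expsum_approx \1_E.
Proof.
pose G : set (set R) := [set E | measurable E /\ expsum_approx \1_E].
have approxC (B : set R) : G B -> G (~` B).
  move=> [mB aB]; split; first exact: measurableC.
  have := expsum_approx_onem _ aB; congr expsum_approx; apply/funext => y.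
  by rewrite !indicE in_setC; case: (y \in B); rewrite ?subrr ?subr0.
have Gsigma : sigma_algebra setT G.
  split.
  - split; first exact: measurable0.
    rewrite indic0; apply: expsum_approx_expsum; first exact: expsum_cst.
    by move=> y _; rewrite /= lexx ler01.
  - by move=> B /approxC; rewrite setTD.
  - move=> B GB; have mB k : measurable (B k) by have [] := GB k.
    have mU : measurable (\bigcup_k B k) by exact: bigcup_measurable.
    split => //.
    pose q n (y : R) : R := \prod_(0 <= k < n) (1 - \1_(B k) y).
    apply: (@expsum_approx_lim (fun n y => 1 - q n y)).
    + exact: measurable_indic.
    + move=> n; apply: expsum_approx_onem; elim: n => [|n IH].
        rewrite (_ : q 0%N = cst 1); last first.
          by apply/funext => y; rewrite /q big_geq.
        apply: expsum_approx_expsum; first exact: expsum_cst.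
        by move=> y _; rewrite /= lexx ler01.
      rewrite (_ : q n.+1 = (fun y => q n y * (1 - \1_(B n) y))); last first.
        by apply/funext => y; rewrite /q big_nat_recr.
      by apply: expsum_approxM IH (expsum_approx_onem _ _); have [] := GB n.
    + move=> y _; rewrite indicE.
      have [yU|yU] := boolP (y \in \bigcup_k B k).
        move: yU; rewrite inE => -[k _ Bky].
        apply: cvg_near_cst; exists k.+1 => // n /= kn.
        rewrite /q (@big_cat_nat _ _ _ k.+1)//= big_nat_recr//= indicE mem_set//.
        by rewrite subrr mulr0 mul0r subr0.
      apply: cvg_near_cst; apply: nearW => n; rewrite /q big1 ?subrr// => k _.
      rewrite indicE memNset ?subr0// => Bky.
      by move/negP: yU; apply; rewrite inE; exists k.
move=> mE; suff : G E by case.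
have : (@RGenOInfty.G R).-sigma.-measurable E by rewrite -RGenOInfty.measurableE.
apply; split => // _ [a ->]; split; first exact: measurable_itv.
exact: expsum_approx_ray.
Qed.

End ExponentialSums.

(** * Total variation bounds from Laplace transforms *)

Section TotalVariation.
Context {R : realType}.
Implicit Types (mu nu : {measure set R -> \bar R}) (f : R -> R) (E : set R).
Local Notation D := `[(0 : R), +oo[%classic.

Lemma Rintegral_indic mu E : measurable E ->
  \int[mu]_(y in D) \1_E y = fine (mu (E `&` D)).
Proof. by move=> mE; rewrite /Rintegral integral_indic. Qed.

(** An approximant [p] of [\1_E] has values in [[0, 1]], so [M = 1] is allowed and [K] bounds the
    difference of its two integrals. *)
Lemma lap_bounded_tv mu nu K : (mu setT < +oo)%E -> (nu setT < +oo)%E ->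
  lap_bounded K (fun l => \int[mu]_(y in D) expo y l -
                          \int[nu]_(y in D) expo y l) ->
  forall E, measurable E ->
    `|fine (mu (E `&` D)) - fine (nu (E `&` D))| <= K.
Proof.
move=> muoo nuoo Kb E mE; apply/ler_addgt0Pr => e e0.
(* A single [p] has to be close to [\1_E] under both measures, hence the approximation under their
   sum. *)
pose tot := measure_add mu nu.
have totoo : (tot setT < +oo)%E by rewrite /tot measure_addE lte_add_pinfty.
have e20 : 0 < e / 2 by rewrite divr_gt0.
have [mI I01 /(_ _ e20)[p pe [p01 pE]]] := expsum_approx_measurable tot totoo _ mE.
have mp := measurable_expsum _ pe.
have mD : measurable D by [].
have mdist : measurable_fun D (fun y => (`|\1_E y - p y|)%:E).
  apply/measurable_EFinP; apply: measurable_funTS.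
  by apply: measurableT_comp => //; exact: measurable_funB.
have close : \int[mu]_(y in D) `|\1_E y - p y| +
             \int[nu]_(y in D) `|\1_E y - p y| <= e / 2.
  apply: le_trans pE; rewrite /Rintegral -fineD ?ge0_integral_measure_add//.
    exact: (integrable_fin_num mD (integrable_dist mu muoo _ _ mI mp I01 p01)).
  exact: (integrable_fin_num mD (integrable_dist nu nuoo _ _ mI mp I01 p01)).
have dist (m : {measure set R -> \bar R}) : (m setT < +oo)%E ->
    `|fine (m (E `&` D)) - \int[m]_(y in D) p y| <=
      \int[m]_(y in D) `|\1_E y - p y|.
  move=> moo; rewrite -Rintegral_indic// -RintegralB//; [|exact: integrable_unit..].
  apply: le_normr_Rintegral => //.
  apply: (bounded_integrable m moo _ 1) => //; first exact: measurable_funB.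
  move=> y /halfline_ge0 y0; rewrite ler_norml.
  by have := I01 y y0; have := p01 y y0; lra.
have dmu := dist mu muoo; have dnu := dist nu nuoo.
have pK : `|\int[mu]_(y in D) p y - \int[nu]_(y in D) p y| <= K.
  have [s ns ps] := pe.
  have iexp (m : {measure set R -> \bar R}) : (m setT < +oo)%E ->
      forall u, u \in s -> m.-integrable D (EFin \o (fun y => expo y u.2)).
    move=> moo u /ns[u0 _]; apply: integrable_unit => //.
      by apply: continuous_measurable_fun; exact: continuous_expoM.
    move=> y y0; rewrite expR_ge0 -[leRHS]expR0 ler_expR oppr_le0.
    by rewrite mulr_ge0.
  have pm (m : {measure set R -> \bar R}) : (m setT < +oo)%E ->
      \int[m]_(y in D) p y = ev s (fun l => \int[m]_(y in D) expo y l).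
    move=> moo; have [_ <-] := ev_Rintegral m D s mD (iexp m moo).
    by apply: eq_Rintegral => y _.
  rewrite !pm// -evB -[K]mulr1; apply: Kb => // y y0.
  by rewrite -ps; have /andP[? ?] := p01 y y0; rewrite ger0_norm.
have p1 (a b : R) : `|a - b| <= `|a| + `|b| by rewrite -(normrN b) ler_normD.
move: close dmu dnu pK; rewrite !ler_norml.
move: (\int[mu]_(y in D) `|_|) (\int[nu]_(y in D) `|_|) => a b.
move=> ab /andP[? ?] /andP[? ?] /andP[? ?]; apply/andP; split; lra.
Qed.

(** The sum counts the levels [j.+1 / N.+1] that do not exceed [v], so it is the integer part of
    [N.+1 * v]. *)
Lemma step_approx (v : R) (N : nat) : 0 <= v <= 1 ->
  `|v - N.+1%:R^-1 * \sum_(0 <= j < N.+1) (j.+1%:R <= N.+1%:R * v)%R%:R| <=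
    N.+1%:R^-1.
Proof.
move=> /andP[v0 v1]; have N0 : (0 : R) < N.+1%:R by rewrite ltr0n.
pose k := Num.truncn (N.+1%:R * v).
have /andP[k1 k2] : k%:R <= N.+1%:R * v < k.+1%:R.
  by apply: truncn_itv; rewrite mulr_ge0// ltW.
have kN : (k <= N.+1)%N.
  by rewrite -(ler_nat R); apply: le_trans k1 _; rewrite ler_piMr// ltW.
have -> : \sum_(0 <= j < N.+1) (j.+1%:R <= N.+1%:R * v)%R%:R = k%:R :> R.
  rewrite (big_cat_nat (n := k))//= [X in _ + X]big1_seq ?addr0; last first.
    move=> j; rewrite mem_index_iota => /andP[_ /andP[kj _]].
    by rewrite leNgt (lt_le_trans k2)// ler_nat ltnS.
  rewrite big_nat (eq_bigr (fun=> 1)); last first.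
    by move=> j /andP[_ jk]; rewrite (le_trans _ k1)// ler_nat.
  by rewrite -big_nat sumr_const_nat subn0.
have -> : v - N.+1%:R^-1 * k%:R = N.+1%:R^-1 * (N.+1%:R * v - k%:R).
  by rewrite mulrBr mulKf// gt_eqF.
rewrite normrM gtr0_norm ?invr_gt0// -[leRHS]mulr1 ler_pM2l ?invr_gt0//.
rewrite ger0_norm ?subr_ge0//; move: k2; rewrite -natr1; lra.
Qed.

(** Layer cake: up to [1 / N.+1], [f] is the average of [N.+1] indicators of superlevel sets, and
    averaging keeps the bound [K] of each. *)
Lemma tv_bound_integral mu nu K f : (mu setT < +oo)%E -> (nu setT < +oo)%E ->
  (forall E, measurable E -> `|fine (mu (E `&` D)) - fine (nu (E `&` D))| <= K) ->
  measurable_fun setT f -> (forall y, 0 <= y -> 0 <= f y <= 1) ->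
  `|\int[mu]_(y in D) f y - \int[nu]_(y in D) f y| <= K.
Proof.
move=> muoo nuoo EK mf f01; apply/ler_addgt0Pr => e e0.
have mD : measurable D by [].
pose T := fine (mu D) + fine (nu D).
have T0 : 0 <= T by rewrite addr_ge0// fine_ge0.
have [N NT] : exists N : nat, T / N.+1%:R <= e.
  exists (Num.truncn (T / e)); rewrite ler_pdivrMr// mulrC -ler_pdivrMr//.
  by rewrite ltW// truncnS_gt.
pose E (j : nat) : set R := [set y | j.+1%:R <= N.+1%:R * f y].
have mE j : measurable (E j).
  have mNf : measurable_fun setT (fun y => N.+1%:R * f y).
    by apply: measurable_funM => //; exact: measurable_cst.
  have := mNf measurableT _ (measurable_itv `[(j.+1%:R : R), +oo[).
  rewrite setTI; congr measurable; apply/seteqP.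
  by split => y; rewrite /= in_itv/= andbT.
pose g n (y : R) : R := \sum_(0 <= j < n) \1_(E j) y.
have gS n : g n.+1 = (fun y => g n y + \1_(E n) y).
  by apply/funext => y; rewrite /g big_nat_recr.
have mg n : measurable_fun setT (g n).
  elim: n => [|n IH]; last by rewrite gS; apply: measurable_funD => //; exact: measurable_indic.
  by rewrite (_ : g 0%N = cst 0)//; apply/funext => y; rewrite /g big_geq.
have g0 n y : 0 <= g n y <= n%:R.
  elim: n => [|n IH]; first by rewrite /g big_geq// lexx.
  rewrite gS -natr1; move: IH; rewrite indicE; case: (_ \in _) => /=; lra.
have ig (m : {measure set R -> \bar R}) n : (m setT < +oo)%E ->
    m.-integrable D (EFin \o g n).
  move=> moo; apply: (bounded_integrable m moo _ n%:R) => // y _.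
  by have /andP[? ?] := g0 n y; rewrite ger0_norm.
have ii (m : {measure set R -> \bar R}) j : (m setT < +oo)%E ->
    m.-integrable D (EFin \o \1_(E j)).
  move=> moo; apply: (bounded_integrable m moo _ 1) => //.
  by move=> y _; rewrite indicE normr_nat lern1 leq_b1.
have gK n : `|\int[mu]_(y in D) g n y - \int[nu]_(y in D) g n y| <= n%:R * K.
  elim: n => [|n IH].
    have z (m : {measure set R -> \bar R}) : \int[m]_(y in D) g 0%N y = 0.
      rewrite (@eq_Rintegral _ _ _ _ _ (cst 0)) ?Rintegral_cst ?mul0r//.
      by move=> y _; rewrite /g big_geq.
    by rewrite !z subrr normr0 mul0r.
  rewrite gS !RintegralD//; try exact: ig; try exact: ii.
  rewrite !Rintegral_indic// -natr1 mulrDl mul1r.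
  rewrite opprD addrACA; apply: le_trans (ler_normD _ _) _.
  by rewrite lerD// EK.
have near_g (m : {measure set R -> \bar R}) : (m setT < +oo)%E ->
    `|\int[m]_(y in D) f y - N.+1%:R^-1 * \int[m]_(y in D) g N.+1 y| <=
      N.+1%:R^-1 * fine (m D).
  move=> moo; have i_g := ig m N.+1 moo.
  have i_f := integrable_unit m moo _ mf f01.
  have i_cg : m.-integrable D (EFin \o (fun y => N.+1%:R^-1 * g N.+1 y)).
    by apply: (eq_integrable mD _ _ _ (integrableZl mD N.+1%:R^-1 i_g)).
  have i_fg : m.-integrable D (EFin \o (fun y => f y - N.+1%:R^-1 * g N.+1 y)).
    by apply: (eq_integrable mD _ _ _ (integrableB mD i_f i_cg)).
  rewrite -RintegralZl// -RintegralB//.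
  apply: le_trans (le_normr_Rintegral _ _) _ => //.
  rewrite -Rintegral_cst//; apply: le_Rintegral => //.
  - by have := integrable_norm i_fg; apply: eq_integrable.
  - apply: (bounded_integrable m moo _ N.+1%:R^-1) => // y _.
    by rewrite ger0_norm ?invr_ge0.
  - move=> y /halfline_ge0/f01/(step_approx _ N).
    rewrite (_ : \sum_(0 <= j < N.+1) _ = g N.+1 y)//.
    apply: eq_bigr => j _; rewrite indicE; congr ((nat_of_bool _)%:R).
    by apply/idP/idP; rewrite inE.
have n1 := near_g mu muoo; have n2 := near_g nu nuoo; have n3 := gK N.+1.
have N0 : (0 : R) < N.+1%:R^-1 by rewrite invr_gt0 ltr0n.
have n4 : `|N.+1%:R^-1 * \int[mu]_(y in D) g N.+1 y -
            N.+1%:R^-1 * \int[nu]_(y in D) g N.+1 y| <= K.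
  rewrite -mulrBr normrM gtr0_norm//.
  by rewrite -(@ler_pM2l _ N.+1%:R)// mulVKf.
move: NT; rewrite /T mulrC mulrDr.
move: n1 n2 n4; rewrite !ler_norml.
move: (N.+1%:R^-1 * \int[mu]_(y in D) g _ y) (N.+1%:R^-1 * \int[nu]_(y in D) g _ y).
move: (N.+1%:R^-1 * fine (mu D)) (N.+1%:R^-1 * fine (nu D)) => a b c d.
by move=> /andP[? ?] /andP[? ?] /andP[? ?] ?; apply/andP; split; lra.
Qed.

End TotalVariation.

(** * Real parts of holomorphic functions on the real axis *)

Section RealPart.
Context {R : realType}.

Lemma Re_cvg (f : nat -> cplx R) (l : cplx R) :
  f n @[n --> \oo] --> l -> complex.Re (f n) @[n --> \oo] --> complex.Re l.
Proof.
move=> fl; apply/cvgrPdist_le => e e0.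
have eC : 0 < (embC e : cplx R) by rewrite /embC ltcR.
move/cvgrPdist_le : fl => /(_ _ eC); apply: filterS => n H.
rewrite -lecR; apply: le_trans H; rewrite (_ : complex.Re l - _ = complex.Re (l - f n)).
  exact: normc_ge_Re.
by case: l => a b; case: (f n) => c d.
Qed.

Lemma Re_mulXr (z : cplx R) (u : R) n :
  complex.Re (z * embC u ^+ n) = complex.Re z * u ^+ n.
Proof.
have -> : embC u ^+ n = embC (u ^+ n) by rewrite /embC rmorphXn.
by case: z => a b; rewrite /embC /= mulr0 subr0.
Qed.

Lemma Re_sum (f : nat -> cplx R) n :
  complex.Re (\sum_(0 <= k < n) f k) = \sum_(0 <= k < n) complex.Re (f k).
Proof.
elim: n => [|n IH]; first by rewrite !big_geq.
by rewrite !big_nat_recr//= -IH; case: (\sum_(_ <= _ < _) _) => a b; case: (f n).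
Qed.

Lemma holomorphic_real_series (r : \bar R) (F : cplx R -> cplx R) :
  holomorphic_disc r F -> exists al : nat -> R, forall u : R, (`|u|%:E < r)%E ->
    pseries al u n @[n --> \oo] --> complex.Re (F (embC u)).
Proof.
move=> Fh; exists (fun n => complex.Re (taylor_coef F n)) => u ur.
have du : disc r (embC u : cplx R).
  by rewrite /disc/= expr0n/= addr0 sqrtr_sqr.
have [_ /Re_cvg] := Fh _ du; apply: cvg_trans; apply: near_eq_cvg.
apply: nearW => n; rewrite /pseries /series/= Re_sum.
by apply: eq_bigr => k _; rewrite Re_mulXr.
Qed.

Lemma extends_real_series (r : \bar R) (F : cplx R -> cplx R) (f : R -> R) :
  holomorphic_disc r F -> extends r F f -> exists2 al : nat -> R,
    forall u : R, (`|u|%:E < r)%E ->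
      pseries al u n @[n --> \oo] --> complex.Re (F (embC u)) &
    forall u : R, 0 <= u -> (u%:E < r)%E -> pseries al u n @[n --> \oo] --> f u.
Proof.
move=> /holomorphic_real_series[al alF] Ff; exists al => // u u0 ur.
by have := alF u; rewrite ger0_norm// => /(_ ur); rewrite Ff.
Qed.

End RealPart.

(** * Real power series near 0 *)

Section PowerSeries.
Context {R : realType}.
Implicit Types (al : nat -> R) (u q rho : R).

Lemma pseries_at0 al (l : R) : pseries al 0 n @[n --> \oo] --> l -> l = al 0%N.
Proof.
move=> cv; have cv' : pseries al 0 n @[n --> \oo] --> al 0%N.
  rewrite -cvg_shiftS; apply: cvg_near_cst; apply: nearW => n.
  rewrite /pseries /series/= big_nat_recl//= expr0 mulr1 big1 ?addr0// => k _.
  by rewrite expr0n mulr0.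
by rewrite -(cvg_lim _ cv)// (cvg_lim _ cv').
Qed.

Lemma pseries_abs_cvg al rho u : cvgn (pseries al u) ->
  0 <= rho -> rho < u -> cvgn (pseries (fun n => `|al n|) rho).
Proof.
move=> cv rho0 rhou; apply: (is_cvg_pseries_inside_norm (x := u)).
  exact: cv.
by rewrite !ger0_norm// (le_trans rho0)// ltW.
Qed.

(** Without a constant term, each [q ^ k] that occurs is at most [q], which extracts one factor [q]
    from the whole series. *)
Lemma pseries_scale_le al rho q n : al 0%N = 0 -> 0 <= q <= 1 -> 0 <= rho ->
  cvgn (pseries (fun n => `|al n|) rho) ->
  \sum_(0 <= k < n) `|al k| * (q * rho) ^+ k <=
    q * limn (pseries (fun n => `|al n|) rho).
Proof.
move=> al0 /andP[q0 q1] rho0 cv.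
apply: (@le_trans _ _ (q * pseries (fun n => `|al n|) rho n)).
  rewrite /pseries /series/= mulr_sumr; apply: ler_sum => -[|k] _.
    by rewrite al0 normr0 !mul0r mulr0.
  rewrite mulrCA ler_wpM2l// exprMn ler_wpM2r ?exprn_ge0//.
  by rewrite exprS ler_piMr// exprn_ile1.
rewrite ler_wpM2l//; apply: nondecreasing_cvgn_le => //.
by apply: nondecreasing_series => k _; rewrite mulr_ge0// exprn_ge0.
Qed.

Lemma pseries_lipschitz0 al r (h : R -> R) : 0 < r ->
  (forall u, 0 <= u < r -> pseries al u n @[n --> \oo] --> h u) ->
  exists2 rho, 0 < rho < r &
  exists C, forall u, 0 <= u <= rho -> `|h u - al 0%N| <= C * u.
Proof.
(* A third of [r] leaves [2 * rho] inside the interval, and convergence there gives absolute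
   convergence at [rho]. *)
move=> r0 hal; exists (r / 3); first by apply/andP; split; lra.
set rho := r / 3.
have rho0 : 0 < rho by rewrite /rho; lra.
have cv2 : pseries al (2 * rho) n @[n --> \oo] --> h (2 * rho).
  by apply: hal; rewrite /rho; apply/andP; split; lra.
pose al' n := if n == 0%N then 0 else al n.
have cvabs : cvgn (pseries (fun n => `|al n|) rho).
  apply: (pseries_abs_cvg _ _ (2 * rho)); [exact: cvgP cv2|lra|lra].
have cvabs' : cvgn (pseries (fun n => `|al' n|) rho).
  apply: series_le_cvg cvabs => n.
  - by rewrite mulr_ge0// exprn_ge0// ltW.
  - by rewrite mulr_ge0// exprn_ge0// ltW.
  - apply: ler_wpM2r; first by rewrite exprn_ge0// ltW.
    by rewrite /al'; case: ifP => // _; rewrite normr0.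
exists (limn (pseries (fun n => `|al' n|) rho) / rho) => u /andP[u0 urho].
have cvu : pseries al u n @[n --> \oo] --> h u.
  by apply: hal; rewrite u0 (le_lt_trans urho)// /rho; lra.
have : `|pseries al u n.+1 - al 0%N| @[n --> \oo] --> `|h u - al 0%N|.
  apply: cvg_norm; apply: cvgB; last exact: cvg_cst.
  by rewrite (cvg_shiftS (pseries al u) (nbhs (h u))).
move=> cv; rewrite -(cvg_lim _ cv)//; apply: limr_le; first exact: cvgP cv.
apply: nearW => n.
have -> : pseries al u n.+1 - al 0%N = \sum_(0 <= k < n.+1) al' k * u ^+ k.
  rewrite /pseries /series/= !big_nat_recl//= {1}/al' eqxx mul0r add0r.
  by rewrite expr0 mulr1 addrC addKr.
apply: le_trans (ler_norm_sum _ _ _) _.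
have uE : u = (u / rho) * rho by field; rewrite gt_eqF.
have q01 : 0 <= u / rho <= 1.
  by rewrite divr_ge0 ?(ltW rho0)//= ler_pdivrMr// mul1r.
have := pseries_scale_le al' rho (u / rho) n.+1 erefl q01 (ltW rho0) cvabs'.
rewrite -uE => H; rewrite [leRHS]mulrAC -mulrA [leRHS]mulrC; apply: le_trans H.
by apply: ler_sum => k _; rewrite normrM (ger0_norm (exprn_ge0 _ u0)).
Qed.

Lemma pseries_shift al u (h0 hu : R) : 0 < u -> h0 = al 0%N ->
  pseries al u n @[n --> \oo] --> hu ->
  pseries (fun n => al n.+1) u n @[n --> \oo] --> (hu - h0) / u.
Proof.
move=> u0 -> hal.
have : (pseries al u n.+1 - al 0%N) / u @[n --> \oo] --> (hu - al 0%N) / u.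
  apply: cvgMl; apply: cvgB; last exact: cvg_cst.
  by rewrite (cvg_shiftS (pseries al u) (nbhs hu)).
apply: cvg_trans; apply: near_eq_cvg; apply: nearW => n.
rewrite /pseries /series/= big_nat_recl//= expr0 mulr1 addrC addKr.
rewrite mulr_suml; apply: eq_bigr => k _; rewrite exprS.
by field; rewrite gt_eqF.
Qed.

Lemma pseries_first_order al r (h : R -> R) : 0 < r -> h 0 = al 0%N ->
  (forall u, 0 <= u < r -> pseries al u n @[n --> \oo] --> h u) ->
  (h u - h 0) / u @[u --> 0^'+] --> al 1%N.
Proof.
move=> r0 h0 hal.
pose g u := if u == 0 then al 1%N else (h u - h 0) / u.
have [rho /andP[rho0 _] [C HC]] : exists2 rho, 0 < rho < r &
    exists C, forall u, 0 <= u <= rho -> `|g u - al 1%N| <= C * u.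
  apply: (@pseries_lipschitz0 (fun n => al n.+1)) => // u /andP[u0 ur].
  rewrite /g; case: eqVneq u0 => [->|un0] u0.
    rewrite -cvg_shiftS; apply: cvg_near_cst; apply: nearW => n.
    rewrite /pseries /series/= big_nat_recl//= expr0 mulr1 big1 ?addr0// => k _.
    by rewrite expr0n mulr0.
  by apply: pseries_shift => //; [rewrite lt_def un0|apply: hal; rewrite u0].
apply/cvgrPdist_le => e e0; near=> u.
have u0 : 0 < u by [].
have -> : (h u - h 0) / u = g u by rewrite /g gt_eqF.
rewrite distrC; apply: le_trans (HC u _) _.
  rewrite ltW//=; near: u; exact: nbhs_right_le.
have C1 : 0 < `|C| + 1 by rewrite ltr_wpDl.
apply: (@le_trans _ _ ((`|C| + 1) * u)).
  by rewrite ler_wpM2r ?(ltW u0)// (le_trans (ler_norm _))// lerDl.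
rewrite -ler_pdivlMl// mulrC; near: u; apply: nbhs_right_le.
by rewrite divr_gt0.
Unshelve. all: by end_near. Qed.

End PowerSeries.

(** * Signs of the Taylor coefficients of Laplace-positive functions *)

Section TaylorSigns.
Context {R : realType}.
Implicit Types (al : nat -> R) (h : R -> R) (s : seq (R * R)).

Let c (n : nat) : R := n.+1%:R^-1.

Let c_gt0 n : 0 < c n. Proof. by rewrite invr_gt0. Qed.

Let c_cvg : c n @[n --> \oo] --> 0^'+.
Proof.
move=> U [e /= e0 eU]; exists (Num.truncn e^-1) => // n /= en.
apply: eU => //=; rewrite sub0r normrN gtr0_norm// /c.
rewrite invf_plt ?posrE//; apply: lt_le_trans (truncnS_gt _) _.
by rewrite ler_nat ltnS.
Qed.

Let c_cvg0 : c n @[n --> \oo] --> (0 : R). Proof. exact: cvg_harmonic. Qed.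

(** The node at 0 collects the constants that make the primitive vanish at [y = 0]. *)
Definition primitive_sum s : seq (R * R) :=
  (\sum_(p <- s) p.1 / p.2, 0) :: [seq (- (p.1 / p.2), p.2) | p <- s].

Lemma ev_primitive_sum s h : (forall p, p \in s -> 0 < p.2) ->
  ev (primitive_sum s) h = ev s (fun l => - ((h l - h 0) / l)).
Proof.
move=> s0; rewrite /primitive_sum ev_cons /ev big_map /= mulr_suml -big_split/=.
apply: eq_big_seq => p /s0 p0; field; exact: lt0r_neq0.
Qed.

Lemma primitive_sum_ge0 s y : (forall p, p \in s -> 0 < p.2) ->
  (forall y, 0 <= y -> 0 <= ev s (expo y)) ->
  0 <= y -> 0 <= ev (primitive_sum s) (expo y).
Proof.
move=> s0 sy y0.
apply: (@derive_ge0_ge R (fun y => ev (primitive_sum s) (expo y))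
  (fun y => ev s (expo y))) => //.
  rewrite ev_primitive_sum// /ev big1_seq// => p _.
  by rewrite !expo0 subrr mul0r oppr0 mulr0.
move=> z.
have -> : (fun y => ev (primitive_sum s) (expo y)) =
    (fun y => ev s (fun l => - ((expo y l - 1) / l))).
  apply/funext => x; rewrite ev_primitive_sum//.
  by congr ev; apply/funext => l; rewrite {2}/expo mul0r oppr0 expR0.
elim: s s0 {sy y0 y} => [|p s IH] s0.
  rewrite (_ : (fun y => _) = cst 0); last by apply/funext => x; rewrite /ev big_nil.
  rewrite /ev big_nil; exact: is_derive_cst.
have p0 : p.2 != 0 by rewrite gt_eqF// s0// mem_head.
rewrite (_ : (fun y => _) = (fun y => p.1 * - ((expo y p.2 - 1) / p.2)) +
    (fun y => ev s (fun l => - ((expo y l - 1) / l)))); last first.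
  by apply/funext => x; rewrite ev_cons.
rewrite ev_cons; apply: is_deriveD; last first.
  by apply: IH => q qs; apply: s0; rewrite inE qs orbT.
rewrite /expo; apply: is_derive_eq; rewrite /GRing.scale/=.
by field.
Qed.

(* Induction through [h |-> (h 0 - h u) / u], which shifts the Taylor
   coefficients up to sign: it preserves Laplace-positivity because the primitive
   of a nonnegative exponential sum is again one.  Nodes at [0], where the
   quotient is only a limit, are first moved to [c n]. *)
Lemma lap_pos_taylor_signs (r : R) al h : 0 < r ->
  lap_pos [set l | l < r] h ->
  (forall u, 0 <= u < r -> pseries al u n @[n --> \oo] --> h u) ->
  (forall u, 0 < u < r -> h (u + c n) @[n --> \oo] --> h u) ->
  forall n, 0 <= (-1) ^+ n * al n.
Proof.
move=> r0 hp hal hc n; elim: n al h hp hal hc => [|n IH] al h hp hal hc.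
  have -> : al 0%N = h 0.
    by rewrite (pseries_at0 al (h 0))//; apply: hal; rewrite lexx.
  rewrite expr0 mul1r; have := hp [:: (1, 0)]; rewrite /ev big_seq1 mul1r; apply.
    by move=> p; rewrite inE => /eqP ->.
  by move=> y y0; rewrite big_seq1 mul1r expR_ge0.
have h0 : h 0 = al 0%N by apply: pseries_at0; apply: hal; rewrite lexx.
pose h' u := if u == 0 then - al 1%N else - ((h u - h 0) / u).
have h'E u : 0 < u -> h' u = - ((h u - h 0) / u) by move=> u0; rewrite /h' gt_eqF.
rewrite exprS mulN1r mulNr -mulrN; apply: (IH (fun n => - al n.+1) h').
- have strict s : nodes [set l | 0 < l < r] s ->
      (forall y, 0 <= y -> 0 <= ev s (expo y)) -> 0 <= ev s h'.
    move=> ns sy; have s0 p : p \in s -> 0 < p.2 by move=> /ns[_ /andP[]].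
    rewrite (eq_ev [set l | 0 < l < r] _ _ (fun l => - ((h l - h 0) / l)) ns).
      rewrite -ev_primitive_sum//; apply: hp; last first.
        by move=> y y0; exact: primitive_sum_ge0.
      move=> p; rewrite inE => /predU1P[->/=|/mapP[q /ns[q0 /andP[_ qr]] ->]//].
      by split.
    by move=> l _ /= /andP[l0 _]; exact: h'E.
  move=> s ns sy.
  have cv : ev s (fun l => h' (l + c n)) @[n --> \oo] --> ev s h'.
    apply: (ev_cvg [set l | l < r]) => // l; rewrite le_eqVlt => /predU1P[<- _|l0 /= lr].
      rewrite /h' eqxx; apply: cvg_trans (_ : - ((h (c n) - h 0) / c n) @[n --> \oo] --> _).
        by apply: near_eq_cvg; apply: nearW => k; rewrite add0r gt_eqF.
      apply: cvgN; exact: cvg_comp c_cvg (pseries_first_order al r h r0 h0 hal).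
    rewrite h'E//; apply: cvg_trans (_ : - ((h (l + c n) - h 0) / (l + c n))
        @[n --> \oo] --> _).
      by apply: near_eq_cvg; apply: nearW => k; rewrite h'E// addr_gt0.
    apply: cvgN; apply: cvgM.
      by apply: cvgB; [apply: hc; rewrite l0 lr|exact: cvg_cst].
    apply: cvgV; first by rewrite gt_eqF.
    rewrite -[X in _ --> X]addr0; apply: cvgD; first exact: cvg_cst.
    exact: c_cvg0.
  rewrite -(cvg_lim _ cv)//; apply: limr_ge; first exact: cvgP cv.
  have near_r : \forall n \near \oo, forall p, p \in s -> p.2 + c n < r.
    elim: s ns {sy cv} => [|p s IHs] ns; first exact: nearW.
    have [_ /= pr] := ns p (mem_head _ _).
    have H1 : \forall n \near \oo, p.2 + c n < r.
      have : \forall u \near 0^'+, u < r - p.2.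
        by apply: nbhs_right_lt; rewrite subr_gt0.
      by move=> /c_cvg[K _ HK]; exists K => // k /HK /=; rewrite ltrBrDl.
    have H2 : \forall n \near \oo, forall p, p \in s -> p.2 + c n < r.
      by apply: IHs => q qs; apply: ns; rewrite inE qs orbT.
    by apply: filterS2 H1 H2 => k a1 a2 q; rewrite inE => /predU1P[->//|/a2].
  apply: filterS near_r => k kr.
  pose s' := [seq (p.1, p.2 + c k) | p <- s].
  have evs' g : ev s' g = ev s (fun l => g (l + c k)) by rewrite /ev big_map.
  rewrite -evs'; apply: strict.
    move=> _ /mapP[p ps ->] /=; have [p0 _] := ns p ps.
    by split; [rewrite addr_ge0// ltW|rewrite ltr_wpDl//= kr].
  move=> y y0; rewrite evs'.
  rewrite (eq_ev setT _ _ (fun l => expo y (c k) * expo y l)).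
  + by rewrite evZ mulr_ge0 ?expR_ge0 ?sy.
  + by move=> p /ns[].
  + by move=> l _ _; rewrite /expo mulrDl opprD expRD mulrC.
- move=> u /andP[u0 ur]; have cvu : pseries al u n @[n --> \oo] --> h u.
    by apply: hal; rewrite u0.
  move: u0; rewrite le_eqVlt => /predU1P[<-|u0].
    rewrite /h' eqxx -cvg_shiftS; apply: cvg_near_cst; apply: nearW => k.
    rewrite /pseries /series/= big_nat_recl//= expr0 mulr1 big1 ?addr0// => i _.
    by rewrite expr0n mulr0.
  rewrite h'E//.
  rewrite (_ : pseries _ u = (fun k => - pseries (fun n => al n.+1) u k)).
    by apply: cvgN; exact: pseries_shift.
  apply/funext => k; rewrite /pseries /series/= -sumrN.
  by apply: eq_bigr => i _; rewrite mulNr.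
- move=> u /andP[u0 ur]; rewrite h'E//.
  apply: cvg_trans (_ : - ((h (u + c n) - h 0) / (u + c n)) @[n --> \oo] --> _).
    by apply: near_eq_cvg; apply: nearW => k; rewrite h'E// addr_gt0.
  apply: cvgN; apply: cvgM.
    by apply: cvgB; [apply: hc; rewrite u0 ur|exact: cvg_cst].
  apply: cvgV; first by rewrite gt_eqF.
  rewrite -[X in _ --> X]addr0; apply: cvgD; first exact: cvg_cst.
  exact: c_cvg0.
Qed.

End TaylorSigns.

(** * The extension of [A] to the negative axis *)

Section ExtensionOfA.
Context {R : realType} (m : R) (psi : R -> R).
Hypothesis psiN : classN m psi.
Context (RA : \bar R) (FA : cplx R -> cplx R).
Hypothesis RA_gt0 : (0 < RA)%E.
Hypothesis FA_hol : holomorphic_disc RA FA.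
Hypothesis FA_A : extends RA FA (funA m psi).
Local Notation A := (funA m psi).

Lemma real_radius : exists2 r : R, 0 < r & (r%:E <= RA)%E.
Proof.
case: RA RA_gt0 => [r r0|_|//]; first by exists r.
by exists 1; rewrite ?leey.
Qed.

(** The first coefficient is the derivative that the Bernstein property of [A] asks for; positivity
    of [1 - A] then fixes the signs of the others. *)
Lemma funA_taylor : exists al : nat -> R,
  [/\ forall u : R, (`|u|%:E < RA)%E ->
        pseries al u n @[n --> \oo] --> complex.Re (FA (embC u)),
      al 0%N = 0, 0 < al 1%N, forall n, (-1) ^+ n * al n <= 0 &
      lap_pos setT (fun l => 1 - A l)].
Proof.
have [A0 Agt0 Ale1 _ [A1 Acv Ab]] := funA_properties m psi psiN.
have [al alF alA] := extends_real_series RA FA A FA_hol FA_A.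
have [r r0 rRA] := real_radius.
have alr u : 0 <= u < r -> pseries al u n @[n --> \oo] --> A u.
  by move=> /andP[u0 ur]; apply: alA => //; apply: lt_le_trans rRA.
have al0 : al 0%N = 0.
  by rewrite -A0; apply/esym/pseries_at0; apply: alr; rewrite lexx.
have Aal : A u / u @[u --> 0^'+] --> al 1%N.
  have := pseries_first_order al r A r0 _ alr; rewrite A0 al0 => /(_ erefl).
  by under eq_fun do rewrite subr0.
have [a0 bA] := Ab _ Aal.
have pos := bernstein_1sub A bA A1.
exists al; split => //.
pose eta n : R := (n == 0%N)%:R - al n.
have eta_cv u : 0 <= u < r -> pseries eta u n @[n --> \oo] --> 1 - A u.
  move=> /alr cv; rewrite -cvg_shiftS.
  apply: cvg_trans (_ : 1 - pseries al u n.+1 @[n --> \oo] --> _).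
    apply: near_eq_cvg; apply: nearW => n.
    rewrite /pseries /series/= !big_nat_recl//= /eta/= !expr0 !mulr1 al0.
    rewrite subr0 add0r -sumrN; congr (_ + _); apply: eq_bigr => k _.
    by rewrite sub0r mulNr.
  apply: cvgB; first exact: cvg_cst.
  by rewrite (cvg_shiftS (pseries al u) (nbhs (A u))).
have := lap_pos_taylor_signs r eta (fun l => 1 - A l) r0
  (lap_posW _ _ _ (@subsetT _ _) pos) eta_cv.
move=> H n; case: n => [|n]; first by rewrite al0 mulr0.
have := H _ n.+1; rewrite /eta/= sub0r mulrN oppr_ge0; apply.
move=> u /andP[u0 _]; apply: cvgB; [exact: cvg_cst|exact: Acv].
Qed.

(** [A = 1 - (1 - A)], and both terms have norm at most 1. *)
Lemma funA_bounded : lap_bounded 2 A.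
Proof.
have [al [_ al0 _ _ pos]] := funA_taylor.
have [A0 _ _ _ _] := funA_properties m psi psiN.
have := lap_boundedD _ _ _ _ (lap_bounded_cst 1)
  (lap_boundedZ _ (-1) _ (lap_pos_bounded _ pos)).
rewrite A0 subr0 normrN normr1 mulr1; apply: eq_lap_bounded => l _ /=.
by ring.
Qed.

(** All terms [al n * (- w) ^+ n] are nonpositive for [w >= 0], so the extension decreases as one
    moves left along the negative axis and lies below its linear term. *)
Lemma FA_negative_axis : exists2 a : R, 0 < a &
  forall u v : R, 0 <= u -> u <= v -> (v%:E < RA)%E ->
    complex.Re (FA (embC (- v))) <= complex.Re (FA (embC (- u))) /\
    complex.Re (FA (embC (- v))) <= - (a * v).
Proof.
have [al [alF al0 a0 sgn _]] := funA_taylor.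
exists (al 1%N) => // u v u0 uv vRA; have v0 := le_trans u0 uv.
have cv : pseries al (- v) n @[n --> \oo] --> complex.Re (FA (embC (- v))).
  by apply: alF; rewrite normrN ger0_norm.
have cu : pseries al (- u) n @[n --> \oo] --> complex.Re (FA (embC (- u))).
  by apply: alF; rewrite normrN ger0_norm// (le_lt_trans _ vRA)// lee_fin.
have term w n : al n * (- w) ^+ n = (-1) ^+ n * al n * w ^+ n.
  by rewrite exprNn; ring.
rewrite -(cvg_lim _ cv)// -(cvg_lim _ cu)//; split.
  apply: ler_lim; [exact: cvgP cv|exact: cvgP cu|].
  apply: nearW => n; apply: ler_sum => k _ /=.
  rewrite !term; apply: ler_wnM2l => //.
  by rewrite lerXn2r// nnegrE.
apply: limr_le; first exact: cvgP cv.
exists 2%N => // -[|[|n]]//= _.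
rewrite /pseries /series/= !big_nat_recl//= al0 mul0r add0r expr1.
rewrite mulrN gerDl; apply: sumr_le0 => k _.
by rewrite term mulr_le0_ge0// exprn_ge0.
Qed.

(** For a finite radius, monotonicity makes the limit exist and the linear bound at [- r / 2] keeps
    it away from 0. For an infinite radius the linear bound forces the limit [-oo]. *)
Lemma A_at_minus_lt0 : (A_at_minus RA FA < 0)%E.
Proof.
have [a a0 HA] := FA_negative_axis.
rewrite /A_at_minus; case: RA RA_gt0 HA => [r r0|_|//] HA.
- rewrite lte_fin in r0.
  have r20 : 0 < r / 2 by rewrite divr_gt0.
  apply: (@le_lt_trans _ _ (- (a * (r / 2)))%:E); last first.
    by rewrite lte_fin oppr_lt0 mulr_gt0.
  apply: lime_le.
    apply: nondecreasing_at_right_is_cvge; near=> x => u v.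
    rewrite !in_itv/= => /andP[u1 u2] /andP[v1 v2] uv.
    have x0 : x <= 0 by near: x; apply: nbhs_right_le; rewrite oppr_lt0.
    have := HA (- v) (- u); rewrite !opprK => H; rewrite lee_fin; apply H.
    + by rewrite oppr_ge0 (le_trans (ltW v2)).
    + by rewrite lerN2.
    + by rewrite lte_fin ltrNl.
  near=> u; have ur : u < - (r / 2).
    by near: u; apply: nbhs_right_lt; lra.
  have nur : - r < u by [].
  have := HA (- u) (- u); rewrite opprK lee_fin => H.
  apply: le_trans (H _ _ _).2 _ => //.
  + lra.
  + by rewrite lte_fin ltrNl.
  + by rewrite lerN2 ler_pM2l//; lra.
- suff -> : lim ((complex.Re (FA (embC u)))%:E @[u --> -oo%R]) = -oo%E by [].
  apply: cvg_lim => //; apply/cvgeNyPle => M; near=> u.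
  have u0 : u <= 0 by near: u; exact: nbhs_ninfty_le.
  have := HA (- u) (- u); rewrite oppr_ge0 opprK lee_fin => H.
  apply: le_trans (H u0 _ (ltry _)).2 _ => //.
  rewrite mulrN opprK -ler_pdivlMl//; near: u; exact: nbhs_ninfty_le.
Unshelve. all: by end_near. Qed.

End ExtensionOfA.

(** * Limits of probabilities, uniform over Borel sets *)

Section UniformLimit.
Context {R : realType} (p : nat -> {measure set R -> \bar R}) (r : nat -> R).
Hypothesis p1 : forall n, p n setT = 1%E.
Hypothesis r0 : r n @[n --> \oo] --> (0 : R).
Hypothesis pr : forall n k E, measurable E ->
  `|fine (p n E) - fine (p k E)| <= r n + r k.

Let q n E := fine (p n E).

Let pE n E : measurable E -> p n E = (q n E)%:E.
Proof.
move=> mE; rewrite /q fineK// ge0_fin_numE// (@le_lt_trans _ _ 1%E) ?ltry//.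
by rewrite -(p1 n); apply: le_measure; rewrite ?inE//; exact: subsetT.
Qed.

(* The absolute value only matters for sets that are not measurable. *)
Let v (E : set R) : R := `|limn (fun n => q n E)|.

Let q_cvg E : measurable E -> q n E @[n --> \oo] --> v E.
Proof.
move=> mE.
have cv : cvgn (fun n => q n E).
  apply: cauchy_cvg; apply: cauchy_exP => e e0.
  have e3 : 0 < e / 3 by rewrite divr_gt0.
  move/cvgr0Pnorm_le : r0 => /(_ _ e3)[N _ HN].
  exists (q N E); exists N => // n /= Nn; rewrite /ball/=.
  apply: le_lt_trans (pr N n E mE) _.
  have := HN N (leqnn _); have := HN n Nn; rewrite /= !ler_norml.
  by move=> /andP[? ?] /andP[? ?]; lra.
rewrite /v ger0_norm//; apply: limr_ge => //; apply: nearW => n.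
by rewrite /q fine_ge0.
Qed.

Let q_dist n E : measurable E -> `|q n E - v E| <= r n.
Proof.
move=> mE.
have cv : `|q n E - q k E| @[k --> \oo] --> `|q n E - v E|.
  by apply: cvg_norm; apply: cvgB; [exact: cvg_cst|exact: q_cvg].
have cr : r n + r k @[k --> \oo] --> r n.
  by rewrite -[X in _ --> X]addr0; apply: cvgD => //; exact: cvg_cst.
rewrite -(cvg_lim _ cv)// -(cvg_lim _ cr)//.
apply: ler_lim; [exact: cvgP cv|exact: cvgP cr|].
by apply: nearW => k; exact: pr.
Qed.

Let V (E : set R) : \bar R := (v E)%:E.

Let V0 : V set0 = 0%E.
Proof.
rewrite /V -(cvg_lim _ (q_cvg _ measurable0))//; congr (_%:E).
rewrite (_ : (fun n => q n set0) = cst 0) ?lim_cst//.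
by apply/funext => n; rewrite /q measure0.
Qed.

Let V_ge0 E : (0 <= V E)%E. Proof. by rewrite lee_fin; exact: normr_ge0. Qed.

Let v_sum (F : (set R)^nat) N : (forall i, measurable (F i)) -> trivIset setT F ->
  \sum_(0 <= i < N) v (F i) = v (\big[setU/set0]_(i < N) F i).
Proof.
move=> mF tF.
have cv1 : \sum_(0 <= i < N) q n (F i) @[n --> \oo] --> \sum_(0 <= i < N) v (F i).
  elim: N => [|N IH].
    by rewrite big_geq//; under eq_fun do rewrite big_geq//; exact: cvg_cst.
  rewrite big_nat_recr//=; under eq_fun do rewrite big_nat_recr//=.
  by apply: cvgD => //; exact: q_cvg.
have cv2 : q n (\big[setU/set0]_(i < N) F i) @[n --> \oo] -->
    v (\big[setU/set0]_(i < N) F i).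
  by apply: q_cvg; apply: bigsetU_measurable => i _; exact: mF.
have E : (fun n => \sum_(0 <= i < N) q n (F i)) =
    (fun n => q n (\big[setU/set0]_(i < N) F i)).
  apply/funext => n; rewrite big_mkord [RHS]/q measure_bigsetU//.
  rewrite (eq_bigr (fun i : 'I_N => (q n (F i))%:E)) ?sumEFin// => i _.
  exact: pE.
by rewrite -(cvg_lim _ cv2)// -E (cvg_lim _ cv1).
Qed.

(** The bound [r n] is uniform in the set, so countable additivity of a single [p n] passes to the
    limit with three errors of [e / 3]. *)
Let V_sigma_additive : semi_sigma_additive V.
Proof.
move=> F mF tF mU; rewrite /V.
have -> : (fun n => \sum_(0 <= i < n) (v (F i))%:E)%E =
    (fun n => (v (\big[setU/set0]_(i < n) F i))%:E).
  by apply/funext => n; rewrite -v_sum// sumEFin.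
apply: cvg_EFin; first exact: nearW.
apply/cvgrPdist_le => e e0; have e3 : 0 < e / 3 by rewrite divr_gt0.
have [n rn] : exists n, r n <= e / 3.
  move/cvgr0Pnorm_le : r0 => /(_ _ e3)[N _ /(_ N (leqnn _))] H.
  by exists N; apply: le_trans H; exact: ler_norm.
have cvp : q n (\big[setU/set0]_(i < N) F i) @[N --> \oo] --> q n (\bigcup_i F i).
  have := @measure_semi_sigma_additive _ _ _ (p n) F mF tF mU.
  rewrite (pE n) //; move=> /fine_cvg; apply: cvg_trans.
  apply: near_eq_cvg; apply: nearW => N /=.
  by rewrite /q measure_bigsetU// big_mkord.
move/cvgrPdist_le : cvp => /(_ _ e3); apply: filterS => N H.
have d1 := q_dist n _ mU.
have d2 : `|q n (\big[setU/set0]_(i < N) F i) - v (\big[setU/set0]_(i < N) F i)| <= r n.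
  by apply: q_dist; apply: bigsetU_measurable => i _; exact: mF.
move: H d1 d2; rewrite /= !ler_norml => /andP[? ?] /andP[? ?] /andP[? ?].
by apply/andP; split; lra.
Qed.

Lemma uniform_limit_probability : exists W : probability R R,
  forall n E, measurable E -> `|fine (p n E) - fine (W E)| <= r n.
Proof.
pose W0 : {measure set R -> \bar R} :=
  HB.pack V (isMeasure.Build _ _ _ V V0 V_ge0 V_sigma_additive).
have WT : W0 setT = 1%E.
  rewrite /W0/= /V -(cvg_lim _ (q_cvg _ measurableT))//; congr (_%:E).
  rewrite (_ : (fun n => q n setT) = cst 1) ?lim_cst//.
  by apply/funext => n; rewrite /q p1.
pose W : probability R R := HB.pack (Measure.sort W0)
  (Measure_isProbability.Build _ _ _ (Measure.sort W0) WT).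
by exists W => n E mE; exact: q_dist.
Qed.

End UniformLimit.

(** Convexity of the exponential between 0 and [K], obtained from its tangent at [q * K]. *)
Lemma expR_sub1_le {R : realType} (q K : R) : 0 <= q <= 1 ->
  expR (q * K) - 1 <= q * expR K.
Proof.
move=> /andP[q0 q1].
have e1 : expR (q * K) * (1 + (1 - q) * K) <= expR K.
  have -> : expR K = expR (q * K) * expR ((1 - q) * K).
    by rewrite -expRD; congr expR; ring.
  by rewrite ler_wpM2l ?expR_ge0// expR_ge1Dx.
have e2 : expR (q * K) * (1 - q * K) <= 1.
  apply: (@le_trans _ _ (expR (q * K) * expR (- (q * K)))).
    by rewrite ler_wpM2l ?expR_ge0//; exact: expR_ge1Dx.
  by rewrite -expRD subrr expR0.
have := ler_wpM2l q0 e1.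
have q10 : 0 <= 1 - q by rewrite subr_ge0.
have := ler_wpM2l q10 e2.
lra.
Qed.

(** * Test functions in [C0] and bounded integrands *)

Section BoundedTests.
Context {R : realType}.
Implicit Types (mu nu : {measure set R -> \bar R}) (f : R -> R).
Local Notation D := `[(0 : R), +oo[%classic.

Lemma C0_measurable f : C0 f -> measurable_fun setT (f \_ D).
Proof.
move=> [cf _]; apply/(measurable_restrictT f) => //.
by apply: subspace_continuous_measurable_fun.
Qed.

Lemma C0_bounded f : C0 f -> exists2 M : R, 0 < M & forall y, 0 <= y -> `|f y| <= M.
Proof.
move=> [cf f0]; move/cvgr0Pnorm_le : f0 => /(_ 1 ltr01)[N [_ HN]].
pose b := Num.max 0 N + 1.
have b0 : 0 <= b by rewrite addr_ge0// le_max lexx.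
have cb : {within `[0, b], continuous f}.
  apply: continuous_subspaceW cf => y; rewrite /= !in_itv/= andbT.
  by move=> /andP[].
have [c1 _ H1] := EVT_max b0 cb; have [c2 _ H2] := EVT_min b0 cb.
exists (`|f c1| + `|f c2| + 1) => [|y y0].
  by rewrite ltr_wpDl// addr_ge0.
have [yb|yb] := leP y b.
  have yI : y \in `[0, b] by rewrite in_itv/= y0.
  have := H1 y yI; have := H2 y yI; rewrite ler_norml.
  have := ler_norm (f c1); have := ler_norm (- f c2); rewrite normrN.
  have := normr_ge0 (f c1); have := normr_ge0 (f c2).
  by move=> *; apply/andP; split; lra.
apply: (@le_trans _ _ 1).
  apply: HN => /=; apply: le_lt_trans yb.
  by apply: (@le_trans _ _ (Num.max 0 N)); rewrite ?le_max ?lexx ?orbT// lerDl.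
by rewrite lerDr addr_ge0.
Qed.

Lemma tv_bound_bounded mu nu K f M : (mu D = 1)%E -> (nu D = 1)%E ->
  (mu setT < +oo)%E -> (nu setT < +oo)%E ->
  (forall E, measurable E -> `|fine (mu (E `&` D)) - fine (nu (E `&` D))| <= K) ->
  measurable_fun setT (f \_ D) -> 0 < M -> (forall y, 0 <= y -> `|f y| <= M) ->
  `|\int[mu]_(y in D) f y - \int[nu]_(y in D) f y| <= 2 * M * K.
Proof.
move=> mu1 nu1 muoo nuoo EK mf M0 fM.
(* [g] rescales [f] from [[- M, M]] to [[0, 1]]; both measures have mass 1 on the half-line, so the
   shift by [M] cancels in the difference. *)
pose g y := (2 * M)^-1 * ((f \_ D) y + M).
have M20 : 0 < 2 * M by rewrite mulr_gt0.
have mg : measurable_fun setT g.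
  by apply: measurable_funM => //; apply: measurable_funD.
have fD y : 0 <= y -> (f \_ D) y = f y.
  by move=> y0; rewrite patchE mem_set//= in_itv/= y0.
have g01 y : 0 <= y -> 0 <= g y <= 1.
  move=> y0; rewrite /g fD//; have := fM y y0; rewrite ler_norml => /andP[h1 h2].
  rewrite mulr_ge0 ?invr_ge0 ?(ltW M20)//=; last by lra.
  by rewrite ler_pdivrMl// mulr1; lra.
have gE (m : {measure set R -> \bar R}) : (m D = 1)%E -> (m setT < +oo)%E ->
    \int[m]_(y in D) g y = (2 * M)^-1 * (\int[m]_(y in D) f y + M).
  move=> m1 moo; have mD : measurable D by [].
  have i1 : m.-integrable D (EFin \o (f \_ D)).
    apply: (bounded_integrable m moo _ M) => // y /halfline_ge0 y0.
    by rewrite fD// fM.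
  have i2 : m.-integrable D (EFin \o cst M).
    by apply: (bounded_integrable m moo _ M) => // y _; rewrite /= ger0_norm// ltW.
  have i3 : m.-integrable D (EFin \o (fun y => (f \_ D) y + cst M y)).
    by apply: (eq_integrable mD _ _ _ (integrableD mD i1 i2)).
  rewrite RintegralZl// RintegralD// Rintegral_cst// m1 mulr1.
  congr (_ * (_ + _)); apply: eq_Rintegral => y; rewrite inE => /halfline_ge0.
  exact: fD.
have := tv_bound_integral mu nu K g muoo nuoo EK mg g01.
rewrite !gE// -mulrBr normrM gtr0_norm ?invr_gt0// ler_pdivrMl//.
by rewrite opprD addrACA subrr addr0.
Qed.

Lemma C0_expo l : 0 < l -> C0 (fun y : R => expo y l).
Proof.
move=> l0; split; first by apply: continuous_subspaceT; exact: continuous_expoM.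
rewrite /expo; apply/cvgr0Pnorm_le => e e0.
have [N [_ HN]] := (cvgr0Pnorm_le _).1 (@cvgr_expR R) e e0.
exists (N / l); split; first exact: num_real.
move=> y; rewrite ltr_pdivrMr// => /HN; rewrite mulrC.
exact.
Qed.

Lemma lap_bounded_laplace mu : (mu D <= 1)%E ->
  lap_bounded 1 (fun l => \int[mu]_(y in D) expo y l).
Proof.
move=> mu1.
have mD : measurable D by [].
have iD l : 0 <= l -> mu.-integrable D (EFin \o (fun y => expo y l)).
  move=> l0; apply: (le_integrable mD _ _ (_ : mu.-integrable D (cst 1%E))).
  - apply/measurable_EFinP; apply: measurable_funTS.
    by apply: continuous_measurable_fun; exact: continuous_expoM.
  - move=> y /halfline_ge0 y0; rewrite /= lee_fin normr1 ger0_norm ?expR_ge0//.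
    by rewrite /expo -[leRHS]expR0 ler_expR oppr_le0 mulr_ge0.
  - apply/integrableP; split; first exact: measurable_cst.
    rewrite (eq_integral (cst 1%E)) ?integral_cst// ?mul1e.
      by apply: le_lt_trans mu1 _; exact: ltry.
    by move=> y _; rewrite /= normr1.
have := lap_pos_bounded _ (lap_pos_Rintegral mu D mD halfline_ge0 iD).
apply: lap_boundedW.
rewrite (@eq_Rintegral _ _ _ _ _ (cst 1)) ?Rintegral_cst ?mul1r//.
  by rewrite -lee_fin fineK// ge0_fin_numE// (le_lt_trans mu1)// ltry.
by move=> y _; exact: expo_at0.
Qed.

End BoundedTests.

(** * Convergence of the CBI semigroup and its invariant measure *)

Section CBI.
Context {R : realType} (m : R) (psi phi : R -> R).
Hypothesis psiN : classN m psi.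
Context (RA : \bar R) (FA : cplx R -> cplx R).
Hypothesis RA_gt0 : (0 < RA)%E.
Hypothesis FA_hol : holomorphic_disc RA FA.
Hypothesis FA_A : extends RA FA (funA m psi).
Context (R0 : R).
Hypothesis R0_gt0 : 0 < R0.
Hypothesis B_hol : holomorphic_ext R0%:E (funB m psi).
Hypothesis PhiB_hol : holomorphic_ext R0%:E
  (fun z => Phi_nu psi phi (funB m psi z)).
Context (P : R -> R.-spker R ~> R).
Hypothesis P_cbi : cbi_semigroup m psi phi P.
Implicit Types (t s x l rho q : R) (E : set R).

Local Notation D := `[(0 : R), +oo[%classic.
Local Notation A := (funA m psi).
Local Notation B := (funB m psi).
Local Notation Phi := (Phi_nu psi phi).

Definition laplace t x l := \int[P t x]_(y in D) expo y l.

Let m_gt0 : 0 < m.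
Proof. by have [] := mechanism_properties m psi psiN. Qed.

Let A_range l : 0 <= l -> 0 <= A l <= 1.
Proof.
have [A0 Agt0 Ale1 _ _] := funA_properties m psi psiN.
rewrite le_eqVlt => /predU1P[<-|l0]; first by rewrite A0 lexx ler01.
by rewrite (ltW (Agt0 _ l0)) Ale1.
Qed.

Let A0 : A 0 = 0. Proof. by have [] := funA_properties m psi psiN. Qed.

Let B0 : B 0 = 0.
Proof.
have [_ _ _ inj _] := funA_properties m psi psiN.
rewrite -{1}A0 /funB; apply: (@pinvKV _ _ _ _ _ inj).
by rewrite inE/= in_itv/= lexx.
Qed.

Let Phi0 : Phi 0 = 0.
Proof. by rewrite /Phi_nu set_itv1 Rintegral_set1. Qed.

Lemma laplaceE t x l : 0 <= t -> 0 <= x -> 0 <= l -> laplace t x l =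
  expR (- Phi l) * expR (- (x * B (A l * expR (- (m * t))))
                        + Phi (B (A l * expR (- (m * t))))).
Proof. exact: P_cbi.2. Qed.

Let P_le1 t x : (P t x setT <= 1)%E.
Proof. exact: sprob_kernel_le1. Qed.

Lemma cbi_finite t x : (P t x setT < +oo)%E.
Proof. by apply: le_lt_trans (P_le1 t x) _; exact: ltry. Qed.

Lemma cbi_halfline_le1 t x : (P t x D <= 1)%E.
Proof.
apply: le_trans (P_le1 t x); apply: le_measure; rewrite ?inE//.
Qed.

(** Conservativeness is read off the Laplace formula at [l = 0], where [A], [B] and [Phi] vanish;
    the kernels are a priori only sub-Markov. *)
Lemma cbi_halfline t x : 0 <= t -> 0 <= x -> P t x D = 1%E.
Proof.
move=> t0 x0; have := laplaceE t x 0 t0 x0 (lexx _).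
rewrite A0 mul0r B0 Phi0 mulr0 oppr0 addr0 expR0 mulr1.
rewrite /laplace (@eq_Rintegral _ _ _ _ _ (cst 1)); last first.
  by move=> y _; exact: expo_at0.
rewrite Rintegral_cst// mul1r => PD.
by rewrite -(fineK (_ : P t x D \is a fin_num)) ?PD// ge0_fin_numE//
  (le_lt_trans (cbi_halfline_le1 t x))// ltry.
Qed.

Lemma restrict_halfline (mu : {measure set R -> \bar R}) E : measurable E ->
  mu `]-oo, 0[%classic = 0%E -> mu (E `&` D) = mu E.
Proof.
move=> mE mu0; rewrite (measureDI mu mE (measurable_itv _ : measurable D)).
rewrite [X in (X + _)%E](_ : _ = 0%E) ?add0e//.
apply: (@subset_measure0 _ _ _ mu _ `]-oo, 0[%classic) => //.
  exact: measurableD.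
by move=> y [_] /=; rewrite !in_itv/= andbT => /negP; rewrite -ltNge.
Qed.

Let series_ext (f : R -> R) : holomorphic_ext R0%:E f -> f 0 = 0 ->
  exists2 al : nat -> R, al 0%N = 0 &
    forall u, 0 <= u < R0 -> pseries al u n @[n --> \oo] --> f u.
Proof.
move=> [F Fh Ff] f0; have [al _ H] := extends_real_series _ F f Fh Ff.
have alf u : 0 <= u < R0 -> pseries al u n @[n --> \oo] --> f u.
  by move=> /andP[u0 uR]; apply: H => //; rewrite lte_fin.
exists al => //; rewrite -f0; apply/esym/pseries_at0; apply: alf.
by rewrite lexx.
Qed.

(* The function [e^(Phi l) P_t e_l x] is [exp (sum_k g_k e^(-mkt) A(l)^k)],
   and [A^k] has norm at most [2^k]. *)
Lemma laplace_bound rho : 0 < rho < R0 -> exists beta kappa : R,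
  [/\ 0 <= beta, 0 <= kappa & forall t x q, 0 <= t -> 0 <= x -> 0 <= q <= 1 ->
    2 * expR (- (m * t)) = q * rho ->
    lap_bounded (q * expR (x * beta + kappa))
      (fun l => expR (- (x * B (A l * expR (- (m * t))))
                        + Phi (B (A l * expR (- (m * t))))) - 1)].
Proof.
move=> /andP[rho0 rhoR].
have [be be0 beB] := series_ext _ B_hol B0.
have [ph ph0 phB] := series_ext _ PhiB_hol (etrans (congr1 Phi B0) Phi0).
have abs_cvg (al : nat -> R) (f : R -> R) : (forall u, 0 <= u < R0 -> pseries al u n @[n --> \oo] --> f u) ->
    cvgn (pseries (fun n => `|al n|) rho).
  move=> H; apply: (pseries_abs_cvg _ _ ((rho + R0) / 2)); [|lra|lra].
  have h : 0 <= (rho + R0) / 2 < R0 by apply/andP; split; lra.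
  exact: cvgP (H _ h).
have cbe := abs_cvg _ _ beB; have cph := abs_cvg _ _ phB.
have lim_ge0 al : cvgn (pseries (fun n => `|al n|) rho) ->
    0 <= limn (pseries (fun n => `|al n|) rho).
  move=> cv; apply: limr_ge => //; apply: nearW => n.
  by apply: sumr_ge0 => k _; rewrite mulr_ge0// exprn_ge0// ltW.
exists (limn (pseries (fun n => `|be n|) rho)),
  (limn (pseries (fun n => `|ph n|) rho)); split; [exact: lim_ge0|exact: lim_ge0|].
move=> t x q t0 x0 q01 tq.
set z := expR (- (m * t)); have z0 : 0 < z by exact: expR_gt0.
set K := x * _ + _.
have zR : z < R0.
  have : q * rho <= rho by case/andP: q01 => ? ?; rewrite ler_piMl// ltW.
  by rewrite -tq -/z; lra.
suff hb : lap_bounded (q * K) (fun l => - (x * B (A l * z)) + Phi (B (A l * z))).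
  apply: lap_boundedW (lap_bounded_expR_sub1 _ _ hb).
  exact: expR_sub1_le.
pose g k := - (x * be k) + ph k.
(* Since [2 z = q rho], the [k]-th term has norm at most [|g k| (q rho)^k]; both series start at
   order 1, which yields the factor [q]. *)
pose S N := \sum_(0 <= k < N) (`|g k * z ^+ k| * 2 ^+ k).
have Sle N : S N <= q * K.
  apply: (@le_trans _ _ (x * (\sum_(0 <= k < N) `|be k| * (q * rho) ^+ k) +
      \sum_(0 <= k < N) `|ph k| * (q * rho) ^+ k)).
    rewrite mulr_sumr -big_split/=; apply: ler_sum => k _.
    rewrite normrM (ger0_norm (exprn_ge0 _ (ltW z0))) -mulrA -exprMn.
    rewrite [z * 2]mulrC tq mulrA -mulrDl; apply: ler_wpM2r.
      by rewrite -tq exprn_ge0// mulr_ge0// expR_ge0.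
    apply: le_trans (ler_normD _ _) _; rewrite lerD2r normrN normrM.
    by rewrite ger0_norm.
  have h1 := pseries_scale_le be rho q N be0 q01 (ltW rho0) cbe.
  have h2 := pseries_scale_le ph rho q N ph0 q01 (ltW rho0) cph.
  have := ler_wpM2l x0 h1; rewrite /K; lra.
apply: (@lap_bounded_lim _ (fun=> q * K) (q * K)
    (fun N l => \sum_(0 <= k < N) (g k * z ^+ k) * A l ^+ k)).
- move=> N; apply: lap_boundedW (Sle N) _; apply: lap_bounded_sum => k.
  apply: lap_boundedZ; apply: lap_boundedX.
  exact: funA_bounded psiN RA FA RA_gt0 FA_hol FA_A.
- exact: cvg_cst.
- move=> l l0; have /andP[a0 a1] := A_range l l0.
  have w01 : 0 <= A l * z < R0.
    rewrite mulr_ge0 ?(ltW z0)//= (le_lt_trans _ zR)//.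
    by rewrite ler_piMl// ltW.
  have cx : x * pseries be (A l * z) n @[n --> \oo] --> x * B (A l * z).
    by apply: cvgMr; exact: beB.
  rewrite (_ : (fun N => _) =
      (fun N => - (x * pseries be (A l * z) N) + pseries ph (A l * z) N)).
    by apply: cvgD; [exact: cvgN|exact: phB].
  apply/funext => N; rewrite /pseries /series/= mulr_sumr -sumrN -big_split/=.
  by apply: eq_bigr => k _; rewrite /g exprMn; ring.
Qed.

Lemma laplace_cvg x l : 0 <= x -> 0 <= l ->
  laplace n%:R x l @[n --> \oo] --> expR (- Phi l).
Proof.
move=> x0 l0.
have [be be0 beB] := series_ext _ B_hol B0.
have [ph ph0 phB] := series_ext _ PhiB_hol (etrans (congr1 Phi B0) Phi0).
pose w n := A l * expR (- (m * n%:R)).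
have /andP[a0 a1] := A_range l l0.
have w_ge0 n : 0 <= w n by rewrite mulr_ge0 ?expR_ge0.
have w_cvg : w n @[n --> \oo] --> (0 : R).
  apply: (@cvg_harmonic_bound _ _ _ m^-1) => n.
  rewrite sub0r normrN ger0_norm//.
  have mn : 0 < m * n.+1%:R by rewrite mulr_gt0.
  apply: (@le_trans _ _ (expR (- (m * n.+1%:R)))).
    by rewrite ler_piMl ?expR_ge0.
  rewrite expRN -invfM lef_pV2 ?posrE ?expR_gt0//.
  by apply: le_trans (expR_ge1Dx _); rewrite lerDr.
have cv0 (al : nat -> R) (f : R -> R) : al 0%N = 0 ->
    (forall u, 0 <= u < R0 -> pseries al u n @[n --> \oo] --> f u) ->
    f (w n) @[n --> \oo] --> (0 : R).
  move=> al0 alf.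
  have [rho /andP[rho0 _] [C]] := pseries_lipschitz0 al R0 f R0_gt0 alf.
  rewrite al0 => HC; apply/cvgr0Pnorm_le => e e0; near=> n.
  have wrho : w n <= rho.
    by apply: le_trans (ler_norm _) _; near: n; move/cvgr0Pnorm_le : w_cvg; apply.
  have := HC (w n); rewrite subr0 w_ge0 wrho => /(_ isT) H; apply: le_trans H _.
  have C1 : 0 < `|C| + 1 by rewrite ltr_wpDl.
  apply: (@le_trans _ _ ((`|C| + 1) * w n)).
    by rewrite ler_wpM2r// (le_trans (ler_norm _))// lerDl.
  rewrite -ler_pdivlMl//; apply: le_trans (ler_norm _) _.
  near: n; move/cvgr0Pnorm_le : w_cvg; apply.
  by rewrite mulr_gt0// invr_gt0.
have cvB := cv0 _ _ be0 beB; have cvPhi := cv0 _ _ ph0 phB.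
have : expR (- Phi l) * expR (- (x * B (w n)) + Phi (B (w n))) @[n --> \oo] -->
    expR (- Phi l) * 1.
  apply: cvgMr; rewrite -expR0; apply: continuous_cvg; first exact: continuous_expR.
  rewrite -[X in _ --> X]addr0; apply: cvgD => //.
  by rewrite -oppr0 -(mulr0 x); apply: cvgN; exact: cvgMr.
rewrite mulr1; apply: cvg_trans; apply: near_eq_cvg; apply: nearW => n.
by rewrite laplaceE.
Unshelve. all: by end_near. Qed.

(** The bound is inherited from the transforms of sub-probabilities that converge to this function.
    Multiplying by it carries [laplace_bound] over to [laplace t x l - expR (- Phi l)]. *)
Lemma expR_Phi_bounded : lap_bounded 1 (fun l => expR (- Phi l)).
Proof.
apply: (@lap_bounded_lim _ (fun=> 1) 1 (fun n l => laplace n%:R 0 l)).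
- by move=> n; apply: lap_bounded_laplace; exact: cbi_halfline_le1.
- exact: cvg_cst.
- by move=> l l0; exact: laplace_cvg.
Qed.

Lemma cbi_restrict t x E : 0 <= t -> 0 <= x -> measurable E ->
  P t x (E `&` D) = P t x E.
Proof.
by move=> t0 x0 mE; apply: restrict_halfline => //; exact: (feller_support P_cbi.1).
Qed.

Lemma cbi_total t x : 0 <= t -> 0 <= x -> P t x setT = 1%E.
Proof. by move=> t0 x0; rewrite -cbi_restrict// setTI cbi_halfline. Qed.

Lemma expR_small rho : 0 < rho -> exists n0, forall n, (n0 <= n)%N ->
  2 * expR (- (m * n%:R)) <= rho.
Proof.
move=> rho0; exists (Num.truncn (2 / rho / m)).+1 => n n0n.
have h : 2 / rho < m * n%:R.
  rewrite [m * _]mulrC -ltr_pdivrMr//; apply: lt_le_trans (truncnS_gt _) _.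
  by rewrite ler_nat.
rewrite expRN ler_pdivrMr ?expR_gt0// [rho * _]mulrC -ler_pdivrMr//.
by apply: le_trans (ltW h) _; apply: le_trans (expR_ge1Dx _); rewrite lerDr.
Qed.

(** All [P t x] are compared with the same target [exp (- Phi)], so two of them differ by the sum of
    their errors. The limit along integer times from [0] is therefore the limit from every [x], and
    the error left is that of [P t x] alone. *)
Lemma cbi_limit rho : 0 < rho < R0 -> exists beta kappa (V : probability R R),
  [/\ 0 <= beta, 0 <= kappa, V `]-oo, 0[%classic = 0%E &
   forall t x E, 0 <= t -> 0 <= x -> 2 * expR (- (m * t)) <= rho ->
     measurable E -> `|fine (P t x E) - fine (V E)| <=
       2 * expR (- (m * t)) / rho * expR (x * beta + kappa)].
Proof.
move=> rhoR; have /andP[rho0 _] := rhoR.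
have [beta [kappa [beta0 kappa0 bound]]] := laplace_bound _ rhoR.
pose eta t x := 2 * expR (- (m * t)) / rho * expR (x * beta + kappa).
have dist t x : 0 <= t -> 0 <= x -> 2 * expR (- (m * t)) <= rho ->
    lap_bounded (eta t x) (fun l => laplace t x l - expR (- Phi l)).
  move=> t0 x0 tr.
  have q01 : 0 <= 2 * expR (- (m * t)) / rho <= 1.
    by rewrite ler_pdivrMr// mul1r tr divr_ge0 ?mulr_ge0 ?expR_ge0// ltW.
  have qE : 2 * expR (- (m * t)) = 2 * expR (- (m * t)) / rho * rho.
    by rewrite divfK// gt_eqF.
  have := lap_boundedM _ _ _ _ expR_Phi_bounded (bound t x _ t0 x0 q01 qE).
  rewrite mul1r; apply: eq_lap_bounded => l l0.
  by rewrite laplaceE// mulrBr mulr1.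
have tv t x s y E : 0 <= t -> 0 <= x -> 0 <= s -> 0 <= y ->
    2 * expR (- (m * t)) <= rho -> 2 * expR (- (m * s)) <= rho -> measurable E ->
    `|fine (P t x E) - fine (P s y E)| <= eta t x + eta s y.
  move=> t0 x0 s0 y0 tr sr mE.
  rewrite -(cbi_restrict t x)// -(cbi_restrict s y)//.
  apply: lap_bounded_tv => //; try exact: cbi_finite.
  have := lap_boundedD _ _ _ _ (dist t x t0 x0 tr)
    (lap_boundedZ _ (-1) _ (dist s y s0 y0 sr)).
  rewrite normrN normr1 mul1r; apply: eq_lap_bounded => l l0.
  by rewrite /laplace; ring.
(* Times start at [n0], so that the estimate applies from the first index on. *)
have [n0 Hn0] := expR_small _ rho0.
pose p n : {measure set R -> \bar R} := P (n + n0)%:R 0.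
pose r n := eta (n + n0)%:R 0.
have nr n : 2 * expR (- (m * (n + n0)%:R)) <= rho by apply: Hn0; exact: leq_addl.
have r_cvg : r n @[n --> \oo] --> (0 : R).
  apply: (@cvg_harmonic_bound _ _ _ (2 / rho * expR kappa / m)) => n.
  have r0 : 0 <= r n.+1.
    by rewrite /r /eta mulr_ge0 ?expR_ge0// divr_ge0 ?(ltW rho0)// mulr_ge0 ?expR_ge0.
  rewrite sub0r normrN ger0_norm// /r /eta mul0r add0r.
  have mn : 0 < m * n.+1%:R by rewrite mulr_gt0.
  have -> : 2 * expR (- (m * (n.+1 + n0)%:R)) / rho * expR kappa =
    2 / rho * expR kappa * expR (- (m * (n.+1 + n0)%:R)) by ring.
  rewrite -[leRHS]mulrA ler_wpM2l ?mulr_ge0 ?expR_ge0 ?invr_ge0 ?(ltW rho0)//.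
  rewrite expRN -invfM lef_pV2 ?posrE ?expR_gt0//.
  apply: le_trans (expR_ge1Dx _).
  by rewrite ler_wpDl// ler_wpM2l ?(ltW m_gt0)// ler_nat leq_addr.
have [V HV] : exists V : probability R R,
    forall n E, measurable E -> `|fine (p n E) - fine (V E)| <= r n.
  apply: uniform_limit_probability => //.
    by move=> n; exact: cbi_total.
  by move=> n k E mE; apply: tv.
have limit t x E : 0 <= t -> 0 <= x -> 2 * expR (- (m * t)) <= rho ->
    measurable E -> `|fine (P t x E) - fine (V E)| <= eta t x.
  move=> t0 x0 tr mE.
  have cv : eta t x + r n + r n @[n --> \oo] --> eta t x.
    rewrite -[X in _ --> X]addr0 -[X in _ --> X]addr0.
    by apply: cvgD => //; apply: cvgD => //; exact: cvg_cst.
  rewrite -[leRHS](cvg_lim _ cv)//; apply: limr_ge; first exact: cvgP cv.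
  apply: nearW => n.
  have h2 := HV n E mE.
  have h1 : `|fine (P t x E) - fine (p n E)| <= eta t x + r n by exact: tv.
  apply: le_trans (ler_distD (fine (p n E)) _ _) _.
  by rewrite lerD.
exists beta, kappa, V; split => //.
apply/eqP; rewrite -(fineK (_ : V `]-oo, 0[%classic \is a fin_num)); last first.
  exact: fin_num_measure.
rewrite eqe; apply/eqP/normr0_eq0/eqP; rewrite eq_le normr_ge0 andbT.
have Vr n : `|fine (V `]-oo, (0 : R)[%classic)| <= r n.
  have := HV n _ (measurable_itv `]-oo, (0 : R)[).
  by rewrite /p (feller_support P_cbi.1)//= sub0r normrN.
have : `|fine (V `]-oo, (0 : R)[%classic)| <= limn r.
  by apply: limr_ge; [exact: cvgP r_cvg|exact: nearW].
by rewrite (cvg_lim _ r_cvg).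
Qed.

Section Limit.
Context (rho beta kappa : R) (V : probability R R).
Hypothesis rho_gt0 : 0 < rho.
Hypothesis V_neg : V `]-oo, 0[%classic = 0%E.
Hypothesis V_lim : forall t x E, 0 <= t -> 0 <= x ->
  2 * expR (- (m * t)) <= rho -> measurable E ->
  `|fine (P t x E) - fine (V E)| <=
    2 * expR (- (m * t)) / rho * expR (x * beta + kappa).

Lemma halfline_prob (W : probability R R) : W `]-oo, 0[%classic = 0%E -> W D = 1%E.
Proof.
move=> W0; have := restrict_halfline W setT measurableT W0.
by rewrite setTI => ->; exact: probability_setT.
Qed.

Lemma cbi_integral_cvg (f : R -> R) t : 0 <= t -> C0 f ->
  \int[P (n%:R + t) 0]_(y in D) f y @[n --> \oo] --> \int[V]_(y in D) f y.
Proof.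
move=> t0 fC0; have [M M0 fM] := C0_bounded _ fC0.
have mf := C0_measurable _ fC0.
have [n0 Hn0] := expR_small _ rho_gt0.
pose K n := 2 * expR (- (m * n%:R)) / rho * expR kappa.
have e_cvg : expR (- (m * n%:R)) @[n --> \oo] --> (0 : R).
  apply: (@cvg_harmonic_bound _ _ _ m^-1) => n.
  rewrite sub0r normrN ger0_norm ?expR_ge0//.
  have mn : 0 < m * n.+1%:R by rewrite mulr_gt0.
  rewrite expRN -invfM lef_pV2 ?posrE ?expR_gt0//.
  by apply: le_trans (expR_ge1Dx _); rewrite lerDr.
have K_cvg : 2 * M * K n @[n --> \oo] --> (0 : R).
  rewrite -(mulr0 (2 * M)); apply: cvgMr.
  rewrite -(mul0r (expR kappa)); apply: cvgMl.
  rewrite -(mul0r rho^-1); apply: cvgMl.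
  by rewrite -(mulr0 2); exact: cvgMr.
apply/cvgrPdist_le => e e0; near=> n.
have nt0 : 0 <= n%:R + t by rewrite addr_ge0.
have le_e : expR (- (m * (n%:R + t))) <= expR (- (m * n%:R)).
  by rewrite ler_expR lerN2 ler_pM2l// lerDl.
have small : 2 * expR (- (m * n%:R)) <= rho.
  by apply: Hn0; near: n; exact: nbhs_infty_ge.
have bound E : measurable E ->
    `|fine (P (n%:R + t) 0 (E `&` D)) - fine (V (E `&` D))| <= K n.
  move=> mE; have mED : measurable (E `&` D) by exact: measurableI.
  apply: le_trans (V_lim _ 0 _ nt0 (lexx _) _ mED) _.
    by apply: le_trans small; rewrite ler_pM2l.
  rewrite mul0r add0r /K ler_wpM2r ?expR_ge0// ler_wpM2r ?invr_ge0 ?(ltW rho_gt0)//.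
  by rewrite ler_pM2l.
rewrite distrC.
apply: le_trans (tv_bound_bounded _ _ (K n) f M _ _ _ _ bound mf M0 fM) _.
- by apply: cbi_halfline.
- exact: halfline_prob.
- exact: cbi_finite.
- by apply: le_lt_trans (probability_le1 _ measurableT) (ltry _).
apply: le_trans (ler_norm _) _; near: n.
by move/cvgr0Pnorm_le : K_cvg; apply.
Unshelve. all: by end_near. Qed.

(** By the semigroup property [P_n (P_t f) 0 = P_(n + t) f 0]; the two sides converge to the
    integrals of [P_t f] and of [f] against [V]. *)
Lemma cbi_invariant : invariant_measure P V.
Proof.
split => // t f t0 fC0.
have c1 := cbi_integral_cvg _ 0 (lexx _) (feller_C0 P_cbi.1 t0 fC0).
have c2 := cbi_integral_cvg f t t0 fC0.
have E : (fun n : nat => \int[P (n%:R + 0) 0]_(y in D) semigroup_op P t f y) =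
    (fun n : nat => \int[P (n%:R + t) 0]_(y in D) f y).
  apply/funext => n; rewrite addr0; apply/esym.
  exact: (feller_comp P_cbi.1).
by rewrite E in c1; rewrite -(cvg_lim _ c1)// (cvg_lim _ c2).
Qed.

(** Invariance lets [W] be tested on [P_n e_l], which tends pointwise to the constant
    [exp (- Phi l)]; dominated convergence concludes. *)
Lemma invariant_laplace (W : probability R R) l : invariant_measure P W ->
  0 <= l -> \int[W]_(y in D) expo y l = expR (- Phi l).
Proof.
move=> [W0 Winv]; have WD := halfline_prob _ W0.
(* [expo y 0] is the constant 1 and lies outside [C0], so [l = 0] uses the total mass instead. *)
rewrite le_eqVlt => /predU1P[<-|l0].
  rewrite Phi0 oppr0 expR0 (@eq_Rintegral _ _ _ _ _ (cst 1)).
    by rewrite Rintegral_cst// mul1r; exact: (congr1 fine WD).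
  by move=> y _; exact: expo_at0.
have l0' := ltW l0.
have inv n : \int[W]_(x in D) laplace n%:R x l = \int[W]_(y in D) expo y l.
  by rewrite -(Winv n%:R _ (ler0n _ _) (C0_expo _ l0)).
have mD : measurable D by [].
have cv : \int[W]_(x in D) laplace n%:R x l @[n --> \oo] -->
    \int[W]_(x in D) expR (- Phi l).
  pose G n (x : R) : R := expR (- Phi l) *
    expR (- (x * B (A l * expR (- (m * n%:R)))) + Phi (B (A l * expR (- (m * n%:R))))).
  have GE n x : D x -> laplace n%:R x l = G n x.
    by move=> /halfline_ge0 x0; rewrite laplaceE.
  have mG n : measurable_fun D (fun x => (G n x)%:E).
    apply/measurable_EFinP; apply: measurable_funTS.
    apply: measurable_funM => //; apply: measurableT_comp => //.
    apply: measurable_funD => //; apply: measurable_funN.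
    exact: measurable_funM.
  have G01 n x : D x -> `|G n x| <= 1.
    move=> Dx; rewrite -GE//.
    have := lap_bounded_laplace (P n%:R x) (cbi_halfline_le1 _ _) [:: (1, l)] 1.
    rewrite mulr1 {2}/ev big_seq1 mul1r; apply.
      by move=> p; rewrite inE => /eqP ->.
    move=> y y0; rewrite /ev big_seq1 mul1r ger0_norm ?expR_ge0//.
    by rewrite /expo -[leRHS]expR0 ler_expR oppr_le0 mulr_ge0.
  rewrite (_ : (fun n => _) = (fun n => \int[W]_(x in D) G n x)); last first.
    by apply/funext => n; apply: eq_Rintegral => x; rewrite inE; exact: GE.
  have i1 : W.-integrable D (cst (1%E : \bar R)).
    apply: (bounded_integrable W _ (cst 1) 1) => //.
      exact: le_lt_trans (probability_le1 _ measurableT) (ltry _).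
    by move=> y _; rewrite /= normr1.
  have := @dominated_convergence _ _ R W D mD
    (fun n x => (G n x)%:E) (cst (expR (- Phi l))%:E) (cst 1%E) mG
    (measurable_cst _).
  case=> //.
  - apply: aeW => x Dx; apply: cvg_EFin; first exact: nearW.
    apply: cvg_trans (laplace_cvg x l (halfline_ge0 _ Dx) l0').
    by apply: near_eq_cvg; apply: nearW => n; rewrite /= GE.
  - by apply: aeW => x n Dx; rewrite lee_fin; exact: G01.
  move=> _ _ cvI; apply: fine_cvg; rewrite fineK.
    exact: cvI.
  rewrite integral_cst//; apply: fin_numM => //.
  exact: fin_num_measure.
move: cv; under eq_fun do rewrite inv.
move=> /cvg_lim; rewrite lim_cst// => ->//.
by rewrite Rintegral_cst// -[RHS]mulr1; congr (_ * _); exact: (congr1 fine WD).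
Qed.

(** Two invariant measures have the same Laplace transform, so the difference of transforms has norm
    0 and [lap_bounded_tv] applies with [K = 0]. *)
Lemma invariant_unique (W : probability R R) : invariant_measure P W ->
  forall E, measurable E -> W E = V E.
Proof.
move=> Winv E mE; have Vinv := cbi_invariant.
rewrite -(restrict_halfline W E mE Winv.1) -(restrict_halfline V E mE Vinv.1).
have mED : measurable (E `&` D) by exact: measurableI.
have fin (U : probability R R) : U (E `&` D) \is a fin_num by exact: fin_num_measure.
suff fE : fine (W (E `&` D)) = fine (V (E `&` D)).
  by apply: (etrans (esym (fineK (fin W)))); rewrite fE; exact: (fineK (fin V)).
apply/eqP; rewrite -subr_eq0 -normr_le0.
apply: (lap_bounded_tv W V 0) => //.
- exact: le_lt_trans (probability_le1 _ measurableT) (ltry _).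
- exact: le_lt_trans (probability_le1 _ measurableT) (ltry _).
- have := lap_bounded_cst (0 : R); rewrite normr0; apply: eq_lap_bounded => l l0.
  have := invariant_laplace _ l Winv l0; have := invariant_laplace _ l Vinv l0.
  by move=> hV hW; apply/esym/eqP; rewrite subr_eq0; apply/eqP; exact: etrans hW (esym hV).
Qed.

End Limit.
End CBI.

Theorem proposition1p4 (R : realType) (m : R) (psi phi : R -> R)
    (psiN : classN m psi) (phiB : classB phi)
    (* radius of convergence and holomorphic extension of A *)
    (RA : \bar R) (FA : cplx R -> cplx R)
    (RA_gt0 : (0 < RA)%E) (FA_H : calH RA FA)
    (FA_A : extends RA FA (funA m psi))
    (* the number R_0 *)
    (R0 : R) (R0_gt0 : 0 < R0) (R0_le1 : R0 <= 1)
    (B_hol : holomorphic_ext R0%:E (funB m psi))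
    (PhiB_hol : holomorphic_ext R0%:E
       (fun z => Phi_nu psi phi (funB m psi z)))
    (G_hol : forall x, 0 <= x -> holomorphic_ext R0%:E (funG m psi phi x))
    (P : R -> R.-spker R ~> R) (P_cbi : cbi_semigroup m psi phi P) :
  exists V : probability R R,
    [/\ invariant_measure P V,
        forall V' : probability R R, invariant_measure P V' ->
          forall E : set R, measurable E -> V' E = V E
      & exists C B : R, [/\ 0 < C, 0 < B &
          forall x t : R, 0 <= x -> (T_lower m R0 RA FA < t%:E)%E ->
            let q := expR (- (m * (t - fine (T_lower m R0 RA FA)))) in
            (tv_norm (fun E => P t x E - V E) <=
             (C * expR (B * x) * (q / (1 - q)))%:E)%E]].
Proof.
have [m0 _ _ _ _] := mechanism_properties m psi psiN.
have FA_hol := FA_H.1.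
have := A_at_minus_lt0 m psi psiN RA FA RA_gt0 FA_hol FA_A.
set L := A_at_minus RA FA => L0.
(* [d = - A(- R_A)] when this is finite; otherwise [T_lower] is infinite. *)
have [d d0 dL] : exists2 d : R, 0 < d & forall r, L = r%:E -> d = - r.
  case: L L0 => [r r0|//|_]; last by exists 1.
  by exists (- r) => [|_ [->]//]; rewrite oppr_gt0.
have d20 : 0 < 1 + d / 2 by rewrite addr_gt0// divr_gt0.
pose rho := R0 / (1 + d / 2).
have rho0 : 0 < rho by rewrite divr_gt0.
have rhoR : 0 < rho < R0.
  by rewrite rho0 ltr_pdivrMr// ltr_pMr// ltrDl divr_gt0.
have [beta [kappa [V [beta0 kappa0 V_neg V_lim]]]] :=
  cbi_limit m psi phi psiN RA FA RA_gt0 FA_hol FA_A R0 R0_gt0 B_hol PhiB_hol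
    P P_cbi rho rhoR.
exists V; split.
- by apply: (cbi_invariant m psi phi psiN P P_cbi rho beta kappa V).
- by apply: (invariant_unique m psi phi psiN R0 R0_gt0 B_hol PhiB_hol P P_cbi rho beta kappa V).
(* The [+ 1] makes the rate positive even when [beta = 0]. *)
exists (expR kappa), (beta + 1); split; [exact: expR_gt0|exact: ltr_wpDl|].
move=> x t x0; rewrite /T_lower -/L.
case EL : L L0 => [r||] // => [|_].
  rewrite lte_fin => r0.
  have dE : d = - r by exact: dL.
  have r20 : 0 < 2 - r by rewrite subr_gt0 (lt_trans r0).
  rewrite -EFinB lne_EFin// -EFinM -EFinD lte_fin /= => Tt.
  set T := T_zero m R0 + m^-1 * ln (2 - r) in Tt *.
  have T0 : 0 <= T.
    rewrite addr_ge0//.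
      by rewrite /T_zero divr_ge0 ?(ltW m0)// oppr_ge0 ln_le0.
    by rewrite mulr_ge0 ?invr_ge0 ?(ltW m0)// ln_ge0//; lra.
  have t0 : 0 <= t by rewrite (le_trans T0)// ltW.
  set q := expR (- (m * (t - T))).
  have q1 : q < 1 by rewrite -expR0 ltr_expR oppr_lt0 mulr_gt0// subr_gt0.
  have q0 : 0 < q by exact: expR_gt0.
  (* [rho] was chosen for this identity: [exp (m T) = (2 - r) / R0 = 2 / rho]. *)
  have qE : q = 2 * expR (- (m * t)) / rho.
    have -> : q = expR (- (m * t)) * expR (- ln R0) * expR (ln (2 - r)).
      rewrite -!expRD; congr expR; rewrite /T /T_zero; field.
      by rewrite gt_eqF.
    have -> : expR (- ln R0) = R0^-1 by rewrite expRN lnK ?posrE.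
    rewrite lnK ?posrE// /rho dE; field.
    by rewrite !gt_eqF//; lra.
  apply: ub_ereal_sup => _ [E [mE ED] <-].
  have lim := V_lim t x E t0 x0.
  have Pfin : P t x E \is a fin_num.
    rewrite ge0_fin_numE// (le_lt_trans _ (cbi_finite P t x))//.
    by apply: le_measure; rewrite ?inE//; exact: subsetT.
  have Vfin : V E \is a fin_num by exact: fin_num_measure.
  rewrite -(fineK Pfin) -(fineK Vfin) -EFinB abse_EFin lee_fin.
  apply: le_trans (lim _ mE) _.
    (* [q < 1], that is [t > T], implies the condition [2 exp (- m t) <= rho] of the estimate. *)
    by move: q1; rewrite qE ltr_pdivrMr// mul1r => /ltW.
  rewrite -qE expRD.
  have -> : q * (expR (x * beta) * expR kappa) = expR kappa * expR (x * beta) * q.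
    by ring.
  apply: ler_pM; rewrite ?(ltW q0) ?mulr_ge0 ?expR_ge0//.
    by rewrite ler_wpM2l ?expR_ge0// ler_expR mulrC ler_wpM2r// lerDl.
  rewrite ler_pdivlMr ?subr_gt0// ler_piMr ?(ltW q0)//; lra.
(* When [A(- R_A) = -oo] the threshold is [+oo], and no real [t] exceeds it. *)
by rewrite /= gt0_muley ?lte_fin ?invr_gt0// ltNge leey.
Qed.
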